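(* Let $(M,\varphi_i,\xi_i,\eta_i,g)$ be a $3$-$(\alpha,\delta)$-Sasaki manifold and let $\pi\colon M\to N$ be its (locally defined) canonical submersion. Then the base $(N,g_N)$ carries a quaternionic Kähler structure, given by $$\check\varphi_i=\pi_*\circ\varphi_i\circ s_*,\qquad i=1,2,3,$$ where $s\colon U\to M$ is any local smooth section of $\pi$ over an open set $U\subset N$. The covariant derivatives of the almost complex structures $\check\varphi_i$ with respect to the Levi-Civita connection $\nabla^{g_N}$ are given, for every even permutation $(ijk)$ of $(123)$ and every tangent vector $X$ of $U$, by $$\nabla^{g_N}_X\check\varphi_i=2\delta\big(\check\eta_k(X)\check\varphi_j-\check\eta_j(X)\check\varphi_k\big),$$ where $\check\eta_i(X)=\eta_i(s_*X)$ for $i=1,2,3$.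
   Context: An almost contact metric structure $(\varphi,\xi,\eta,g)$ on an odd-dimensional manifold consists of a $(1,1)$-tensor field $\varphi$, a vector field $\xi$, a $1$-form $\eta$ and a Riemannian metric $g$ with $\varphi^2=-I+\eta\otimes\xi$, $\eta(\xi)=1$, $\varphi\xi=0$, $\eta\circ\varphi=0$, $g(\varphi X,\varphi Y)=g(X,Y)-\eta(X)\eta(Y)$. An almost $3$-contact metric manifold $(M,\varphi_i,\xi_i,\eta_i,g)$ is a manifold of dimension $4n+3$ with three almost contact metric structures $(\varphi_i,\xi_i,\eta_i,g)$, $i=1,2,3$, sharing the metric $g$, such that for every even permutation $(ijk)$ of $(123)$: $\varphi_k=\varphi_i\varphi_j-\eta_j\otimes\xi_i=-\varphi_j\varphi_i+\eta_i\otimes\xi_j$, $\xi_k=\varphi_i\xi_j=-\varphi_j\xi_i$, $\eta_k=\eta_i\circ\varphi_j=-\eta_j\circ\varphi_i$. Put $\mathcal V=\langle\xi_1,\xi_2,\xi_3\rangle$, $\mathcal H=\bigcap_i\ker\eta_i$ (so $TM=\mathcal H\oplus\mathcal V$ orthogonally) and $\Phi_i(X,Y)=g(X,\varphi_iY)$. It is a $3$-$(\alpha,\delta)$-Sasaki manifold, with real constants $\alpha\neq0$ and $\delta$, if $d\eta_i=2\alpha\Phi_i+2(\alpha-\delta)\eta_j\wedge\eta_k$ for every even permutation $(ijk)$ of $(123)$. Conventions: $d\eta(X,Y)=X(\eta(Y))-Y(\eta(X))-\eta([X,Y])$ and $(\eta\wedge\eta')(X,Y)=\eta(X)\eta'(Y)-\eta(Y)\eta'(X)$.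 The canonical submersion of $M$ is the locally defined Riemannian submersion $\pi\colon M\to N$ onto a Riemannian manifold $(N,g_N)$ whose vertical distribution $\ker\pi_*$ is $\mathcal V$ (here $M$ stands for a sufficiently small open subset on which $\pi$ is defined, with connected fibres). A quaternionic Kähler structure on $(N,g_N)$ is a rank-$3$ subbundle $Q\subset\mathrm{End}(TN)$, parallel under $\nabla^{g_N}$, which is locally spanned by $g_N$-orthogonal almost complex structures $J_1,J_2,J_3$ with $J_iJ_j=J_k=-J_jJ_i$ for even permutations $(ijk)$ of $(123)$. That it is given by $\check\varphi_1,\check\varphi_2,\check\varphi_3$ means that these span $Q$ over $U$ in this way. *)

(* Defs.v *)
From HB Require Import structures.
From mathcomp Require Import all_boot all_order all_algebra.
From mathcomp Require Import all_classical all_reals all_analysis.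

Set Implicit Arguments.
Unset Strict Implicit.
Unset Printing Implicit Defensive.

Import Order.TTheory GRing.Theory Num.Theory.
Import numFieldNormedType.Exports.

Local Open Scope classical_set_scope.
Local Open Scope ring_scope.

(* MathComp-Analysis has no manifolds: the notions of differential geometry that
   are needed are built here on its calculus on 'rV[R]_m. *)

Fixpoint iter_derive {R : realType} {U V : normedModType R}
    (vs : seq U) (f : U -> V) : U -> V :=
  if vs is v :: vs' then fun x => 'D_v (iter_derive vs' f) x else f.

(* C^oo on the open set A: iterated directional derivatives of every order are
   differentiable (hence continuous) on A. *)
Definition smooth_on {R : realType} {U V : normedModType R}
    (A : set U) (f : U -> V) : Prop :=
  forall (vs : seq U) (x : U), A x -> differentiable (iter_derive vs f) x.

(* [to] and [from] are total functions; only their restrictions to [dom] and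
   [cod] are meaningful. *)
Record chart (R : realType) (m : nat) (T : topologicalType) := Chart {
  dom : set T;
  cod : set 'rV[R]_m;
  to : T -> 'rV[R]_m;
  from : 'rV[R]_m -> T;
  dom_open : open dom;
  cod_open : open cod;
  to_cod : forall p, dom p -> cod (to p);
  from_dom : forall x, cod x -> dom (from x);
  toK : forall p, dom p -> from (to p) = p;
  fromK : forall x, cod x -> to (from x) = x;
  to_continuous : {in dom, continuous to};
  from_continuous : {in cod, continuous from}
}.

(* A smooth manifold of dimension m, given by an atlas containing a preferred
   chart [chart_at p] around each point p.  The tangent space at p is
   identified with 'rV[R]_m through [chart_at p]: a tangent vector is the row
   of its components in that chart.  Hence
     vector fields                M -> 'rV[R]_m
     1-forms                      M -> {scalar 'rV[R]_m}
     (1,1)-tensor fields          M -> 'End('rV[R]_m)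
     metrics                      M -> 'rV[R]_m -> 'rV[R]_m -> R
   with values at p expressed in [chart_at p].  As this chart may jump with p,
   these functions are not themselves smooth: smoothness is tested after
   changing to a fixed chart (see [tchange]). *)
Record manifold (R : realType) (m : nat) := Manifold {
  mcarrier :> topologicalType;
  chart_at : mcarrier -> chart R m mcarrier;
  m_hausdorff : hausdorff_space mcarrier;
  m_second_countable : @second_countable mcarrier;
  chart_at_dom : forall p, dom (chart_at p) p;
  chart_at_smooth : forall p q,
    smooth_on (cod (chart_at p) `&` from (chart_at p) @^-1` dom (chart_at q))
      (to (chart_at q) \o from (chart_at p))
}.

Definition smooth_map {R : realType} {m n : nat}
    {M : manifold R m} {N : manifold R n} (W : set M) (f : M -> N) : Prop :=
  {in W, continuous f} /\
  forall (p : M) (q : N),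
    smooth_on (cod (chart_at p) `&`
               from (chart_at p) @^-1` (W `&` f @^-1` dom (chart_at q)))
      (to (chart_at q) \o f \o from (chart_at p)).

Definition smooth_fun {R : realType} {m : nat} {M : manifold R m}
    (W : set M) (f : M -> R) : Prop :=
  forall q : M,
    smooth_on (cod (chart_at q) `&` from (chart_at q) @^-1` W)
      (f \o from (chart_at q)).

(* The differential f_* at p, from T_p M to T_(f p) N. *)
Definition dmap {R : realType} {m n : nat}
    {M : manifold R m} {N : manifold R n} (f : M -> N) (p : M) :
    'Hom('rV[R]_m, 'rV[R]_n) :=
  linfun ('d (to (chart_at (f p)) \o f \o from (chart_at p))
             (to (chart_at p) p)).

(* v(f), for v in T_p M. *)
Definition dfun {R : realType} {m : nat} {M : manifold R m}
    (f : M -> R) (p : M) (v : 'rV[R]_m) : R :=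
  'D_v (f \o from (chart_at p)) (to (chart_at p) p).

(* Change of components from [chart_at p] to [chart_at q] for vectors at p. *)
Definition tchange {R : realType} {m : nat} {M : manifold R m} (p q : M) :
    'Hom('rV[R]_m, 'rV[R]_m) :=
  linfun ('d (to (chart_at q) \o from (chart_at p)) (to (chart_at p) p)).

(* The components of the vector field X in the fixed chart [chart_at q]. *)
Definition vf_in_chart {R : realType} {m : nat} {M : manifold R m}
    (q : M) (X : M -> 'rV[R]_m) : 'rV[R]_m -> 'rV[R]_m :=
  fun x => let p := from (chart_at q) x in tchange p q (X p).

Definition smooth_vf {R : realType} {m : nat} {M : manifold R m}
    (W : set M) (X : M -> 'rV[R]_m) : Prop :=
  forall q : M,
    smooth_on (cod (chart_at q) `&` from (chart_at q) @^-1` W)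
      (vf_in_chart q X).

(* [X, Y] = X^a (d_a Y^b) d_b - Y^a (d_a X^b) d_b, at p in [chart_at p]. *)
Definition lie_bracket {R : realType} {m : nat} {M : manifold R m}
    (X Y : M -> 'rV[R]_m) (p : M) : 'rV[R]_m :=
  'D_(X p) (vf_in_chart p Y) (to (chart_at p) p)
  - 'D_(Y p) (vf_in_chart p X) (to (chart_at p) p).

Definition smooth_form {R : realType} {m : nat} {M : manifold R m}
    (eta : M -> {scalar 'rV[R]_m}) : Prop :=
  forall (W : set M) (X : M -> 'rV[R]_m), open W -> smooth_vf W X ->
    smooth_fun W (fun p => eta p (X p)).

Definition smooth_endo {R : realType} {m : nat} {M : manifold R m}
    (U : set M) (A : M -> 'End('rV[R]_m)) : Prop :=
  forall (W : set M) (X : M -> 'rV[R]_m), open W -> W `<=` U ->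
    smooth_vf W X -> smooth_vf W (fun p => A p (X p)).

(* No factor 1/2, here and in [wedge]. *)
Definition ext_d {R : realType} {m : nat} {M : manifold R m}
    (eta : M -> {scalar 'rV[R]_m}) (X Y : M -> 'rV[R]_m) (p : M) : R :=
  dfun (fun q => eta q (Y q)) p (X p) - dfun (fun q => eta q (X q)) p (Y p)
  - eta p (lie_bracket X Y p).

Definition wedge {R : realType} {m : nat} (a b : {scalar 'rV[R]_m})
    (u v : 'rV[R]_m) : R := a u * b v - a v * b u.

Record riemannian_metric {R : realType} {m : nat} {M : manifold R m}
    (g : M -> 'rV[R]_m -> 'rV[R]_m -> R) : Prop := RiemannianMetric {
  metric_linear : forall p u, scalar (g p u);
  metric_sym : forall p u v, g p u v = g p v u;
  metric_pos : forall p u, u != 0 -> 0 < g p u u;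
  metric_smooth : forall (W : set M) (X Y : M -> 'rV[R]_m), open W ->
    smooth_vf W X -> smooth_vf W Y ->
    smooth_fun W (fun p => g p (X p) (Y p))
}.

(* nabla Y p v stands for nabla_v Y, for Y a vector field defined and smooth
   near p and v in T_p M; values on other functions Y are irrelevant.  Axiom
   [conn_local] is what makes nabla act on vector fields defined on open
   subsets. *)
Record affine_connection {R : realType} {m : nat} {M : manifold R m}
    (nabla : (M -> 'rV[R]_m) -> M -> 'End('rV[R]_m)) : Prop :=
  AffineConnection {
  conn_local : forall (W : set M) (Y Z : M -> 'rV[R]_m) (p : M),
    open W -> W p -> smooth_vf W Y -> smooth_vf W Z ->
    (forall q, W q -> Y q = Z q) -> nabla Y p = nabla Z p;
  conn_add : forall (W : set M) (Y Z : M -> 'rV[R]_m) (p : M),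
    open W -> W p -> smooth_vf W Y -> smooth_vf W Z ->
    nabla (fun q => Y q + Z q) p = nabla Y p + nabla Z p;
  conn_leibniz : forall (W : set M) (f : M -> R) (Y : M -> 'rV[R]_m) (p : M)
      (v : 'rV[R]_m),
    open W -> W p -> smooth_fun W f -> smooth_vf W Y ->
    nabla (fun q => f q *: Y q) p v = dfun f p v *: Y p + f p *: nabla Y p v;
  conn_smooth : forall (W : set M) (Y : M -> 'rV[R]_m),
    open W -> smooth_vf W Y -> smooth_endo W (nabla Y)
}.

Record levi_civita {R : realType} {m : nat} {M : manifold R m}
    (g : M -> 'rV[R]_m -> 'rV[R]_m -> R)
    (nabla : (M -> 'rV[R]_m) -> M -> 'End('rV[R]_m)) : Prop := LeviCivita {
  lc_connection : affine_connection nabla;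
  lc_torsion_free : forall (W : set M) (X Y : M -> 'rV[R]_m) (p : M),
    open W -> W p -> smooth_vf W X -> smooth_vf W Y ->
    nabla Y p (X p) - nabla X p (Y p) = lie_bracket X Y p;
  lc_metric : forall (W : set M) (Y Z : M -> 'rV[R]_m) (p : M)
      (v : 'rV[R]_m),
    open W -> W p -> smooth_vf W Y -> smooth_vf W Z ->
    dfun (fun q => g q (Y q) (Z q)) p v
      = g p (nabla Y p v) (Z p) + g p (Y p) (nabla Z p v)
}.

(* nabla_v J = A at p, for a (1,1)-tensor field J defined and smooth near p,
   where (nabla_v J) Y = nabla_v (J Y) - J (nabla_v Y). *)
Definition is_cov_derive {R : realType} {m : nat} {M : manifold R m}
    (nabla : (M -> 'rV[R]_m) -> M -> 'End('rV[R]_m))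
    (J : M -> 'End('rV[R]_m)) (p : M) (v : 'rV[R]_m) (A : 'End('rV[R]_m)) :
    Prop :=
  forall (W : set M) (Y : M -> 'rV[R]_m), open W -> W p -> smooth_vf W Y ->
    A (Y p) = nabla (fun q => J q (Y q)) p v - J p (nabla Y p v).

Record riemannian_submersion {R : realType} {m n : nat}
    {M : manifold R m} {N : manifold R n}
    (g : M -> 'rV[R]_m -> 'rV[R]_m -> R) (gN : N -> 'rV[R]_n -> 'rV[R]_n -> R)
    (pi : M -> N) : Prop := RiemannianSubmersion {
  subm_smooth : smooth_map setT pi;
  subm_onto : forall y, exists x, pi x = y;
  subm_full : forall p, limg (dmap pi p) = fullv;
  subm_isometry : forall p u v,
    (forall w, w \in lker (dmap pi p) -> g p u w = 0) ->
    (forall w, w \in lker (dmap pi p) -> g p v w = 0) ->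
    gN (pi p) (dmap pi p u) (dmap pi p v) = g p u v
}.

Definition smooth_section {R : realType} {m n : nat}
    {M : manifold R m} {N : manifold R n} (pi : M -> N) (U : set N)
    (s : N -> M) : Prop :=
  smooth_map U s /\ forall y, U y -> pi (s y) = y.

(* The even permutations of (123); the indices 1, 2, 3 are 0, 1, 2 : 'I_3. *)
Definition even3 (i j k : 'I_3) : bool :=
  (i, j, k) \in [:: (0, 1, 2); (1, 2, 0); (2, 0, 1)].

Record almost_contact_metric {R : realType} {m : nat} {M : manifold R m}
    (phi : M -> 'End('rV[R]_m)) (xi : M -> 'rV[R]_m)
    (eta : M -> {scalar 'rV[R]_m}) (g : M -> 'rV[R]_m -> 'rV[R]_m -> R) :
    Prop := AlmostContactMetric {
  acm_phi_smooth : smooth_endo setT phi;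
  acm_xi_smooth : smooth_vf setT xi;
  acm_eta_smooth : smooth_form eta;
  acm_phi2 : forall p v, phi p (phi p v) = - v + eta p v *: xi p;
  acm_eta_xi : forall p, eta p (xi p) = 1;
  acm_phi_xi : forall p, phi p (xi p) = 0;
  acm_eta_phi : forall p v, eta p (phi p v) = 0;
  acm_compat : forall p u v,
    g p (phi p u) (phi p v) = g p u v - eta p u * eta p v
}.

Record almost_3_contact_metric {R : realType} {n : nat}
    {M : manifold R (4 * n + 3)%N}
    (phi : 'I_3 -> M -> 'End('rV[R]_(4 * n + 3)))
    (xi : 'I_3 -> M -> 'rV[R]_(4 * n + 3))
    (eta : 'I_3 -> M -> {scalar 'rV[R]_(4 * n + 3)})
    (g : M -> 'rV[R]_(4 * n + 3) -> 'rV[R]_(4 * n + 3) -> R) : Prop :=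
  Almost3ContactMetric {
  a3cm_metric : riemannian_metric g;
  a3cm_acm : forall i, almost_contact_metric (phi i) (xi i) (eta i) g;
  a3cm_phi : forall i j k, even3 i j k -> forall p v,
    phi k p v = phi i p (phi j p v) - eta j p v *: xi i p /\
    phi k p v = - phi j p (phi i p v) + eta i p v *: xi j p;
  a3cm_xi : forall i j k, even3 i j k -> forall p,
    xi k p = phi i p (xi j p) /\ xi k p = - phi j p (xi i p);
  a3cm_eta : forall i j k, even3 i j k -> forall p v,
    eta k p v = eta i p (phi j p v) /\ eta k p v = - eta j p (phi i p v)
}.

Definition fund_form {R : realType} {m : nat} {M : manifold R m}
    (g : M -> 'rV[R]_m -> 'rV[R]_m -> R) (phi : M -> 'End('rV[R]_m))
    (p : M) (u v : 'rV[R]_m) : R := g p u (phi p v).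

Record sasaki3 {R : realType} {n : nat} {M : manifold R (4 * n + 3)%N}
    (alpha delta : R)
    (phi : 'I_3 -> M -> 'End('rV[R]_(4 * n + 3)))
    (xi : 'I_3 -> M -> 'rV[R]_(4 * n + 3))
    (eta : 'I_3 -> M -> {scalar 'rV[R]_(4 * n + 3)})
    (g : M -> 'rV[R]_(4 * n + 3) -> 'rV[R]_(4 * n + 3) -> R) : Prop :=
  Sasaki3 {
  s3_a3cm : almost_3_contact_metric phi xi eta g;
  s3_alpha : alpha != 0;
  s3_deta : forall i j k, even3 i j k ->
    forall (W : set M) (X Y : M -> 'rV[R]_(4 * n + 3)) (p : M),
    open W -> W p -> smooth_vf W X -> smooth_vf W Y ->
    ext_d (eta i) X Y p
      = 2 * alpha * fund_form g (phi i) p (X p) (Y p)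
        + 2 * (alpha - delta) * wedge (eta j p) (eta k p) (X p) (Y p)
}.

Definition vertical {R : realType} {m : nat} {M : manifold R m}
    (xi : 'I_3 -> M -> 'rV[R]_m) (p : M) : {vspace 'rV[R]_m} :=
  <<[:: xi 0%R p; xi 1%R p; xi 2%R p]>>%VS.

Record canonical_submersion {R : realType} {m n : nat}
    {M : manifold R m} {N : manifold R n} (xi : 'I_3 -> M -> 'rV[R]_m)
    (g : M -> 'rV[R]_m -> 'rV[R]_m -> R) (gN : N -> 'rV[R]_n -> 'rV[R]_n -> R)
    (pi : M -> N) : Prop := CanonicalSubmersion {
  csub_submersion : riemannian_submersion g gN pi;
  csub_vertical : forall p, lker (dmap pi p) = vertical xi p;
  csub_connected : forall y, connected (pi @^-1` [set y])
}.

Record quaternionic_frame {R : realType} {n : nat} {N : manifold R n}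
    (g : N -> 'rV[R]_n -> 'rV[R]_n -> R) (Q : N -> {vspace 'End('rV[R]_n)})
    (U : set N) (J : 'I_3 -> N -> 'End('rV[R]_n)) : Prop :=
  QuaternionicFrame {
  qf_smooth : forall i, smooth_endo U (J i);
  qf_square : forall i y v, U y -> J i y (J i y v) = - v;
  qf_orthogonal : forall i y u v, U y -> g y (J i y u) (J i y v) = g y u v;
  qf_mul : forall i j k, even3 i j k -> forall y v, U y ->
    J i y (J j y v) = J k y v /\ J k y v = - J j y (J i y v);
  qf_span : forall y, U y -> Q y = <<[:: J 0%R y; J 1%R y; J 2%R y]>>%VS
}.

(* Q assigns to y the fibre Q_y of a subbundle of End(TN), whose smoothness is
   given by the local frames; Q is parallel if nabla_v J lies in Q for each
   local section J of Q. *)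
Record quaternionic_kaehler {R : realType} {n : nat} {N : manifold R n}
    (g : N -> 'rV[R]_n -> 'rV[R]_n -> R)
    (nabla : (N -> 'rV[R]_n) -> N -> 'End('rV[R]_n))
    (Q : N -> {vspace 'End('rV[R]_n)}) : Prop := QuaternionicKaehler {
  qk_rank : forall y, (\dim (Q y) = 3)%N;
  qk_frame : forall y, exists (U : set N) (J : 'I_3 -> N -> 'End('rV[R]_n)),
    [/\ open U, U y & quaternionic_frame g Q U J];
  qk_parallel : forall (W : set N) (J : N -> 'End('rV[R]_n)),
    open W -> smooth_endo W J -> (forall y, W y -> J y \in Q y) ->
    forall y v, W y -> exists2 A, A \in Q y & is_cov_derive nabla J y v A
}.

Definition phi_check {R : realType} {m n : nat}
    {M : manifold R m} {N : manifold R n} (pi : M -> N)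
    (phi : 'I_3 -> M -> 'End('rV[R]_m)) (s : N -> M) (i : 'I_3) (y : N) :
    'End('rV[R]_n) :=
  (dmap pi (s y) \o phi i (s y) \o dmap s y)%VF.

Definition eta_check {R : realType} {m n : nat}
    {M : manifold R m} {N : manifold R n}
    (eta : 'I_3 -> M -> {scalar 'rV[R]_m}) (s : N -> M) (i : 'I_3) (y : N)
    (v : 'rV[R]_n) : R :=
  eta i (s y) (dmap s y v).

(* Main.v *)
From HB Require Import structures.
Require Import Defs.
From mathcomp Require Import all_boot all_order all_algebra.
From mathcomp Require Import all_classical all_reals all_analysis.
From mathcomp Require Import ring lra.

(** The proof takes place on the base. Let [s] be a section of [pi], put
    [theta_i = s^* eta_i], write [J_i] for the endomorphisms defined by [s], and let
    [Omega_i (X, Y) = gN X (J_i Y)].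

    As [pi] is a Riemannian submersion whose vertical space is spanned by the
    [xi_l], the fundamental form [Phi_i] is the pullback of a form of the base minus
    [eta_j /\ eta_k] ([fund_form_split]). The equation that defines the structure
    therefore becomes [2 alpha Omega_i = d theta_i + 2 delta theta_j /\ theta_k]
    ([omega_structure]). Since [alpha] is not zero, a further exterior derivative
    gives [d Omega_i = 2 delta (theta_k /\ Omega_j - theta_j /\ Omega_k)]
    ([cyclic_derive_omega]).

    Let [B_i (X) = nabla_X J_i - 2 delta (theta_k (X) J_j - theta_j (X) J_k)]. The
    subtracted term is an infinitesimal rotation of the frame, hence a derivation of
    the quaternion relations, as [nabla_X] is. So the [B_i] satisfy the identities of
    the covariant derivative of a quaternionic frame, and the formula for
    [d Omega_i] says that the cyclic sums of [gN (B_i (X) Y) Z] vanish. By a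
    pointwise version of an argument of Hitchin for hyperkaehler structures
    ([hitchin]) these identities force [B_i = 0]: this is the formula for the
    covariant derivatives, and it makes the span of the [J_i] parallel.

    That this span does not depend on [s] is a statement about the fibres. At a point
    [p] of [M] let [A_i] be the endomorphism of the tangent space at [pi p] induced
    by [phi_i]. Around [p] the inverse function theorem straightens [pi] to a linear
    projection ([straighten]); this provides local sections ([local_section]), and
    the formula for [d Omega_i] holds in straightened coordinates just as along a
    section. Evaluated on one vertical vector, it says that the [A_i] rotate along
    the fibre, so that [sum_i A_i (x) A_i] is locally constant there
    ([kraines_locally_constant]). As the [A_i] are orthogonal this tensor determines
    their span, which is constant because the fibres are connected
    ([fibre_span_constant]). *)
Set Implicit Arguments.
Unset Strict Implicit.
Unset Printing Implicit Defensive.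

Import Order.TTheory GRing.Theory Num.Theory.
Import numFieldNormedType.Exports.

Local Open Scope classical_set_scope.
Local Open Scope ring_scope.

(* Derivatives are used only through their algebraic rules, not as limits. *)
#[local] Strategy opaque [derive diff].

(** * Directional derivatives and smooth functions *)

Section Derivatives.
Context {R : realType}.

Lemma derive_linear (U V : normedModType R) (f : U -> V) x a u v :
  differentiable f x ->
  'D_(a *: u + v) f x = a *: 'D_u f x + 'D_v f x.
Proof. by move=> df; rewrite !deriveE // linearP. Qed.

Lemma derive_comp (U V W : normedModType R) (f : V -> W) (g : U -> V) x v :
  differentiable g x -> differentiable f (g x) ->
  'D_v (f \o g) x = 'D_('D_v g x) f (g x).
Proof.
move=> dg df; rewrite !deriveE //; last exact: differentiable_comp.
by rewrite diff_comp.
Qed.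

Lemma differentiable_near_eq (U V : normedModType R) (f g : U -> V) x :
  (\near x, f x = g x) -> differentiable f x -> differentiable g x.
Proof.
move=> fg df.
have fgx : f x = g x by apply: nbhs_singleton fg.
have E : g \o shift x = cst (g x) + 'd f x +o_ 0 id.
  rewrite -fgx; have /diff_locally fE := df.
  apply/eqaddoP => _/posnumP[e].
  have /eqaddoP /(_ e%:num (gt0 e)) := fE.
  have : \forall h \near 0, (f \o shift x) h = (g \o shift x) h.
    move: fg; rewrite (near_shift 0 x) subr0 => fg.
    by near=> h; near: h; apply: filterS fg.
  move=> A B; near=> h.
  have Bh : `|((f \o shift x) - (cst (f x) + 'd f x)) h| <= e%:num * `|id h|.
    by near: h.
  have Ah : (f \o shift x) h = (g \o shift x) h by near: h.
  by rewrite /= in Ah Bh *; move: Bh; rewrite !fctE /= Ah.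
have cdf : continuous ('d f x) by exact: diff_continuous.
by apply/diff_locallyP; rewrite (diff_unique cdf E).
Unshelve. all: by end_near. Qed.

Lemma near_eq_open (T : topologicalType) (W : Type) (A : set T) (f g : T -> W) x :
  open A -> (forall y, A y -> f y = g y) -> A x -> \near x, f x = g x.
Proof.
move=> oA fg Ax; apply: (filterS fg).
by apply: open_nbhs_nbhs; split.
Qed.

Lemma differentiable_row (U : normedModType R) n (f : U -> 'rV[R]_n) x :
  (forall j, differentiable (fun y => f y 0 j) x) -> differentiable f x.
Proof.
move=> df.
have -> : f = \sum_(a < n) (fun y => f y 0 a *: (delta_mx 0 a : 'rV[R]_n)).
  apply/funext => y; rewrite [LHS]row_sum_delta fct_sumE; exact: eq_bigr.
by apply: differentiable_sum => i; apply: differentiableZl; exact: df.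
Qed.

Lemma differentiable_coordf (U : normedModType R) n (f : U -> 'rV[R]_n) x j :
  differentiable f x -> differentiable (fun y => f y 0 j) x.
Proof.
move=> df; apply: (@differentiable_comp _ _ _ _ f (fun N : 'rV[R]_n => N 0 j)) => //.
exact: differentiable_coord.
Qed.

Lemma derive_coord (U : normedModType R) n (f : U -> 'rV[R]_n) x v j :
  differentiable f x -> 'D_v f x 0 j = 'D_v (fun y => f y 0 j) x.
Proof. by move=> df; rewrite derive_mx ?mxE //; exact: diff_derivable. Qed.

Lemma derive_basis (V : normedModType R) n (f : 'rV[R]_n -> V) x v :
  differentiable f x ->
  'D_v f x = \sum_(a < n) v 0 a *: 'D_(delta_mx 0 a) f x.
Proof.
move=> df; rewrite !deriveE // {1}[v]row_sum_delta linear_sum.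
by apply: eq_bigr => a _; rewrite linearZ /= deriveE.
Qed.

End Derivatives.

Section SmoothScalar.
Context {R : realType} {U : normedModType R}.
Implicit Types (A : set U) (f g : U -> R).

(** An inductive counterpart of [smooth_on]: here the derivative taken first is
    peeled off first, so that the closure properties follow by induction on [k]
    from the Leibniz and chain rules. *)
Fixpoint Ck (V : normedModType R) (k : nat) A (f : U -> V) : Prop :=
  (forall x, A x -> differentiable f x) /\
  if k is k'.+1 then forall v, Ck k' A ('D_v f) else True.

Lemma iter_derive_rcons (V : normedModType R) (f : U -> V) vs v :
  iter_derive (rcons vs v) f = iter_derive vs ('D_v f).
Proof. by elim: vs => //= w vs ->. Qed.

Lemma smooth_onP (V : normedModType R) A (f : U -> V) :
  smooth_on A f <-> forall k, Ck k A f.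
Proof.
split=> [sf k|Cf vs].
  elim: k f sf => [|k IH] f sf; (split; first exact: (sf [::])) => //.
  move=> v; apply: IH => vs x Ax.
  by rewrite -iter_derive_rcons; exact: sf.
elim/last_ind: vs f Cf => [|vs v IH] f Cf x Ax; first by case: (Cf 0%N) => df _; exact: df.
rewrite iter_derive_rcons; apply: IH => // k.
by case: (Cf k.+1) => _ D; exact: D.
Qed.

Lemma Ck_derive (V : normedModType R) k A (f : U -> V) v :
  Ck k.+1 A f -> Ck k A ('D_v f).
Proof. by case=> _ D; exact: D. Qed.

Lemma CkS (V : normedModType R) k A (f : U -> V) : Ck k.+1 A f -> Ck k A f.
Proof.
elim: k f => [|k IH] f [df Df]; split=> // v.
by apply: IH; exact: Df.
Qed.

Lemma Ck_diff (V : normedModType R) k A (f : U -> V) x :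
  Ck k A f -> A x -> differentiable f x.
Proof. by case: k => [|k] [df _]; exact: df. Qed.

Lemma Ck_eq (V : normedModType R) k A (f g : U -> V) : open A ->
  (forall x, A x -> f x = g x) -> Ck k A f -> Ck k A g.
Proof.
move=> oA; elim: k f g => [|k IH] f g fg [df Df]; split=> //.
- move=> x Ax; apply: differentiable_near_eq (df x Ax).
  exact: near_eq_open oA fg Ax.
- move=> x Ax; apply: differentiable_near_eq (df x Ax).
  exact: near_eq_open oA fg Ax.
- move=> v; apply: (IH ('D_v f)); last exact: Df.
  by move=> x Ax; apply: near_eq_derive; exact: near_eq_open oA fg Ax.
Qed.

Lemma Ck_cst (V : normedModType R) k A (c : V) : Ck k A (fun=> c).
Proof.
elim: k c => [|k IH] c; split=> //.
move=> v; rewrite (_ : 'D_v _ = fun=> 0) //.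
by apply/funext => x; rewrite derive_cst.
Qed.

Lemma CkD k A f g : open A -> Ck k A f -> Ck k A g ->
  Ck k A (fun x => f x + g x).
Proof.
move=> oA; elim: k f g => [|k IH] f g Cf Cg.
  split=> // x Ax; apply: differentiableD; [exact: Ck_diff Cf _|exact: Ck_diff Cg _].
split=> [x Ax|v].
  by apply: differentiableD; [exact: Ck_diff Cf _|exact: Ck_diff Cg _].
apply: (@Ck_eq _ _ _ (fun x => 'D_v f x + 'D_v g x)) => //.
  move=> x Ax; rewrite -deriveD //; apply: diff_derivable.
    exact: Ck_diff Cf _.
  exact: Ck_diff Cg _.
by apply: IH; exact: Ck_derive.
Qed.

Lemma CkM k A f g : open A -> Ck k A f -> Ck k A g ->
  Ck k A (fun x => f x * g x).
Proof.
move=> oA; elim: k f g => [|k IH] f g Cf Cg.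
  split=> // x Ax; apply: differentiableM; [exact: Ck_diff Cf _|exact: Ck_diff Cg _].
split=> [x Ax|v].
  by apply: differentiableM; [exact: Ck_diff Cf _|exact: Ck_diff Cg _].
apply: (@Ck_eq _ _ _ (fun x => f x * 'D_v g x + g x * 'D_v f x)) => //.
  move=> x Ax; rewrite -[LHS]/(f x *: _ + g x *: _) -deriveM //;
    apply: diff_derivable.
    exact: Ck_diff Cf _.
  exact: Ck_diff Cg _.
by apply: CkD => //; apply: IH => //; [exact: CkS|exact: Ck_derive|exact: CkS|
  exact: Ck_derive].
Qed.

Lemma Ck_sum k A (I : Type) (r : seq I) (P : pred I) (F : I -> U -> R) :
  open A -> (forall i, Ck k A (F i)) ->
  Ck k A (fun x => \sum_(i <- r | P i) F i x).
Proof.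
move=> oA CF; elim: r => [|i r IH].
  by apply: (@Ck_eq _ _ _ (fun=> 0)) => // [x _|]; [rewrite big_nil|exact: Ck_cst].
apply: (@Ck_eq _ _ _ (fun x => (if P i then F i x else 0) +
  \sum_(j <- r | P j) F j x)) => //.
  by move=> x _; rewrite big_cons; case: ifP; rewrite ?add0r.
by apply: CkD => //; case: (P i) => //; exact: Ck_cst.
Qed.

Lemma Ck_prod k A (I : Type) (r : seq I) (P : pred I) (F : I -> U -> R) :
  open A -> (forall i, Ck k A (F i)) ->
  Ck k A (fun x => \prod_(i <- r | P i) F i x).
Proof.
move=> oA CF; elim: r => [|i r IH].
  by apply: (@Ck_eq R _ _ (fun=> 1 : R)) => // [x _|]; [rewrite big_nil|exact: Ck_cst].
apply: (@Ck_eq _ _ _ (fun x => (if P i then F i x else 1) *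
  \prod_(j <- r | P j) F j x)) => //.
  by move=> x _; rewrite big_cons; case: ifP; rewrite ?mul1r.
by apply: CkM => //; case: (P i) => //; exact: Ck_cst.
Qed.

Lemma CkV k A f : open A -> (forall x, A x -> f x != 0) -> Ck k A f ->
  Ck k A (fun x => (f x)^-1).
Proof.
move=> oA fn0; elim: k f fn0 => [|k IH] f fn0 Cf.
  split=> // x Ax; apply: differentiableV; [exact: Ck_diff Cf _|exact: fn0].
have CVf : Ck k A (fun x => (f x)^-1) by apply: IH => //; exact: CkS.
split=> [x Ax|v].
  by apply: differentiableV; [exact: Ck_diff Cf _|exact: fn0].
apply: (@Ck_eq _ _ _ (fun x => (-1) * ((f x)^-1 * ((f x)^-1 * 'D_v f x)))) => //.
  move=> x Ax; rewrite deriveV; last 2 first.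
  - exact: fn0.
  - by apply: diff_derivable; exact: Ck_diff Cf _.
  by rewrite -[RHS]/(- f x ^- 2 * _) -exprVn expr2; ring.
apply: CkM => //; first exact: Ck_cst.
by apply: CkM => //; apply: CkM => //; exact: Ck_derive.
Qed.

Lemma Ck_rowP n k A (f : U -> 'rV[R]_n) : open A ->
  Ck k A f <-> forall j, Ck k A (fun x => f x 0 j).
Proof.
move=> oA; elim: k f => [|k IH] f.
  split=> [[df _] j|Cf]; split=> // x Ax.
    by apply: differentiable_coordf; exact: df.
  by apply: differentiable_row => j; exact: Ck_diff (Cf j) _.
split=> [Cf j|Cf].
  split=> [x Ax|v]; first by apply: differentiable_coordf; exact: Ck_diff Cf _.
  case: (Cf) => df /(_ v) /IH /(_ j) Dj; apply: Ck_eq Dj => // x Ax.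
  by rewrite derive_coord //; exact: df.
have df x : A x -> differentiable f x.
  by move=> Ax; apply: differentiable_row => j; exact: Ck_diff (Cf j) _.
split=> // v; apply/IH => j.
have [_ /(_ v) Dj] := Cf j; apply: Ck_eq Dj => // x Ax.
by rewrite derive_coord //; exact: df.
Qed.

End SmoothScalar.

(** The chain rule in coordinates, [D_v (f o g) = sum_a (D_v g)_a (D_a f) o g],
    lowers the order of [f] and of [g] at once. *)
Lemma Ck_comp {R : realType} {U : normedModType R} n k (A : set U)
    (B : set 'rV[R]_n) (f : 'rV[R]_n -> R) (g : U -> 'rV[R]_n) :
  open A -> Ck k B f -> Ck k A g -> (forall x, A x -> B (g x)) ->
  Ck k A (fun x => f (g x)).
Proof.
move=> oA; elim: k f => [|k IH] f Cf Cg AB.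
  split=> // x Ax; apply: differentiable_comp; first exact: Ck_diff Cg _.
  exact: Ck_diff Cf (AB _ Ax).
split=> [x Ax|v].
  apply: differentiable_comp; first exact: Ck_diff Cg _.
  exact: Ck_diff Cf (AB _ Ax).
apply: (@Ck_eq _ _ _ _ _
  (fun x : U => \sum_(a < n) 'D_v g x 0 a * 'D_(delta_mx 0 a) f (g x))) => //.
  move=> x Ax; rewrite [RHS](@derive_comp _ _ _ _ f g).
  - by rewrite [RHS]derive_basis //; exact: Ck_diff Cf (AB _ Ax).
  - exact: Ck_diff Cg _.
  - exact: Ck_diff Cf (AB _ Ax).
apply: Ck_sum => // a; apply: CkM => //.
  by have /(Ck_rowP _ _ oA) /(_ a) := Ck_derive v Cg.
by apply: (IH ('D_(delta_mx 0 a) f)) => //; [exact: Ck_derive|exact: CkS].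
Qed.

(** * Symmetry of second derivatives *)

Section MeanValue.
Context {R : realType} {U : normedModType R}.

Lemma is_diff_line (x v : U) (t : R) :
  is_diff t (fun t : R => x + t *: v) (fun t : R => t *: v).
Proof.
have d1 : is_diff t (fun t => t *: v) (fun t : R => t *: v) := is_diff_scalel t v.
have d2 : is_diff t (cst x) (0 : R -> U) := is_diff_cst x t.
by have := is_diffD d2 d1; rewrite add0r.
Qed.

Lemma is_derive_line (V : normedModType R) (f : U -> V) (x v : U) (t : R) :
  differentiable f (x + t *: v) ->
  is_derive t 1 (fun t => f (x + t *: v)) ('D_v f (x + t *: v)).
Proof.
move=> df; have dl := is_diff_line x v t.
have dfl : differentiable (f \o (fun t : R => x + t *: v)) t.
  by apply: differentiable_comp => //; exact: ex_diff.
apply: DeriveDef; first exact: diff_derivable.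
rewrite (@derive_comp _ _ _ _ f (fun t : R => x + t *: v)) //.
by congr ('D__ f _); rewrite deriveE // diff_val scale1r.
Qed.

Lemma mvt_dir (f : U -> R) (x v : U) (h : R) : 0 < h ->
  (forall t, 0 <= t <= h -> differentiable f (x + t *: v)) ->
  exists2 t, 0 < t < h & f (x + h *: v) - f x = h * 'D_v f (x + t *: v).
Proof.
move=> h0 df.
have := @MVT R (fun t => f (x + t *: v)) (fun t => 'D_v f (x + t *: v)) 0 h h0.
case.
- move=> t; rewrite in_itv /= => /andP[t0 th].
  by apply: is_derive_line; apply: df; rewrite !ltW.
- apply: derivable_within_continuous => t; rewrite in_itv /= => th.
  by have [] := is_derive_line (df _ th).
- move=> t; rewrite in_itv /= => th; rewrite scale0r addr0 subr0 mulrC => E.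
  by exists t.
Qed.

End MeanValue.

Section Schwarz.
Context {R : realType} {U : normedModType R}.

(** The mean value theorem applied twice: first along [u] to the increment of [f]
    along [v], then along [v] to ['D_u f]. *)
Lemma second_difference (A : set U) (f : U -> R) (x u v : U) (h : R) :
  smooth_on A f -> 0 < h ->
  (forall s t, 0 <= s <= h -> 0 <= t <= h -> A (x + s *: u + t *: v)) ->
  exists s t, [/\ 0 < s < h, 0 < t < h &
   f (x + h *: u + h *: v) - f (x + h *: u) - (f (x + h *: v) - f x) =
   h * (h * 'D_v ('D_u f) (x + s *: u + t *: v))].
Proof.
move=> sf h0 Ah; have hh : 0 <= h <= h by rewrite lexx ltW.
have h00 : 0 <= (0 : R) <= h by rewrite lexx ltW.
have df p : A p -> differentiable f p by move=> Ap; exact: (sf [::]).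
have dDf p : A p -> differentiable ('D_u f) p by move=> Ap; exact: (sf [:: u]).
pose F p := f (p + h *: v) - f p.
have dsh p : A (p + h *: v) -> is_diff p (fun p => f (p + h *: v)) ('d f (p + h *: v)).
  move=> Ap; pose shift (p : U) := p + h *: v.
  have dshift : is_diff p shift id.
    by apply: is_diff_eq; rewrite addr0.
  exact: (@is_diff_comp _ _ _ _ shift _ f _ p dshift (differentiableP (df _ Ap))).
have dF p : A p -> A (p + h *: v) ->
    differentiable F p /\ 'D_u F p = 'D_u f (p + h *: v) - 'D_u f p.
  move=> Ap Aph; have d1 := dsh _ Aph.
  have d2 := differentiableP (df _ Ap).
  have dF : is_diff p F (fun w => 'd f (p + h *: v) w - 'd f p w).
    exact: is_diffB d1 d2.
  split; first exact: ex_diff.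
  rewrite deriveE; last exact: ex_diff.
  by rewrite diff_val !deriveE //; exact: df.
have [t th|s hs E] := @mvt_dir _ _ F x u h h0.
  apply: (proj1 (dF _ _ _)); last exact: Ah.
  by have := Ah t 0 th h00; rewrite scale0r addr0.
have hs' : 0 <= s <= h by case/andP: hs => *; rewrite !ltW.
have [t th|t ht E'] := @mvt_dir _ _ ('D_u f) (x + s *: u) v h h0.
  by apply: dDf; exact: Ah.
exists s, t; split => //; rewrite -E' -(proj2 (dF _ _ _)).
- by rewrite -E /F.
- by have := Ah s 0 hs' h00; rewrite scale0r addr0.
- exact: Ah.
Qed.

(** Both mixed derivatives are limits of the same second difference over [h ^ 2],
    because exchanging [u] and [v] leaves that difference unchanged. *)
Lemma schwarz_scalar (A : set U) (f : U -> R) (x u v : U) :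
  open A -> A x -> smooth_on A f ->
  'D_u ('D_v f) x = 'D_v ('D_u f) x.
Proof.
move=> oA Ax sf.
have [e /= e0 eA] : exists2 e, 0 < e & ball x e `<=` A.
  by apply/nbhs_ballP; apply: open_nbhs_nbhs.
have c1 : {for x, continuous ('D_u ('D_v f))}.
  by apply: differentiable_continuous; exact: (sf [:: u; v]).
have c2 : {for x, continuous ('D_v ('D_u f))}.
  by apply: differentiable_continuous; exact: (sf [:: v; u]).
apply/eqP; rewrite eq_sym -subr_eq0 -normr_le0; apply/ler_addgt0Pl => d d0.
rewrite addr0.
have /nbhs_ballP[/= e1 e10 He1] : nbhs x
    ((fun y => `|'D_u ('D_v f) x - 'D_u ('D_v f) y| < d / 2) `&`
     (fun y => `|'D_v ('D_u f) x - 'D_v ('D_u f) y| < d / 2)).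
  apply: filterI; [move/cvgrPdist_lt: c1 | move/cvgrPdist_lt: c2];
    by apply; rewrite divr_gt0.
pose r := Num.min e e1; have r0 : 0 < r by rewrite lt_min e0.
pose c := `|u| + `|v| + 1; have c0 : 0 < c.
  by rewrite ltr_wpDl // addr_ge0.
pose h := r / c / 2.
have h0 : 0 < h by rewrite !divr_gt0.
have near_x s t : 0 <= s <= h -> 0 <= t <= h -> ball x r (x + s *: u + t *: v).
  move=> /andP[s0 sh] /andP[t0 th].
  rewrite -ball_normE /= -addrA opprD addrA subrr add0r normrN.
  apply: le_lt_trans (ler_normD _ _) _; rewrite !normrZ (ger0_norm s0) (ger0_norm t0).
  apply: (@le_lt_trans _ _ (h * c)).
    rewrite /c [leRHS]mulrDr [X in _ <= X + _]mulrDr.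
    apply: ler_wpDr; first by rewrite mulr_ge0 // ltW.
    by apply: lerD; rewrite ler_wpM2r.
  have -> : h * c = r / 2.
    by rewrite /h mulrAC divfK // gt_eqF.
  by rewrite ltr_pdivrMr // ltr_pMr // ltr1n.
have inA s t : 0 <= s <= h -> 0 <= t <= h -> A (x + s *: u + t *: v).
  move=> hs ht; apply: eA; apply: le_ball (near_x _ _ hs ht).
  by rewrite ge_min lexx.
have in1 s t : 0 < s < h -> 0 < t < h -> ball x e1 (x + s *: u + t *: v).
  move=> /andP[s0 sh] /andP[t0 th].
  apply: (@le_ball _ _ _ r); first by rewrite ge_min lexx orbT.
  by apply: near_x; rewrite !ltW.
have [s [t [hs ht E]]] := second_difference sf h0 inA.
have inA' s' t' : 0 <= s' <= h -> 0 <= t' <= h -> A (x + s' *: v + t' *: u).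
  by move=> hs' ht'; rewrite addrAC; exact: inA.
have [s' [t' [hs' ht' E']]] := second_difference sf h0 inA'.
have Dst : 'D_v ('D_u f) (x + s *: u + t *: v) =
           'D_u ('D_v f) (x + s' *: v + t' *: u).
  have hn0 : h != 0 by rewrite gt_eqF.
  have xhh : x + h *: v + h *: u = x + h *: u + h *: v by rewrite addrAC.
  move: E E'.
  rewrite xhh.
  set a := 'D_v ('D_u f) (x + s *: u + t *: v).
  set b := 'D_u ('D_v f) (x + s' *: v + t' *: u).
  move: a b => a b E E'.
  by apply: (mulfI hn0); apply: (mulfI hn0); rewrite -E -E'; ring.
have [_ /= B1] := He1 _ (in1 _ _ hs ht).
have swap : x + t' *: u + s' *: v = x + s' *: v + t' *: u by rewrite addrAC.
have := in1 _ _ ht' hs'.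
rewrite swap.
move=> /He1[/= B2 _].
rewrite -Dst in B2; move: B1 B2; clear.
set a := 'D_v _ _; set b := 'D_u _ _; set c := 'D_v ('D_u f) (_ + _).
move: a b c => a b c B1 B2.
rewrite ltW // -(subrKA c) [d]splitr (le_lt_trans (ler_normD _ _)) // ltrD //.
by rewrite distrC.
Qed.

Lemma schwarz n (A : set U) (f : U -> 'rV[R]_n) (x u v : U) :
  open A -> A x -> smooth_on A f ->
  'D_u ('D_v f) x = 'D_v ('D_u f) x.
Proof.
move=> oA Ax sf; apply/rowP => j.
have df y : A y -> differentiable f y by move=> Ay; exact: (sf [::]).
have dD w y : A y -> differentiable ('D_w f) y by move=> Ay; exact: (sf [:: w]).
transitivity ('D_u (fun y => 'D_v f y 0 j) x).
  exact: (derive_coord u j (dD v x Ax)).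
transitivity ('D_v (fun y => 'D_u f y 0 j) x); last first.
  exact/esym/(derive_coord v j (dD u x Ax)).
have E w w' : 'D_w (fun y => 'D_w' f y 0 j) x = 'D_w ('D_w' (fun y => f y 0 j)) x.
  apply: near_eq_derive; apply: (near_eq_open oA) => // y Ay.
  exact: derive_coord (df y Ay).
transitivity ('D_u ('D_v (fun y => f y 0 j)) x); first exact: E.
transitivity ('D_v ('D_u (fun y => f y 0 j)) x); last exact/esym/E.
apply: (schwarz_scalar _ _ oA Ax).
apply/smooth_onP => k; move/smooth_onP : sf => /(_ k) /(Ck_rowP _ _ oA); exact.
Qed.

End Schwarz.

(** * Calculus of smooth maps between coordinate spaces *)

Section Norms.
Context {R : realType}.

Lemma ler_coord_norm n (v : 'rV[R]_n) a : `|v 0 a| <= `|v|.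
Proof.
rewrite [leRHS]/Num.Def.normr /= mx_normrE.
exact: (le_bigmax _ (fun ij : 'I_1 * 'I_n => `|v ij.1 ij.2|) (0, a)).
Qed.

Lemma row_norm_le n (v : 'rV[R]_n) c :
  0 <= c -> (forall a, `|v 0 a| <= c) -> `|v| <= c.
Proof.
move=> c0 vc; rewrite [leLHS]/Num.Def.normr /= mx_normrE.
by apply: bigmax_le => // -[i j] _ /=; rewrite ord1.
Qed.

Lemma mulmx_norm_le n p (M : 'M[R]_(n, p)) (c : R) (v : 'rV[R]_n) :
  0 <= c -> (forall a b, `|M a b| <= c) -> `|v *m M| <= c *+ n * `|v|.
Proof.
move=> c0 Mc; apply: row_norm_le => [|b]; first by rewrite mulr_ge0 ?mulrn_wge0.
rewrite mxE; apply: le_trans (ler_norm_sum _ _ _) _.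
apply: (@le_trans _ _ (\sum_(a < n) c * `|v|)).
  apply: ler_sum => a _; rewrite normrM mulrC ler_pM //.
  exact: ler_coord_norm.
by rewrite sumr_const card_ord -mulrnAl.
Qed.

Lemma mulmx_bounded n p (M : 'M[R]_(n, p)) :
  exists2 C, 0 < C & forall v : 'rV[R]_n, `|v *m M| <= C * `|v|.
Proof.
pose c := \sum_a \sum_b `|M a b|.
have c0 : 0 <= c by apply: sumr_ge0 => a _; apply: sumr_ge0.
exists (c *+ n + 1) => [|v]; first by rewrite ltr_wpDl ?mulrn_wge0.
have Mc a b : `|M a b| <= c.
  rewrite /c (bigD1 a) //= (bigD1 b) //= -addrA lerDl addr_ge0 ?sumr_ge0 //.
  by move=> a' _; apply: sumr_ge0.
apply: le_trans (mulmx_norm_le v c0 Mc) _.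
by rewrite ler_wpM2r // lerDl.
Qed.

End Norms.

Section Smooth.
Context {R : realType} {U : normedModType R}.
Implicit Types (A B : set U) (f g : U -> R).

Lemma smooth_diff (V : normedModType R) A (f : U -> V) x :
  smooth_on A f -> A x -> differentiable f x.
Proof. by move=> sf; exact: (sf [::]). Qed.

Lemma smooth_derive (V : normedModType R) A (f : U -> V) v :
  smooth_on A f -> smooth_on A ('D_v f).
Proof. by move=> /smooth_onP Cf; apply/smooth_onP => k; apply: Ck_derive. Qed.

Lemma smooth_eq (V : normedModType R) A (f g : U -> V) : open A ->
  (forall x, A x -> f x = g x) -> smooth_on A f -> smooth_on A g.
Proof.
move=> oA fg /smooth_onP Cf; apply/smooth_onP => k.
exact: Ck_eq oA fg (Cf k).
Qed.

Lemma smooth_sub (V : normedModType R) A B (f : U -> V) :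
  B `<=` A -> smooth_on A f -> smooth_on B f.
Proof. by move=> BA sf vs x /BA; exact: sf. Qed.

(** Smoothness is a pointwise condition, so it may be checked on a neighbourhood of
    each point, in charts chosen for that point. *)
Lemma smooth_local (V : normedModType R) A (f : U -> V) :
  (forall x, A x -> exists2 B, B x & smooth_on B f) -> smooth_on A f.
Proof. by move=> H vs x /H[B Bx sf]; exact: sf. Qed.

Lemma smooth_cst (V : normedModType R) A (c : V) : smooth_on A (fun=> c).
Proof. by apply/smooth_onP => k; exact: Ck_cst. Qed.

Lemma smoothD A f g : open A -> smooth_on A f -> smooth_on A g ->
  smooth_on A (fun x => f x + g x).
Proof.
move=> oA /smooth_onP Cf /smooth_onP Cg; apply/smooth_onP => k; exact: CkD.
Qed.

Lemma smoothM A f g : open A -> smooth_on A f -> smooth_on A g ->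
  smooth_on A (fun x => f x * g x).
Proof.
move=> oA /smooth_onP Cf /smooth_onP Cg; apply/smooth_onP => k; exact: CkM.
Qed.

Lemma smoothV A f : open A -> (forall x, A x -> f x != 0) -> smooth_on A f ->
  smooth_on A (fun x => (f x)^-1).
Proof. by move=> oA f0 /smooth_onP Cf; apply/smooth_onP => k; exact: CkV. Qed.

Lemma smooth_sum A (I : Type) (r : seq I) (P : pred I) (F : I -> U -> R) :
  open A -> (forall i, smooth_on A (F i)) ->
  smooth_on A (fun x => \sum_(i <- r | P i) F i x).
Proof.
move=> oA CF; apply/smooth_onP => k; apply: Ck_sum => // i.
exact: (smooth_onP _ _).1.
Qed.

Lemma smooth_rowP n A (f : U -> 'rV[R]_n) : open A ->
  smooth_on A f <-> forall j, smooth_on A (fun x => f x 0 j).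
Proof.
move=> oA; split=> [/smooth_onP Cf j|Cf]; apply/smooth_onP => k.
  by have /(Ck_rowP _ _ oA) := Cf k.
by apply/(Ck_rowP _ _ oA) => j; exact: (smooth_onP _ _).1.
Qed.

Lemma smooth_comp_scalar n A (B : set 'rV[R]_n) (f : 'rV[R]_n -> R)
    (g : U -> 'rV[R]_n) :
  open A -> smooth_on B f -> smooth_on A g -> (forall x, A x -> B (g x)) ->
  smooth_on A (fun x => f (g x)).
Proof.
move=> oA /smooth_onP Cf /smooth_onP Cg AB; apply/smooth_onP => k.
exact: Ck_comp oA (Cf k) (Cg k) AB.
Qed.

Lemma smoothDv n A (f g : U -> 'rV[R]_n) : open A ->
  smooth_on A f -> smooth_on A g -> smooth_on A (fun x => f x + g x).
Proof.
move=> oA /(smooth_rowP _ oA) sf /(smooth_rowP _ oA) sg; apply/(smooth_rowP _ oA) => j.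
apply: (@smooth_eq _ A (fun x => f x 0 j + g x 0 j)) => //.
  by move=> x _; rewrite mxE.
exact: smoothD.
Qed.

Lemma smoothZv n A (k : U -> R) (g : U -> 'rV[R]_n) : open A ->
  smooth_on A k -> smooth_on A g -> smooth_on A (fun x => k x *: g x).
Proof.
move=> oA sk /(smooth_rowP _ oA) sg; apply/(smooth_rowP _ oA) => j.
apply: (@smooth_eq _ A (fun x => k x * g x 0 j)) => //.
  by move=> x _; rewrite mxE.
exact: smoothM.
Qed.

Lemma smooth_apply_scalar n A (L : U -> 'rV[R]_n -> R) (w : U -> 'rV[R]_n) :
  open A -> (forall x, A x -> scalar (L x)) ->
  (forall a, smooth_on A (L ^~ (delta_mx 0 a))) -> smooth_on A w ->
  smooth_on A (fun x => L x (w x)).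
Proof.
move=> oA linL sL /(smooth_rowP _ oA) sw.
apply: (@smooth_eq _ A (fun x => \sum_(a < n) w x 0 a * L x (delta_mx 0 a))) => //.
  move=> x Ax; rewrite {2}[w x]row_sum_delta.
  pose lM := GRing.isLinear.Build _ _ _ _ _ (linL x Ax).
  pose l : {scalar _} := HB.pack (L x) lM.
  rewrite -[RHS]/(l _) linear_sum; apply: eq_bigr => a _.
  by rewrite linearZ.
by apply: smooth_sum => // a; exact: smoothM.
Qed.

(** A family of linear maps is smooth as soon as it is so on the canonical basis. *)
Lemma smooth_apply n p A (L : U -> 'rV[R]_n -> 'rV[R]_p) (w : U -> 'rV[R]_n) :
  open A -> (forall x, A x -> linear (L x)) ->
  (forall a, smooth_on A (L ^~ (delta_mx 0 a))) -> smooth_on A w ->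
  smooth_on A (fun x => L x (w x)).
Proof.
move=> oA linL sL sw; apply/(smooth_rowP _ oA) => j.
apply: (@smooth_apply_scalar _ _ (fun x v => L x v 0 j)) => //.
  by move=> x Ax a u v; rewrite linL // !mxE.
by move=> a; move: j; apply/(smooth_rowP _ oA); exact: sL.
Qed.

End Smooth.

Lemma smooth_comp {R : realType} {U : normedModType R} n p
    (A : set U) (B : set 'rV[R]_n) (f : 'rV[R]_n -> 'rV[R]_p)
    (g : U -> 'rV[R]_n) :
  open A -> open B -> smooth_on B f -> smooth_on A g ->
  (forall x, A x -> B (g x)) ->
  smooth_on A (fun x => f (g x)).
Proof.
move=> oA oB /(smooth_rowP _ oB) sf sg AB; apply/(smooth_rowP _ oA) => j.
exact: smooth_comp_scalar oA (sf j) sg AB.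
Qed.

Lemma smooth_id {R : realType} n (A : set 'rV[R]_n) : smooth_on A id.
Proof.
apply/smooth_onP => -[|k]; split=> // v.
rewrite (_ : 'D_v _ = fun=> v); first exact: Ck_cst.
by apply/funext => y; rewrite derive_id.
Qed.

Section SmoothMatrix.
Context {R : realType} {U : normedModType R}.

Lemma Ck_det k n (A : set U) (M : U -> 'M[R]_n) : open A ->
  (forall i j, Ck k A (fun x => M x i j)) -> Ck k A (fun x => \det (M x)).
Proof.
move=> oA CM; apply: Ck_sum => // s; apply: CkM => //; first exact: Ck_cst.
by apply: Ck_prod => // i; exact: CM.
Qed.

(** By Cramer's rule the entries of the inverse are rational in those of [M]. *)
Lemma Ck_invmx k n (A : set U) (M : U -> 'M[R]_n) : open A ->
  (forall x, A x -> M x \in unitmx) ->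
  (forall i j, Ck k A (fun x => M x i j)) ->
  forall i j, Ck k A (fun x => invmx (M x) i j).
Proof.
move=> oA uM CM i j.
apply: (@Ck_eq _ _ _ _ _ (fun x => (\det (M x))^-1 * (\adj (M x)) i j)) => //.
  by move=> x Ax; rewrite /invmx uM // [RHS]mxE.
apply: CkM => //; first apply: CkV => //.
- by move=> x /uM; rewrite unitmxE unitfE.
- exact: Ck_det.
apply: (@Ck_eq _ _ _ _ _
   (fun x => (-1) ^+ (j + i) * \det (row' j (col' i (M x))))) => //.
  by move=> x _; rewrite !mxE.
apply: CkM => //; first exact: Ck_cst.
apply: Ck_det => // a b; apply: Ck_eq (CM (lift j a) (lift i b)) => // x _.
by rewrite !mxE.
Qed.

End SmoothMatrix.

(** * The inverse function theorem *)

Section MeanValueInequality.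
Context {R : realType}.

Lemma ball_line n (x0 x v : 'rV[R]_n) r (t : R) :
  ball x0 r x -> ball x0 r (x + v) -> 0 <= t <= 1 -> ball x0 r (x + t *: v).
Proof.
rewrite -!ball_normE /= => B0 B1 /andP[t0 t1].
have -> : x0 - (x + t *: v) = (1 - t) *: (x0 - x) + t *: (x0 - (x + v)).
  by apply/rowP => j; rewrite !mxE; ring.
apply: le_lt_trans (ler_normD _ _) _; rewrite !normrZ (ger0_norm t0).
rewrite ger0_norm ?subr_ge0 //.
have [->|t00] := eqVneq t 0; first by rewrite subr0 mul1r mul0r addr0.
have tpos : 0 < t by rewrite lt_def t00.
have -> : r = (1 - t) * r + t * r by ring.
by rewrite ler_ltD ?ler_wpM2l ?subr_ge0 ?ltr_pM2l // ltW.
Qed.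

(** Coordinatewise mean value theorem; no constant is lost because the norm of
    ['rV_n] is the supremum norm. *)
Lemma lipschitz_ball n p (T : 'rV[R]_n -> 'rV[R]_p) x0 r c :
  0 <= c -> (forall x, ball x0 r x -> differentiable T x) ->
  (forall x v, ball x0 r x -> `|'D_v T x| <= c * `|v|) ->
  forall x y, ball x0 r x -> ball x0 r y -> `|T x - T y| <= c * `|x - y|.
Proof.
move=> c0 dT DT x y Bx By; rewrite distrC (distrC x).
apply: row_norm_le => [|j]; first by rewrite mulr_ge0.
have Bl t : 0 <= t <= 1 -> ball x0 r (x + t *: (y - x)).
  by move=> t01; apply: ball_line => //; rewrite addrC subrK.
have [t t01|t /andP[t0 t1]] := @mvt_dir _ _ (fun z => T z 0 j) x (y - x) 1 ltr01.
  by apply: differentiable_coordf; apply: dT; exact: Bl.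
rewrite scale1r mul1r addrCA subrr addr0 !mxE => ->.
have Bt : ball x0 r (x + t *: (y - x)) by apply: Bl; rewrite !ltW.
apply: le_trans (DT _ (y - x) Bt).
rewrite -(derive_coord _ _ (dT _ Bt)); exact: ler_coord_norm.
Qed.

End MeanValueInequality.

Lemma differentiable_of_estimate {R : realType} (U V : normedModType R)
    (f : U -> V) (L : {linear U -> V}) (y : U) :
  continuous L ->
  (forall e : R, 0 < e -> exists2 d, 0 < d &
    forall h, `|h| < d -> `|f (y + h) - f y - L h| <= e * `|h|) ->
  differentiable f y /\ forall v, 'D_v f y = L v.
Proof.
move=> cL est.
have E : f \o shift y = cst (f y) + L +o_ 0 id.
  apply/eqaddoP => e /est[d d0 Hd].
  apply/nbhs_ballP; exists d => //= h.
  rewrite -ball_normE /= sub0r normrN => /Hd.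
  by rewrite !fctE /= [h + y]addrC opprD addrA.
have D : differentiable f y.
  by apply/diff_locallyP; rewrite (diff_unique cL E).
by split=> // v; rewrite deriveE // (diff_unique cL E).
Qed.

Lemma derive_mulmxr {R : realType} (m p q : nat) (F : 'rV[R]_m -> 'rV[R]_p)
    (M : 'M[R]_(p, q)) x v :
  differentiable F x ->
  differentiable (fun x => F x *m M) x /\
  'D_v (fun x => F x *m M) x = 'D_v F x *m M.
Proof.
move=> dF.
have [C C0 HC] := mulmx_bounded M.
have cM : continuous (mulmxr M : 'rV[R]_p -> 'rV[R]_q).
  move=> y B /nbhs_ballP[e /= e0 eB].
  apply/nbhs_ballP; exists (e / C) => /=; first by rewrite divr_gt0.
  move=> z; rewrite -ball_normE /= => yz.
  apply: eB; rewrite -ball_normE /= -mulmxBl.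
  apply: le_lt_trans (HC _) _.
  by rewrite -ltr_pdivlMl // mulrC.
have dM y : differentiable (mulmxr M : 'rV[R]_p -> 'rV[R]_q) y.
  exact: linear_differentiable.
split; first exact: (@differentiable_comp _ _ _ _ F (mulmxr M)).
rewrite (@derive_comp _ _ _ _ (mulmxr M) F) // deriveE // diff_lin //.
Qed.

Section InverseFunction.
Context {R : realType} {n : nat}.
Variables (G : 'rV[R]_n -> 'rV[R]_n) (A : set 'rV[R]_n) (x0 : 'rV[R]_n).
Hypotheses (oA : open A) (Ax0 : A x0) (sG : smooth_on A G).

Definition jac x : 'M[R]_n := \matrix_(a, b) 'D_(delta_mx 0 a) G x 0 b.

Lemma jacE x v : A x -> 'D_v G x = v *m jac x.
Proof.
move=> Ax; rewrite derive_basis; last exact: smooth_diff sG Ax.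
apply/rowP => b; rewrite summxE mxE; apply: eq_bigr => a _.
by rewrite !mxE.
Qed.

Lemma diff_estimate x e : A x -> 0 < e -> exists2 d, 0 < d &
  forall h, `|h| < d -> `|G (x + h) - G x - h *m jac x| <= e * `|h|.
Proof.
move=> Ax e0; have dG := smooth_diff sG Ax.
have /diff_locally /eqaddoP /(_ e e0) := dG.
move=> /nbhs_ballP[d /= d0 Hd]; exists d => // h hd.
have := Hd h; rewrite -ball_normE /= sub0r normrN => /(_ hd).
rewrite !fctE /= -(jacE h Ax) deriveE // [h + x]addrC.
by rewrite opprD addrA.
Qed.

Hypothesis G_inj : forall v, 'D_v G x0 = 0 -> v = 0.

Let P := invmx (jac x0).

Lemma jac0_unit : jac x0 \in unitmx.
Proof.
rewrite -row_free_unit; apply/inj_row_free => v; rewrite -jacE //; exact: G_inj.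
Qed.

Let T x := x - G x *m P.

Lemma T_diff x v : A x -> differentiable T x /\ 'D_v T x = v *m (1%:M - jac x *m P).
Proof.
move=> Ax; have dG := smooth_diff sG Ax.
have [d1 D1] := derive_mulmxr P v dG.
have d2 : differentiable (id : 'rV[R]_n -> 'rV[R]_n) x by exact: ex_diff.
split; first exact: (differentiableB d2 d1).
rewrite (@deriveB _ _ _ id (fun x => G x *m P)); [|exact: diff_derivable..].
by rewrite derive_id D1 jacE // mulmxBr mulmx1 mulmxA.
Qed.

(** The derivative of [T] vanishes at [x0] and is continuous, so [T] is a
    contraction near [x0]. *)
Lemma contraction_radius : exists2 r, 0 < r & 
  ball x0 r `<=` A /\ forall x y, ball x0 r x -> ball x0 r y ->
    `|T x - T y| <= 2^-1 * `|x - y|.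
Proof.
pose E x := 1%:M - jac x *m P.
(* n entries bounded by c make the operator norm at most 1/2; the successor
   keeps c finite when n = 0. *)
pose c : R := (2 * n.+1%:R)^-1.
have c0 : 0 < c by rewrite invr_gt0 mulr_gt0.
have cT a : {for x0, continuous ('D_(delta_mx 0 a) T)}.
  apply: differentiable_continuous.
  have [d1 _] := @derive_mulmxr _ _ _ _ ('D_(delta_mx 0 a) G) P x0 0
    (smooth_diff (smooth_derive (delta_mx 0 a) sG) Ax0).
  have d2 : differentiable (cst (delta_mx 0 a : 'rV[R]_n) : 'rV[R]_n -> _) x0.
    exact: ex_diff.
  apply: differentiable_near_eq (differentiableB d2 d1).
  apply: (near_eq_open oA) => // y Ay.
  by have [_ ->] := T_diff (delta_mx 0 a) Ay; rewrite mulmxBr mulmx1 mulmxA -jacE.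
have E0 a : 'D_(delta_mx 0 a) T x0 = 0.
  have [_ ->] := T_diff (delta_mx 0 a) Ax0.
  by rewrite mulmxV ?jac0_unit // subrr mulmx0.
have : nbhs x0 (A `&` [set x | forall a, `|'D_(delta_mx 0 a) T x| < c]).
  apply: filterI; first exact: open_nbhs_nbhs.
  have := @filter_forall _ _ (fun (a : 'I_n) x => `|'D_(delta_mx 0 a) T x| < c)
    (nbhs x0) (nbhs_filter x0).
  apply=> a.
  have /cvgrPdist_lt /(_ c c0) := cT a; rewrite E0.
  by apply: filterS => x; rewrite sub0r normrN.
move=> /nbhs_ballP[r /= r0 rA]; exists r => //; split; first by move=> x /rA[].
apply: lipschitz_ball => [|x /rA[Ax _]|x v /rA[Ax Hx]].
- by rewrite invr_ge0.
- by have [] := T_diff 0 Ax.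
- have [_ ->] := T_diff v Ax.
  apply: le_trans (mulmx_norm_le v (ltW c0) _) _.
    move=> a b; apply: le_trans (ltW (Hx a)).
    have [_ ->] := T_diff (delta_mx 0 a) Ax.
    rewrite -rowE; apply: le_trans (ler_coord_norm _ b).
    by rewrite [X in _ <= `|X|]mxE.
  apply: ler_wpM2r => //; rewrite -[c *+ n]mulr_natl /c invfM.
  rewrite [leLHS]mulrCA ler_piMr ?invr_ge0 //.
  by rewrite ler_pdivrMr // mul1r ler_nat.
Qed.

(** Solving [G x = y] amounts to finding a fixed point of [x |-> T x + y P]. The
    Lipschitz bound on the inverse is what its differentiability rests on. *)
Lemma inverse_exists : exists (s c : R) (H : 'rV[R]_n -> 'rV[R]_n),
  [/\ 0 < s, 0 < c, ball x0 s `<=` A,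
    (forall x y, ball x0 s x -> ball x0 s y -> `|x - y| <= c * `|G x - G y|) &
    (forall y, `|(y - G x0) *m P| < s / 2 -> ball x0 s (H y) /\ G (H y) = y)].
Proof.
have [r r0 [rA Tc]] := contraction_radius.
have [c c0 Hc] := mulmx_bounded P.
pose s := r / 2; have s0 : 0 < s by rewrite divr_gt0.
have sr : s < r by rewrite ltr_pdivrMr // ltr_pMr // ltr1n.
have srB : closed_ball x0 s `<=` ball x0 r.
  move=> x; rewrite closed_ballE // -ball_normE /= => xs.
  exact: le_lt_trans sr.
have lip x y : ball x0 r x -> ball x0 r y ->
    `|x - y| <= 2 * `|(G x - G y) *m P|.
  move=> Bx By; have /= H1 := Tc _ _ Bx By.
  have E : x - y = (T x - T y) + (G x - G y) *m P.
    by rewrite /T mulmxBl; apply/rowP => j; rewrite !mxE; ring.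
  have : `|x - y| <= 2^-1 * `|x - y| + `|(G x - G y) *m P|.
    rewrite {1}E; apply: le_trans (ler_normD _ _) _; exact: lerD.
  lra.
have solve y : exists x, `|(y - G x0) *m P| < s / 2 -> ball x0 s x /\ G x = y.
  have [Hy|Hy] := boolP (`|(y - G x0) *m P| < s / 2); last by exists 0.
  pose U := closed_ball x0 s.
  pose f x := T x + y *m P.
  have Ux0 : U x0 by rewrite /U closed_ballE //= /closed_ball_ /= subrr normr0 ltW.
  have fx0 : `|x0 - f x0| < s / 2.
    rewrite /f /T (_ : x0 - _ = - ((y - G x0) *m P)) ?normrN //.
    by rewrite mulmxBl; apply/rowP => j; rewrite !mxE; ring.
  have f_near x : U x -> `|x0 - f x| < s.
    move=> Ux; rewrite -(subrKA (f x0)).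
    apply: le_lt_trans (ler_normD _ _) _.
    have -> : f x0 - f x = T x0 - T x.
      by rewrite /f; apply/rowP => j; rewrite !mxE; ring.
    have H1 := Tc _ _ (srB _ Ux0) (srB _ Ux).
    have H2 : `|x0 - x| <= s by move: Ux; rewrite /U closed_ballE.
    lra.
  have fU : set_fun U U f.
    move=> x /f_near Hx; rewrite /U closed_ballE //= /closed_ball_ /=.
    exact: ltW.
  pose F : {fun U >-> U} := mkfun fU.
  have ctr : is_contraction F.
    exists (2^-1)%:nng; split=> /=; first by rewrite invf_lt1 ?ltr1n.
    move=> [x z] [/= Ux Uz].
    rewrite (_ : f x - f z = T x - T z); first exact: Tc (srB _ Ux) (srB _ Uz).
    by rewrite /f; apply/rowP => j; rewrite !mxE; ring.
  pose X : completeNormedModType R := HB.pack 'rV[R]_n.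
  have [x Ux xF] := @banach_fixed_point R X U F ctr
    (@closed_ball_closed _ _ x0 s) (ex_intro _ x0 Ux0).
  exists x => _; split.
    by rewrite -ball_normE /= xF; exact: f_near.
  have : (y - G x) *m P = 0.
    rewrite mulmxBl; have : x = T x + y *m P by [].
    by rewrite /T -addrA -{1}[x]addr0 => /addrI/esym; rewrite addrC.
  move=> /(congr1 (mulmx^~ (jac x0))); rewrite mul0mx -mulmxA mulVmx ?jac0_unit //.
  by rewrite mulmx1 => /eqP; rewrite subr_eq0 eq_sym => /eqP.
have [H HH] := choice solve.
exists s, (2 * c), H; split => //.
- by rewrite mulr_gt0.
- by move=> x /(@subset_closed_ball _ _ x0 s)/srB/rA.
- move=> x y /(@subset_closed_ball _ _ x0 s)/srB Bx /(@subset_closed_ball _ _ x0 s)/srB By.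
  apply: le_trans (lip _ _ Bx By) _.
  by rewrite -mulrA ler_wpM2l.
Qed.

(** Once the inverse [H] is known to be Lipschitz, differentiability of [G] at [H y]
    gives that of [H] at [y], with ['D_v H y = v (jac (H y))^-1]; this formula
    then propagates smoothness from one order to the next. *)
Lemma inverse_function : exists (O B : set 'rV[R]_n) (H : 'rV[R]_n -> 'rV[R]_n),
  [/\ open O, O x0, O `<=` A & open B] /\
  [/\ forall x, O x -> B (G x) /\ H (G x) = x,
      forall y, B y -> O (H y) /\ G (H y) = y & smooth_on B H].
Proof.
have [s [c [H [s0 c0 sA lip HH]]]] := inverse_exists.
pose B : set 'rV[R]_n := [set y | `|(y - G x0) *m P| < s / 2].
have [C C0 HC] := mulmx_bounded P.
have oB : open B.
  rewrite openE => y By; rewrite /interior; apply/nbhs_ballP.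
  pose e := (s / 2 - `|(y - G x0) *m P|) / C.
  exists e => /=; first by rewrite divr_gt0 // subr_gt0.
  move=> z; rewrite -ball_normE /= ltr_pdivlMr // mulrC => yz.
  rewrite /B /= (_ : z - G x0 = - (y - z) + (y - G x0)); last first.
    by apply/rowP => j; rewrite !mxE; ring.
  rewrite mulmxDl mulNmx; apply: le_lt_trans (ler_normD _ _) _; rewrite normrN.
  rewrite -ltrBrDr; exact: le_lt_trans (HC _) yz.
have oO : open (ball x0 s `&` G @^-1` B).
  rewrite openE => x [xs xB]; apply: filterI.
    by apply: open_nbhs_nbhs; split => //; exact: ball_open.
  have cG := differentiable_continuous (smooth_diff sG (sA _ xs)).
  by apply: cG; apply: open_nbhs_nbhs.
have HG x : ball x0 s x -> B (G x) -> H (G x) = x.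
  move=> xs xB; have [H1 H2] := HH _ xB.
  have := lip _ _ H1 xs; rewrite H2 subrr normr0 mulr0 normr_le0 subr_eq0.
  by move/eqP.
have Hlip y z : B y -> B z -> `|H y - H z| <= c * `|y - z|.
  move=> /HH[Hy Ey] /HH[Hz Ez]; have := lip _ _ Hy Hz; by rewrite Ey Ez.
(* A kernel vector h of the Jacobian at x would move G by o(h) only, against the
   Lipschitz bound. *)
have junit x : ball x0 s x -> jac x \in unitmx.
  move=> xs; rewrite -row_free_unit; apply/inj_row_free => v vJ.
  have e0 : 0 < (2 * c)^-1 by rewrite invr_gt0 mulr_gt0.
  have [d d0 Hd] := diff_estimate (sA _ xs) e0.
  have /nbhs_ballP[r /= r0 rs] : nbhs x (ball x0 s).
    by apply: open_nbhs_nbhs; split => //; exact: ball_open.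
  have [//|v0] := eqVneq v 0.
  have v0' : 0 < `|v| by rewrite normr_gt0.
  pose m := Num.min d r; have m0 : 0 < m by rewrite lt_min d0.
  pose h := (m / 2 / `|v|) *: v.
  have nh : `|h| = m / 2.
    by rewrite normrZ ger0_norm ?divfK ?gt_eqF // !divr_ge0 // ltW.
  have hm : `|h| < m by rewrite nh ltr_pdivrMr // ltr_pMr // ltr1n.
  have hJ : h *m jac x = 0 by rewrite -scalemxAl vJ scaler0.
  have := Hd h; rewrite hJ subr0 => /(_ (lt_le_trans hm _)) H1.
  have {H1} H1 : `|G (x + h) - G x| <= (2 * c)^-1 * `|h|.
    by apply: H1; rewrite ge_min lexx.
  have xh : ball x0 s (x + h).
    apply: rs; rewrite -ball_normE /= opprD addrA subrr add0r normrN.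
    by apply: lt_le_trans hm _; rewrite ge_min lexx orbT.
  have := lip _ _ xh xs; rewrite addrAC subrr add0r => H2.
  have H3 : `|h| <= c * ((2 * c)^-1 * `|h|).
    by apply: le_trans H2 _; rewrite ler_wpM2l // ltW.
  have H4 : c * ((2 * c)^-1 * `|h|) = `|h| / 2.
    by field; rewrite gt_eqF.
  rewrite H4 nh in H3.
  have m2 : 0 < m / 2 by rewrite divr_gt0.
  by move: H3; rewrite leNgt ltr_pdivrMr // ltr_pMr // ltr1n.
have Hdiff y v : B y -> differentiable H y /\
   'D_v H y = v *m invmx (jac (H y)).
  move=> By; have [xs Gx] := HH _ By.
  set x := H y in xs Gx *; set M := invmx (jac x).
  have [K K0 HK] := mulmx_bounded M.
  have cM : continuous (mulmxr M : 'rV[R]_n -> 'rV[R]_n).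
    move=> z; apply: differentiable_continuous.
    have did : differentiable (id : 'rV[R]_n -> 'rV[R]_n) z by exact: ex_diff.
    by have [] := derive_mulmxr M 0 did.
  suff est : forall e : R, 0 < e -> exists2 d, 0 < d & forall h, `|h| < d ->
      `|H (y + h) - H y - h *m M| <= e * `|h|.
    by have [D1 D2] := differentiable_of_estimate cM est; split => //; exact: D2.
  move=> e e0.
    have e10 : 0 < e / (c * K) by rewrite divr_gt0 // mulr_gt0.
    have [d d0 Hd] := diff_estimate (sA _ xs) e10.
    have /nbhs_ballP[r /= r0 rB] : nbhs y B by apply: open_nbhs_nbhs.
    pose m := Num.min (d / c) r.
    have m0 : 0 < m by rewrite lt_min divr_gt0.
    exists m => //= h hm.
    have Byh : B (y + h).
      apply: rB; rewrite -ball_normE /= opprD addrA subrr add0r normrN.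
      by apply: lt_le_trans hm _; rewrite ge_min lexx orbT.
    pose k := H (y + h) - x.
    have kh : `|k| <= c * `|h|.
      have := Hlip _ _ Byh By; by rewrite addrAC subrr add0r.
    have kd : `|k| < d.
      apply: le_lt_trans kh _; rewrite -ltr_pdivlMl // mulrC.
      by apply: lt_le_trans hm _; rewrite ge_min lexx.
    have := Hd k kd.
    have -> : x + k = H (y + h) by rewrite /k addrC subrK.
    have [_ ->] := HH _ Byh; rewrite Gx [y + h - y]addrAC subrr add0r => H1.
    rewrite -/x -/k.
    have -> : k - h *m M = - ((h - k *m jac x) *m M).
      rewrite mulmxBl -mulmxA mulmxV ?junit // mulmx1; by rewrite opprB.
    rewrite normrN; apply: le_trans (HK _) _.
    rewrite mulrC -ler_pdivlMr //; apply: le_trans H1 _.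
    apply: le_trans (_ : e / (c * K) * (c * `|h|) <= _).
      by rewrite ler_wpM2l // ltW.
    by rewrite le_eqVlt; apply/orP; left; apply/eqP; field; rewrite !gt_eqF.
exists (ball x0 s `&` G @^-1` B), B, H; split; split => //.
- split; first exact: ballxx.
  by rewrite /B /= subrr mul0mx normr0 divr_gt0.
- by move=> x [/sA].
- by move=> x [xs xB]; split => //; exact: HG.
- move=> y By; have [H1 H2] := HH _ By; split => //; split => //=.
  by rewrite H2.
apply/smooth_onP; elim=> [|k IH].
  by split=> // y By; have [] := Hdiff y 0 By.
split=> [y By|v]; first by have [] := Hdiff y 0 By.
apply: (@Ck_eq _ _ _ _ _ (fun y => v *m invmx (jac (H y)))) => //.
  by move=> y By; have [_ ->] := Hdiff y v By.
apply/(Ck_rowP _ _ oB) => j.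
apply: (@Ck_eq _ _ _ _ _ (fun y => \sum_a v 0 a * invmx (jac (H y)) a j)) => //.
  by move=> y By; rewrite mxE.
apply: Ck_sum => // a; apply: CkM => //; first exact: Ck_cst.
apply: Ck_invmx => // [y By|a' b'].
  by apply: junit; have [] := HH _ By.
have sGab : smooth_on A (fun x => 'D_(delta_mx 0 a') G x 0 b').
  by move: b'; apply/(smooth_rowP _ oA); exact: smooth_derive.
apply: (@Ck_eq _ _ _ _ _ (fun y => 'D_(delta_mx 0 a') G (H y) 0 b')) => //.
  by move=> y By; rewrite mxE.
apply: (@Ck_comp _ _ _ _ _ A (fun x => 'D_(delta_mx 0 a') G x 0 b')) => //.
  exact: (smooth_onP _ _).1.
by move=> y By; apply: sA; have [] := HH _ By.
Qed.

End InverseFunction.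

(** * Even permutations and quaternionic linear algebra *)

Lemma even3_rot i j k : even3 i j k -> even3 j k i.
Proof.
by case: i j k => [[|[|[|i]]] Hi] // [[|[|[|j]]] Hj] // [[|[|[|k]]] Hk].
Qed.

Lemma even3_ex (i : 'I_3) : exists j k, even3 i j k.
Proof.
case: i => [[|[|[|i]]] Hi] //.
- by exists 1, 2.
- by exists 2, 0.
- by exists 0, 1.
Qed.

Lemma even3_succ i j k : even3 i j k -> j = i + 1 /\ k = i + 2.
Proof.
rewrite /even3 !inE => /or3P[] /eqP[-> -> ->]; by split; apply: val_inj.
Qed.

Lemma even3_self (i : 'I_3) : even3 i (i + 1) (i + 2).
Proof. by have [j [k ev]] := even3_ex i; have [<- <-] := even3_succ ev. Qed.

Lemma even3_cases i j k l : even3 i j k -> [\/ l = i, l = j | l = k].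
Proof.
rewrite /even3 !inE => /or3P[] /eqP[-> -> ->];
case: l => [[|[|[|l']]] Hl'] //;
by [constructor 1; apply: val_inj|constructor 2; apply: val_inj
   |constructor 3; apply: val_inj].
Qed.

Lemma sum_even3 (V : nmodType) (F : 'I_3 -> V) i j k : even3 i j k ->
  \sum_l F l = F i + F j + F k.
Proof.
have S : \sum_l F l = F 0 + F 1 + F 2.
  rewrite !big_ord_recl big_ord0 addr0 addrA.
  by congr (F _ + F _ + F _); apply: val_inj.
rewrite S /even3 !inE => /or3P[] /eqP[-> -> ->] //.
  by rewrite -[LHS]addrA [LHS]addrC.
by rewrite -[RHS]addrA [RHS]addrC.
Qed.

Section Span3.
Context {K : fieldType} {V : vectType K} (f : 'I_3 -> V).

Lemma span3_mem l : f l \in <<[:: f 0%R; f 1%R; f 2%R]>>%VS.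
Proof.
apply: memv_span; rewrite !inE.
by have [->|->|->] := @even3_cases 0 1 2 l isT; rewrite eqxx ?orbT.
Qed.

Lemma span3P v : v \in <<[:: f 0%R; f 1%R; f 2%R]>>%VS ->
  exists c : 'I_3 -> K, v = \sum_l c l *: f l.
Proof.
rewrite span_cons => /memv_addP[_ /vlineP[a ->] [v1 + ->]].
rewrite span_cons => /memv_addP[_ /vlineP[b ->] [v2 + ->]].
rewrite span_seq1 => /vlineP[c ->].
exists (fun l => if l == 0 then a else if l == 1 then b else c).
by rewrite (@sum_even3 _ _ 0 1 2) //= addrA.
Qed.

Lemma span3_sub (W : {vspace V}) :
  (forall l, f l \in W) -> (<<[:: f 0%R; f 1%R; f 2%R]>> <= W)%VS.
Proof.
by move=> fW; apply/span_subvP => v; rewrite !inE => /or3P[] /eqP ->.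
Qed.

End Span3.

(** In the application [B i u] is the covariant derivative of [J i] along [u], less
    an infinitesimal rotation of the frame: the cyclic identity says that the
    twisted exterior derivatives of the three Kaehler forms vanish. *)
Section HitchinAlgebra.
Context {R : realType} {V : lmodType R}.
Variables (h : V -> V -> R) (J : 'I_3 -> {linear V -> V}).
Hypothesis h_linl : forall u, linear_for *%R (h^~ u).
Hypothesis h_linr : forall u, linear_for *%R (h u).
Hypothesis h_nondeg : forall v, (forall w, h v w = 0) -> v = 0.
Hypothesis J_sq : forall i v, J i (J i v) = - v.
Hypothesis J_mul : forall i j k, even3 i j k -> forall v,
  J i (J j v) = J k v /\ J j (J i v) = - J k v.
Hypothesis J_skew : forall i u v, h (J i u) v = - h u (J i v).
Variable B : 'I_3 -> V -> V -> V.
Hypothesis B_lin1 : forall i v, linear (B i ^~ v).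
Hypothesis B_lin2 : forall i u, linear (B i u).
Hypothesis B_cyclic : forall i u v w,
  h (B i u v) w + h (B i v w) u + h (B i w u) v = 0.
Hypothesis B_anti : forall i u v, B i u (J i v) = - J i (B i u v).
Hypothesis B_der : forall i j k, even3 i j k -> forall u v,
  B k u v = B i u (J j v) + J i (B j u v) /\
  B k u v = - (B j u (J i v) + J j (B i u v)).

Let hDl u v w : h (u + v) w = h u w + h v w.
Proof. by have := h_linl w 1 u v; rewrite scale1r mul1r. Qed.

Let h0l w : h 0 w = 0.
Proof. by apply: (addrI (h 0 w)); rewrite -hDl !addr0. Qed.

Let hNl v w : h (- v) w = - h v w.
Proof. by apply/eqP; rewrite -addr_eq0 -hDl addNr h0l. Qed.

Let hDr u v w : h u (v + w) = h u v + h u w.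
Proof. by have := h_linr u 1 v w; rewrite scale1r mul1r. Qed.

Let h0r w : h w 0 = 0.
Proof. by apply: (addrI (h w 0)); rewrite -hDr !addr0. Qed.

Let hNr v w : h v (- w) = - h v w.
Proof. by apply/eqP; rewrite -addr_eq0 -hDr addNr h0r. Qed.

Let BN1 i u v : B i (- u) v = - B i u v.
Proof.
pose bM := GRing.isLinear.Build _ _ _ _ _ (B_lin1 i v).
pose b : {linear _ -> _} := HB.pack (B i ^~ v) bM.
by rewrite -[LHS]/(b _) linearN.
Qed.

Let BN2 i u v : B i u (- v) = - B i u v.
Proof.
pose bM := GRing.isLinear.Build _ _ _ _ _ (B_lin2 i u).
pose b : {linear _ -> _} := HB.pack (B i u) bM.
by rewrite -[LHS]/(b _) linearN.
Qed.

Lemma self_opp (x : R) : x = - x -> x = 0.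
Proof. by move=> H; lra. Qed.

Lemma self_oppv (x : V) : x = - x -> x = 0.
Proof.
move=> H; have : (2 : R) *: x = 0 by rewrite scaler_nat mulr2n {1}H addNr.
by move/eqP; rewrite scaler_eq0 pnatr_eq0 /= => /eqP.
Qed.

(** This uses a single [i]. With [b u v w := h (B i u v) w], which satisfies
    [b u (J v) w = b u v (J w)], comparing the cyclic identity at [(u, v, w)] and
    at [(u, J v, J w)] shows that [q v w u := b (J v) (J w) u + b v w u] changes
    sign under a cyclic shift; three shifts are the identity, so [q = 0]. *)
Lemma quasi_kaehler i u v : B i (J i u) v = B i u (J i v).
Proof.
have bJ x y z : h (B i x (J i y)) z = h (B i x y) (J i z).
  by rewrite B_anti hNl J_skew opprK.
pose q y z x := h (B i (J i y) (J i z)) x + h (B i y z) x.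
have q_shift y z x : q y z x = - q z x y.
  have H1 := B_cyclic i x (J i y) (J i z); have H2 := B_cyclic i x y z.
  have E1 : h (B i x (J i y)) (J i z) = - h (B i x y) z by rewrite bJ J_sq hNr.
  have E2 : h (B i (J i z) x) (J i y) = h (B i (J i z) (J i x)) y by rewrite bJ.
  rewrite E1 E2 in H1; rewrite /q; lra.
have q0 y z x : q y z x = 0.
  apply: self_opp; by rewrite {1}q_shift q_shift opprK q_shift.
have E y z : B i (J i y) (J i z) = - B i y z.
  apply/eqP; rewrite -subr_eq0 opprK; apply/eqP/h_nondeg => x.
  by rewrite hDl; exact: q0.
have := E u (J i v); rewrite J_sq BN2 => /eqP.
by rewrite eqr_opp => /eqP.
Qed.

(** One has B k = [A, J k] where A = sum_k J k S_k and the S_k commute with all the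
   J l; for even (i, j, k), s i j is 4 S_k. *)
Let s (i j : 'I_3) u v := J i (B j u v) + B j u (J i v).

Let sN i j u v : s i j (- u) v = - s i j u v.
Proof. by rewrite /s !BN1 linearN opprD. Qed.

Let h_eq x y : (forall w, h x w = h y w) -> x = y.
Proof.
move=> E; apply/eqP; rewrite -subr_eq0; apply/eqP/h_nondeg => w.
by rewrite hDl hNl E subrr.
Qed.

Let s_alt i j k u v : even3 i j k -> s i j u v = - s j i u v.
Proof.
move=> ev; have [H1 H2] := B_der ev u v; apply: h_eq => w.
have := congr1 (h^~ w) H1; have /= := congr1 (h^~ w) H2.
rewrite /s !(hDl, hNl); lra.
Qed.

(** The two halves of s j i are evaluated by [quasi_kaehler]. *)
Let s_shift i j k u v : even3 i j k -> s i j (J i u) v = - s k i u v.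
Proof.
move=> ev; rewrite (s_alt _ _ ev) /s !quasi_kaehler.
have [E1 E2] := J_mul ev v; rewrite E1 B_anti linearN.
have [_ ->] := J_mul ev (B i u v).
by rewrite opprK.
Qed.

Let s_rot i j k u v : even3 i j k -> s j k (J i u) v = - s k i (J j u) v.
Proof.
move=> ev; have ev' := even3_rot (even3_rot ev).
rewrite -[LHS]opprK -(s_shift _ _ ev').
by have [-> _] := J_mul ev' u.
Qed.

(** By [s_rot] the three vectors S_i (J_i u) are pairwise opposite, hence zero. *)
Let s0 i j k u v : even3 i j k -> s i j u v = 0.
Proof.
move=> ev; have ev1 := even3_rot ev; have ev2 := even3_rot ev1.
have z w : s i j (J k w) v = 0.
  apply: self_oppv.
  by rewrite {1}(s_rot _ _ ev2) (s_rot _ _ ev) opprK (s_rot _ _ ev1).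
by have := z (J k u); rewrite J_sq sN => /eqP; rewrite oppr_eq0 => /eqP.
Qed.

(** A pointwise form of Hitchin's theorem that an almost hyperkaehler structure with
    closed Kaehler forms is hyperkaehler. As every [S_k] vanishes, [B k]
    anticommutes with each [J l]; then it commutes with [J k = J i J j], and
    [J k (B k) = 0]. *)
Lemma hitchin k u v : B k u v = 0.
Proof.
have [i [j ev']] := even3_ex k.
have ev : even3 i j k := even3_rot ev'.
have anti a b c w : even3 a b c -> B b u (J a w) = - J a (B b u w).
  move=> ev1; apply/eqP; rewrite -addr_eq0 addrC; apply/eqP.
  exact: s0 ev1.
have anti' a b c w : even3 a b c -> B a u (J b w) = - J b (B a u w).
  move=> ev1; apply/eqP; rewrite -addr_eq0 addrC; apply/eqP.
  by have := s_alt u w ev1; rewrite (s0 _ _ ev1) => /esym/eqP; rewrite oppr_eq0 => /eqP.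
have E : B k u (J k v) = J k (B k u v).
  have [<- _] := J_mul ev v.
  rewrite (anti' _ _ _ _ ev') (anti _ _ _ _ (even3_rot ev)) linearN opprK.
  by have [-> _] := J_mul ev (B k u v).
have : J k (B k u v) = 0 by apply: self_oppv; rewrite -{1}E B_anti.
move=> /(congr1 (J k)); rewrite J_sq linear0 => /eqP.
by rewrite oppr_eq0 => /eqP.
Qed.

End HitchinAlgebra.

(** * Vector fields and maps in charts *)

Lemma open_preimage_in (S T : topologicalType) (f : S -> T) (W : set S) (D : set T) :
  open W -> {in W, continuous f} -> open D -> open (W `&` f @^-1` D).
Proof.
move=> oW cf oD; rewrite openE => x [Wx Dx]; apply: filterI.
  exact: open_nbhs_nbhs.
by apply: cf; [rewrite inE|exact: open_nbhs_nbhs].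
Qed.

Lemma derive_comp_near {R : realType} (U V W : normedModType R) (A : set U)
    (F : U -> W) (f : V -> W) (g : U -> V) x u :
  open A -> A x -> (forall y, A y -> F y = f (g y)) ->
  differentiable g x -> differentiable f (g x) ->
  'D_u F x = 'D_('D_u g x) f (g x).
Proof.
move=> oA Ax E dg df; rewrite -derive_comp //.
by apply: near_eq_derive; exact: near_eq_open oA E Ax.
Qed.

Section Charts.
Context {R : realType} {m : nat} {M : manifold R m}.
Implicit Types (c p q : M) (W : set M) (u v : 'rV[R]_m).

Definition cdom c := dom (chart_at c).
Definition ccod c := cod (chart_at c).
Definition cto c := to (chart_at c).
Definition cfrom c := from (chart_at c).
(** The part of the coordinate space of [c] that parametrizes [W]. *)
Definition coords c W : set 'rV[R]_m := ccod c `&` cfrom c @^-1` W.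

Lemma cdom_open c : open (cdom c). Proof. exact: dom_open. Qed.

Lemma open_coords c W : open W -> open (coords c W).
Proof. exact: open_preimage_in (@cod_open _ _ _ _) (@from_continuous _ _ _ _). Qed.

Lemma cto_coords c W p : cdom c p -> W p -> coords c W (cto c p).
Proof. by move=> cp Wp; split; [exact: to_cod|rewrite /= /cfrom /cto toK]. Qed.

Lemma ctoK c p : cdom c p -> cfrom c (cto c p) = p.
Proof. exact: toK. Qed.

Lemma cfromK c x : ccod c x -> cto c (cfrom c x) = x.
Proof. exact: fromK. Qed.

Lemma cfrom_dom c x : ccod c x -> cdom c (cfrom c x).
Proof. exact: from_dom. Qed.

Lemma cdom_self p : cdom p p. Proof. exact: chart_at_dom. Qed.

Lemma smooth_transition c c' :
  smooth_on (coords c (cdom c')) (cto c' \o cfrom c).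
Proof. exact: chart_at_smooth. Qed.

Arguments smooth_transition : clear implicits.

Fact dtrans_key : unit. Proof. exact: tt. Qed.
(** [dtrans c c' p] is the derivative at [p] of the transition from the chart of [c]
    to that of [c']; unlike in [tchange], neither chart need be the preferred chart
    at [p], which makes the cocycle rule [dtrans_comp] available. *)
Definition dtrans : M -> M -> M -> 'Hom('rV[R]_m, 'rV[R]_m) :=
  locked_with dtrans_key
    (fun c c' p => linfun ('d (cto c' \o cfrom c) (cto c p))).

Lemma tchangeE p q : tchange p q = dtrans p q p. Proof. by rewrite /dtrans unlock. Qed.

Lemma transition_diff c c' p : cdom c p -> cdom c' p ->
  differentiable (cto c' \o cfrom c) (cto c p).
Proof.
move=> cp c'p; apply: (smooth_diff (smooth_transition c c')).
exact: cto_coords.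
Qed.

Lemma transition_point c c' p : cdom c p ->
  (cto c' \o cfrom c) (cto c p) = cto c' p.
Proof. by move=> cp /=; rewrite ctoK. Qed.

Lemma dtransE c c' p u : cdom c p -> cdom c' p ->
  dtrans c c' p u = 'D_u (cto c' \o cfrom c) (cto c p).
Proof.
move=> cp c'p; rewrite (deriveE _ (transition_diff cp c'p)) /dtrans locked_withE.
exact: lfunE.
Qed.

Lemma dtrans_comp c c' c'' p u : cdom c p -> cdom c' p -> cdom c'' p ->
  dtrans c' c'' p (dtrans c c' p u) = dtrans c c'' p u.
Proof.
move=> cp c'p c''p; rewrite (dtransE u cp c'p) (dtransE _ c'p c''p).
rewrite (dtransE u cp c''p); apply/esym.
have E := @derive_comp_near _ _ _ _ (coords c (cdom c')) (cto c'' \o cfrom c)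
  (cto c'' \o cfrom c') (cto c' \o cfrom c) (cto c p) u.
rewrite E.
- by rewrite (transition_point c' cp).
- exact/open_coords/cdom_open.
- exact: cto_coords.
- by move=> y [_ c'y] /=; rewrite ctoK.
- exact: transition_diff.
- rewrite (transition_point c' cp); exact: transition_diff.
Qed.

Lemma dtrans_id c p u : cdom c p -> dtrans c c p u = u.
Proof.
move=> cp; rewrite dtransE //.
rewrite (@near_eq_derive _ _ _ _ id) ?derive_id //.
apply: (near_eq_open (open_coords (cdom_open c))); last exact: cto_coords.
by move=> y [cy _] /=; rewrite cfromK.
Qed.

(** The coordinate vector fields of a fixed chart, written in the preferred chart at
    each point. *)
Definition coord_field c u p : 'rV[R]_m := dtrans c p p u.

Lemma coord_field_linear c p : linear (coord_field c ^~ p).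
Proof. by move=> a u v; rewrite /coord_field linearP. Qed.

Lemma coord_field_self p u : coord_field p u p = u.
Proof. by rewrite /coord_field dtrans_id //; exact: cdom_self. Qed.

Lemma dtrans_coord_field c c' p u : cdom c p -> cdom c' p ->
  dtrans p c' p (coord_field c u p) = dtrans c c' p u.
Proof. by move=> cp c'p; rewrite dtrans_comp //; exact: cdom_self. Qed.

Lemma dtrans_coord_fieldK c p u : cdom c p -> dtrans p c p (coord_field c u p) = u.
Proof. by move=> cp; rewrite dtrans_coord_field // dtrans_id. Qed.

Lemma coord_field_dtransK c p v : cdom c p -> coord_field c (dtrans p c p v) p = v.
Proof. by move=> cp; rewrite /coord_field dtrans_comp ?dtrans_id //; exact: cdom_self. Qed.

Lemma vf_in_chart_coord_field c q u x : ccod q x -> cdom c (cfrom q x) ->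
  vf_in_chart q (coord_field c u) x = 'D_u (cto q \o cfrom c) (cto c (cfrom q x)).
Proof.
move=> qx cx; have qx' := cfrom_dom qx.
by rewrite -(dtransE u cx qx') -(dtrans_coord_field u cx qx') -tchangeE.
Qed.

Lemma smooth_coord_field c u : smooth_vf (cdom c) (coord_field c u).
Proof.
move=> q; rewrite -/(cfrom q) -/(ccod q) -/(coords q (cdom c)).
have oA : open (coords q (cdom c)) by exact/open_coords/cdom_open.
apply: (@smooth_eq _ _ _ _
  (fun x => 'D_u (cto q \o cfrom c) ((cto c \o cfrom q) x))) => //.
  by move=> x [qx cx]; rewrite vf_in_chart_coord_field.
apply: (@smooth_comp _ _ _ _ _ (coords c (cdom q)) ('D_u (cto q \o cfrom c))) => //.
- exact/open_coords/cdom_open.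
- exact/smooth_derive/smooth_transition.
- exact: smooth_transition.
- move=> x [qx cx] /=; apply: cto_coords => //; exact: cfrom_dom.
Qed.

Lemma smooth_vf_sub W W' (X : M -> 'rV[R]_m) :
  W' `<=` W -> smooth_vf W X -> smooth_vf W' X.
Proof.
by move=> WW sX q; apply: smooth_sub (sX q) => x [qx /WW Wx]; split.
Qed.

Lemma smooth_fun_sub W W' (f : M -> R) :
  W' `<=` W -> smooth_fun W f -> smooth_fun W' f.
Proof.
by move=> WW sX q; apply: smooth_sub (sX q) => x [qx /WW Wx]; split.
Qed.

Lemma vf_decomp c (Y : M -> 'rV[R]_m) p : cdom c p ->
  Y p = coord_field c (vf_in_chart c Y (cto c p)) p.
Proof.
by move=> cp; rewrite /vf_in_chart -/(cfrom c) ctoK // tchangeE coord_field_dtransK.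
Qed.

Lemma smooth_fun_coords c (A : set 'rV[R]_m) (F : 'rV[R]_m -> R) :
  open A -> smooth_on A F -> 
  smooth_fun (cdom c `&` cto c @^-1` A) (fun p => F (cto c p)).
Proof.
move=> oA sF q.
rewrite -/(cfrom q) -/(ccod q) -/(coords q _).
apply: smooth_local => x [qx [cx Ax]].
pose A' := coords q (cdom c) `&` (cto c \o cfrom q) @^-1` A.
have oA' : open A'.
  rewrite openE => y [[qy cy] Ay]; apply: filterI.
    apply: open_nbhs_nbhs; split => //; exact/open_coords/cdom_open.
  have cg : {for y, continuous (cto c \o cfrom q)}.
    apply: differentiable_continuous.
    exact: (smooth_diff (smooth_transition q c)).
  by apply: cg; apply: open_nbhs_nbhs.
exists A' => //.
apply: (@smooth_comp_scalar _ _ _ A' A F (cto c \o cfrom q)) => //.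
  by apply: smooth_sub (smooth_transition q c) => y [].
by move=> y [].
Qed.

Lemma dfun_chart W (f : M -> R) c p v : open W -> W p -> smooth_fun W f ->
  cdom c p -> dfun f p v = 'D_(dtrans p c p v) (f \o cfrom c) (cto c p).
Proof.
move=> oW Wp sf cp; have pp := cdom_self p.
rewrite /dfun -/(cfrom p) -/(cto p).
rewrite (@derive_comp_near _ _ _ _ (coords p (cdom c)) (f \o cfrom p)
  (f \o cfrom c) (cto c \o cfrom p)).
- by rewrite (transition_point c pp) -(dtransE v pp cp).
- exact/open_coords/cdom_open.
- exact: cto_coords.
- by move=> y [_ cy] /=; rewrite ctoK.
- exact: transition_diff.
- rewrite (transition_point c pp); apply: (smooth_diff (sf c)).
  exact: cto_coords.
Qed.

Lemma dfun_coord_field W (f : M -> R) c p u : open W -> W p -> smooth_fun W f ->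
  cdom c p -> dfun f p (coord_field c u p) = 'D_u (f \o cfrom c) (cto c p).
Proof.
by move=> oW Wp sf cp; rewrite (dfun_chart _ oW Wp sf cp) dtrans_coord_fieldK.
Qed.

(** In the chart at [p] the bracket is the difference of the two mixed derivatives of
    the transition map. *)
Lemma lie_bracket_coord_field c p u v : cdom c p ->
  lie_bracket (coord_field c u) (coord_field c v) p = 0.
Proof.
move=> cp; have pp := cdom_self p.
have E w w' : 'D_(coord_field c w p) (vf_in_chart p (coord_field c w')) (cto p p) =
    'D_w ('D_w' (cto p \o cfrom c)) (cto c p).
  have oA : open (coords p (cdom c)) by exact/open_coords/cdom_open.
  have Ap : coords p (cdom c) (cto p p) by exact: cto_coords.
  rewrite (@derive_comp_near _ _ _ _ (coords p (cdom c))
     (vf_in_chart p (coord_field c w')) ('D_w' (cto p \o cfrom c)) (cto c \o cfrom p)).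
  - by rewrite (transition_point c pp) -(dtransE _ pp cp) dtrans_coord_fieldK.
  - exact: oA.
  - exact: Ap.
  - by move=> x [qx cx]; rewrite vf_in_chart_coord_field.
  - exact: transition_diff.
  - rewrite (transition_point c pp); 
    apply: (smooth_diff (smooth_derive w' (smooth_transition c p))).
    exact: cto_coords.
apply/eqP; rewrite subr_eq0; apply/eqP.
etransitivity; first exact: E.
etransitivity; last exact/esym/E.
apply: (@schwarz _ _ _ (coords c (cdom p))).
- exact/open_coords/cdom_open.
- exact: cto_coords.
- exact: smooth_transition.
Qed.

End Charts.

Arguments smooth_transition {R m M} c c'.

Section Maps.
Context {R : realType} {m n : nat} {M : manifold R m} {N : manifold R n}.
Variables (W : set M) (f : M -> N).
Hypotheses (oW : open W) (sf : smooth_map W f).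

Definition in_coords c d : 'rV[R]_m -> 'rV[R]_n := cto d \o f \o cfrom c.

Lemma in_coords_point c d p : cdom c p ->
  in_coords c d (cto c p) = cto d (f p).
Proof. by move=> cp; rewrite /in_coords /= ctoK. Qed.

Definition map_dom c d := coords c (W `&` f @^-1` cdom d).

Lemma preimage_open (D : set N) : open D -> open (W `&` f @^-1` D).
Proof. by apply: open_preimage_in => //; case: sf. Qed.

Lemma map_dom_open c d : open (map_dom c d).
Proof. exact/open_coords/preimage_open/cdom_open. Qed.

Lemma smooth_in_coords c d : smooth_on (map_dom c d) (in_coords c d).
Proof. by case: sf => _; exact. Qed.

Arguments smooth_in_coords : clear implicits.

Lemma in_coords_diff c d p : W p -> cdom c p -> cdom d (f p) ->
  differentiable (in_coords c d) (cto c p).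
Proof.
move=> Wp cp dp; apply: (smooth_diff (smooth_in_coords c d)).
exact: cto_coords.
Qed.

(** The differential of [f] read in arbitrary fixed charts. *)
Lemma dmap_coord_field c d p u : W p -> cdom c p -> cdom d (f p) ->
  dmap f p (coord_field c u p) = coord_field d ('D_u (in_coords c d) (cto c p)) (f p).
Proof.
move=> Wp cp dp; have pp := cdom_self p; have fpp := cdom_self (f p).
have oA c' : open (map_dom c' d) by exact: map_dom_open.
rewrite {1}/dmap lfunE /= -deriveE; last exact: (in_coords_diff Wp pp fpp).
rewrite -/(in_coords p (f p)) -/(cto p) /coord_field (dtransE _ dp fpp) (dtransE _ cp pp).
have E1 : 'D_u (in_coords c (f p)) (cto c p) =
    'D_('D_u (cto p \o cfrom c) (cto c p)) (in_coords p (f p)) (cto p p).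
  rewrite (@derive_comp_near _ _ _ _ (coords c (cdom p)) (in_coords c (f p))
    (in_coords p (f p)) (cto p \o cfrom c)).
  - by rewrite (transition_point p cp).
  - exact/open_coords/cdom_open.
  - exact: cto_coords.
  - by move=> y [_ py] /=; rewrite /in_coords /= ctoK.
  - exact: transition_diff.
  - by rewrite (transition_point p cp); exact: in_coords_diff.
etransitivity; first exact/esym/E1.
rewrite (@derive_comp_near _ _ _ _ (map_dom c d) (in_coords c (f p))
  (cto (f p) \o cfrom d) (in_coords c d)).
- by rewrite (in_coords_point d cp).
- exact: oA.
- exact: cto_coords cp (conj Wp dp).
- by move=> y [cy [Wy dy]]; rewrite /in_coords /= ctoK.
- exact: in_coords_diff.
- by rewrite (in_coords_point d cp); exact: transition_diff.
Qed.

End Maps.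

Arguments smooth_in_coords {R m n M N W f} sf c d.

(** * Exterior derivative of the structure equations *)

(** Differential forms on a coordinate domain are families [theta i x u] and
    [Omega i x u v]; the exterior derivative of [Omega i] is the cyclic sum of
    its directional derivatives, as constant vector fields commute. *)
Section StructureEquation.
Context {R : realType} {U : normedModType R}.
Variables (A : set U) (a delta : R).
Variables (theta : 'I_3 -> U -> U -> R) (Omega : 'I_3 -> U -> U -> U -> R).
Hypothesis oA : open A.
Hypothesis theta_smooth : forall i u, smooth_on A (theta i ^~ u).
Hypothesis structure : forall i j k, even3 i j k -> forall x u v, A x ->
  Omega i x u v = a * ('D_u (theta i ^~ v) x - 'D_v (theta i ^~ u) x
    + 2 * delta * (theta j x u * theta k x v - theta j x v * theta k x u)).

Let d i w x : A x -> differentiable (theta i ^~ w) x.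
Proof. exact: smooth_diff. Qed.

Let dd i w w' x : A x -> differentiable ('D_w' (theta i ^~ w)) x.
Proof. by move=> Ax; apply: (smooth_diff (smooth_derive w' (theta_smooth i w))). Qed.

Lemma derive_Omega i j k x u v w : even3 i j k -> A x ->
  'D_u (fun y => Omega i y v w) x =
  a * ('D_u ('D_v (theta i ^~ w)) x - 'D_u ('D_w (theta i ^~ v)) x
   + 2 * delta * (theta j x v * 'D_u (theta k ^~ w) x
      + theta k x w * 'D_u (theta j ^~ v) x
      - (theta j x w * 'D_u (theta k ^~ v) x
      + theta k x v * 'D_u (theta j ^~ w) x))).
Proof.
move=> ev Ax.
have D1 i' w' w'' := diff_derivable (v := u) (@dd i' w' w'' x Ax).
have D2 i' w' := diff_derivable (v := u) (@d i' w' x Ax).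
pose f := 'D_v (theta i ^~ w); pose g := 'D_w (theta i ^~ v).
pose p1 := (theta j ^~ v : U -> R) * (theta k ^~ w : U -> R).
pose p2 := (theta j ^~ w : U -> R) * (theta k ^~ v : U -> R).
transitivity ('D_u (a *: (f - g + (2 * delta) *: (p1 - p2))) x).
  apply: near_eq_derive; apply: (near_eq_open oA) => // y Ay.
  exact: structure ev _ _ _ Ay.
have dp1 : derivable p1 x u by apply: derivableM; exact: D2.
have dp2 : derivable p2 x u by apply: derivableM; exact: D2.
have dfg : derivable (f - g) x u by apply: derivableB; exact: D1.
have dpp : derivable (p1 - p2) x u by apply: derivableB.
have dpp' : derivable ((2 * delta) *: (p1 - p2)) x u by apply: derivableZ.
rewrite deriveZ; last exact: derivableD.
rewrite deriveD // deriveZ // deriveB; [|exact: D1|exact: D1].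
rewrite deriveB // deriveM; [|exact: D2|exact: D2].
rewrite deriveM; [|exact: D2|exact: D2].
by [].
Qed.

(** Differentiating the structure equation, the second derivatives cancel by
    symmetry ([d d theta = 0]). Substituting the structure equation for
    [d theta_j] and [d theta_k], the cubic terms in [theta] cancel as well. *)
Lemma cyclic_derive_Omega i j k x u v w : even3 i j k -> A x ->
  'D_u (fun y => Omega i y v w) x + 'D_v (fun y => Omega i y w u) x
    + 'D_w (fun y => Omega i y u v) x =
  2 * delta * ((theta k x u * Omega j x v w - theta j x u * Omega k x v w)
    + (theta k x v * Omega j x w u - theta j x v * Omega k x w u)
    + (theta k x w * Omega j x u v - theta j x w * Omega k x u v)).
Proof.
move=> ev Ax; have ev1 := even3_rot ev; have ev2 := even3_rot ev1.
have sw w1 w2 w3 : 'D_w1 ('D_w2 (theta i ^~ w3)) x = 'D_w2 ('D_w1 (theta i ^~ w3)) x.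
  exact: schwarz_scalar oA Ax (theta_smooth i w3).
rewrite !(derive_Omega _ _ _ ev Ax) !(structure ev1 _ _ Ax) !(structure ev2 _ _ Ax).
have := sw u v w; have := sw u w v; have := sw v w u.
move: ('D_u ('D_v (theta i ^~ w)) x) ('D_u ('D_w (theta i ^~ v)) x)
  ('D_v ('D_w (theta i ^~ u)) x) => x1 x2 x3.
move=> <- <- <-; ring.
Qed.

End StructureEquation.

Section DeriveApply.
Context {R : realType} {p m : nat}.
Variables (A : set 'rV[R]_p) (B : set 'rV[R]_m).
Variables (s w : 'rV[R]_p -> 'rV[R]_m) (L : 'rV[R]_m -> {scalar 'rV[R]_m}).
Hypotheses (oA : open A) (oB : open B) (ss : smooth_on A s) (sw : smooth_on A w).
Hypothesis AB : forall y, A y -> B (s y).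
Hypothesis sL : forall u, smooth_on B (fun x => L x u).

Lemma smooth_pullback : smooth_on A (fun y => L (s y) (w y)).
Proof.
apply: (@smooth_apply_scalar _ _ _ _ (fun y => L (s y))) => //.
  by move=> y Ay; exact: linearP.
move=> b; exact: (smooth_comp_scalar oA (sL _) ss AB).
Qed.

(** The product rule for a one-form [L] along the map [s], applied to a moving
    vector [w]. *)
Lemma derive_pullback y u : A y ->
  'D_u (fun y => L (s y) (w y)) y =
  L (s y) ('D_u w y) + 'D_('D_u s y) (fun x => L x (w y)) (s y).
Proof.
move=> Ay; have By := AB Ay.
have ds := smooth_diff ss Ay; have dw := smooth_diff sw Ay.
have dL b : differentiable (fun x => L x b) (s y) by exact: smooth_diff (sL b) By.
have dLs b : differentiable (fun y => L (s y) b) y.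
  exact: (@differentiable_comp _ _ _ _ s (fun x => L x b)).
have expand x v : L x v = \sum_(b < m) v 0 b * L x (delta_mx 0 b).
  rewrite {1}[v]row_sum_delta linear_sum; apply: eq_bigr => b _; exact: linearZ.
pose F b : 'rV[R]_p -> R :=
  ((fun y => w y 0 b) : 'rV[R]_p -> R) * (fun y => L (s y) (delta_mx 0 b)).
have dF b : is_derive y u (F b)
    (w y 0 b *: 'D_u (fun y => L (s y) (delta_mx 0 b)) y
     + L (s y) (delta_mx 0 b) *: 'D_u (fun y => w y 0 b) y).
  apply: is_deriveM.
    apply: DeriveDef => //; apply: diff_derivable; exact: differentiable_coordf.
  apply: DeriveDef => //; apply: diff_derivable; exact: dLs.
have -> : (fun y => L (s y) (w y)) = \sum_(b < m) F b.
  by apply/funext => z; rewrite fct_sumE expand.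
rewrite derive_sum; last by move=> b; have [] := dF b.
pose G b : 'rV[R]_m -> R := w y 0 b *: (fun x => L x (delta_mx 0 b)).
have dG b : is_derive (s y) ('D_u s y) (G b)
    (w y 0 b *: 'D_('D_u s y) (fun x => L x (delta_mx 0 b)) (s y)).
  apply: is_deriveZ; apply: DeriveDef => //; apply: diff_derivable; exact: dL.
have -> : (fun x => L x (w y)) = \sum_(b < m) G b.
  by apply/funext => z; rewrite fct_sumE expand.
rewrite derive_sum; last by move=> b; have [] := dG b.
rewrite (expand (s y) ('D_u w y)) -big_split /=; apply: eq_bigr => b _.
have [_ ->] := dF b; have [_ ->] := dG b.
rewrite addrC; congr (_ + _); last first.
  by rewrite (derive_coord u b dw) [RHS]mulrC.
congr (_ *: _).
exact: (@derive_comp _ _ _ _ (fun x => L x (delta_mx 0 b)) s).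
Qed.

End DeriveApply.

(** * Linear algebra of almost 3-contact metric manifolds *)

Section MetricTheory.
Context {R : realType} {m : nat} {X : manifold R m}.
Variables (h : X -> 'rV[R]_m -> 'rV[R]_m -> R).
Hypothesis hm : riemannian_metric h.
Implicit Types u v w : 'rV[R]_m.

Definition metric_form x u : {scalar 'rV[R]_m} :=
  HB.pack (h x u) (GRing.isLinear.Build _ _ _ _ _ (metric_linear hm x u)).

Lemma metricDr x u v w : h x u (v + w) = h x u v + h x u w.
Proof. exact: (linearD (metric_form x u)). Qed.
Lemma metricNr x u v : h x u (- v) = - h x u v.
Proof. exact: (linearN (metric_form x u)). Qed.
Lemma metricZr x u a v : h x u (a *: v) = a * h x u v.
Proof. by rewrite -[LHS]/(metric_form x u _) linearZ. Qed.
Lemma metric0r x u : h x u 0 = 0.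
Proof. exact: (linear0 (metric_form x u)). Qed.
Lemma metric_sumr x u (I : Type) (r : seq I) (F : I -> 'rV[R]_m) :
  h x u (\sum_(i <- r) F i) = \sum_(i <- r) h x u (F i).
Proof. exact: (linear_sum (metric_form x u)). Qed.
Lemma metricDl x u v w : h x (v + w) u = h x v u + h x w u.
Proof. by rewrite !(Defs.metric_sym hm x _ u) metricDr. Qed.
Lemma metricNl x u v : h x (- v) u = - h x v u.
Proof. by rewrite !(Defs.metric_sym hm x _ u) metricNr. Qed.
Lemma metricZl x u a v : h x (a *: v) u = a * h x v u.
Proof. by rewrite !(Defs.metric_sym hm x _ u) metricZr. Qed.
Lemma metric0l x u : h x 0 u = 0.
Proof. by rewrite (Defs.metric_sym hm) metric0r. Qed.
Lemma metric_suml x u (I : Type) (r : seq I) (F : I -> 'rV[R]_m) :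
  h x (\sum_(i <- r) F i) u = \sum_(i <- r) h x (F i) u.
Proof.
rewrite (Defs.metric_sym hm) metric_sumr; apply: eq_bigr => i _.
by rewrite (Defs.metric_sym hm).
Qed.
Lemma metric_nondeg x v : (forall w, h x v w = 0) -> v = 0.
Proof.
move=> H; have [//|/(metric_pos hm x)] := eqVneq v 0.
by rewrite H ltxx.
Qed.

End MetricTheory.

Section Pointwise.
Context {R : realType} {n : nat} {M : manifold R (4 * n + 3)%N}.
Variables (phi : 'I_3 -> M -> 'End('rV[R]_(4 * n + 3))).
Variables (xi : 'I_3 -> M -> 'rV[R]_(4 * n + 3)).
Variables (eta : 'I_3 -> M -> {scalar 'rV[R]_(4 * n + 3)}).
Variables (g : M -> 'rV[R]_(4 * n + 3) -> 'rV[R]_(4 * n + 3) -> R).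
Hypothesis M3 : almost_3_contact_metric phi xi eta g.
Context {N : manifold R (4 * n)%N}.
Variables (gN : N -> 'rV[R]_(4 * n) -> 'rV[R]_(4 * n) -> R).
Hypothesis gN_metric : riemannian_metric gN.
Variable pi : M -> N.
Hypothesis pi_can : canonical_submersion xi g gN pi.
Implicit Types (p : M) (u v w : 'rV[R]_(4 * n + 3)) (i j k l : 'I_3).

Let gm : riemannian_metric g. Proof. by case: M3. Qed.
Let acm i : almost_contact_metric (phi i) (xi i) (eta i) g.
Proof. by case: M3. Qed.

(** Set the first argument of the compatibility condition to [xi_l]. *)
Lemma g_xi l p v : g p (xi l p) v = eta l p v.
Proof.
have := acm_compat (acm l) p (xi l p) v.
rewrite (acm_phi_xi (acm l)) (acm_eta_xi (acm l)) mul1r (metric0l gm).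
by move=> /esym/eqP; rewrite subr_eq0 => /eqP.
Qed.

Lemma eta_xi_off i j k p : even3 i j k ->
  eta i p (xi j p) = 0 /\ eta i p (xi k p) = 0.
Proof.
move=> ev; have ev1 := even3_rot ev.
have [_ ->] := a3cm_eta M3 ev1 p (xi j p).
have [-> _] := a3cm_eta M3 ev1 p (xi k p).
by rewrite (acm_phi_xi (acm k)) (acm_phi_xi (acm j)) !linear0 ?oppr0.
Qed.

Lemma eta_xi l l' p : eta l p (xi l' p) = (l == l')%:R.
Proof.
have [<-|ne] := eqVneq; first exact: (acm_eta_xi (acm l)).
have [j [k ev]] := even3_ex l.
have [E1 E2] := eta_xi_off p ev.
have [E|->|->] := even3_cases l' ev; [|exact: E1|exact: E2].
by rewrite E eqxx in ne.
Qed.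

Lemma phi_xi i j k p : even3 i j k ->
  phi i p (xi j p) = xi k p /\ phi i p (xi k p) = - xi j p.
Proof.
move=> ev; have [<- _] := a3cm_xi M3 ev p; split=> //.
have [_ E] := a3cm_xi M3 (even3_rot (even3_rot ev)) p.
by rewrite E opprK.
Qed.

Lemma eta_phi i j k p v : even3 i j k ->
  eta j p (phi i p v) = - eta k p v /\ eta k p (phi i p v) = eta j p v.
Proof.
move=> ev; have [_ ->] := a3cm_eta M3 ev p v.
have [<- _] := a3cm_eta M3 (even3_rot (even3_rot ev)) p v.
by rewrite opprK.
Qed.

Lemma dpi_xi l p : dmap pi p (xi l p) = 0.
Proof.
apply/eqP; rewrite -memv_ker (csub_vertical pi_can).
exact: (span3_mem (xi ^~ p)).
Qed.

Lemma vertical_decomp p v : dmap pi p v = 0 -> v = \sum_l eta l p v *: xi l p.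
Proof.
move=> /eqP; rewrite -memv_ker (csub_vertical pi_can).
move=> /(span3P (f := xi ^~ p))[a ->]; apply: eq_bigr => l _; congr (_ *: _).
rewrite linear_sum (bigD1 l) //= linearZ /= eta_xi eqxx mulr1 big1 ?addr0 //.
by move=> l' ne; rewrite linearZ /= eta_xi eq_sym (negbTE ne) mulr0.
Qed.

Definition horizontal p v := v - \sum_l eta l p v *: xi l p.

Lemma dpi_horizontal p v : dmap pi p (horizontal p v) = dmap pi p v.
Proof.
rewrite /horizontal linearB linear_sum big1 ?subr0 // => l _.
by rewrite linearZ /= dpi_xi scaler0.
Qed.

Lemma eta_horizontal l p v : eta l p (horizontal p v) = 0.
Proof.
rewrite /horizontal linearB linear_sum (bigD1 l) //= linearZ /= eta_xi eqxx mulr1.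
rewrite big1 ?addr0 ?subrr // => l' ne.
by rewrite linearZ /= eta_xi eq_sym (negbTE ne) mulr0.
Qed.

Lemma horizontal_orth p v w : w \in lker (dmap pi p) -> g p (horizontal p v) w = 0.
Proof.
rewrite memv_ker => /eqP/vertical_decomp ->.
rewrite (metric_sumr gm) big1 // => l _.
by rewrite (metricZr gm) (Defs.metric_sym gm) g_xi eta_horizontal mulr0.
Qed.

(** Both arguments may be replaced by their horizontal parts, on which [pi] is an
    isometry. *)
Lemma gN_dpi p u v :
  gN (pi p) (dmap pi p u) (dmap pi p v) = g p u v - \sum_l eta l p u * eta l p v.
Proof.
rewrite -dpi_horizontal -(dpi_horizontal p v) (subm_isometry (csub_submersion pi_can)).
- rewrite {2}/horizontal (metricDr gm) (metricNr gm) (metric_sumr gm) [X in _ - X]big1.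
    rewrite subr0 /horizontal (metricDl gm) (metricNl gm) (metric_suml gm).
    by congr (_ - _); apply: eq_bigr => l _; rewrite (metricZl gm) g_xi.
  by move=> l _; rewrite (metricZr gm) (Defs.metric_sym gm) g_xi eta_horizontal mulr0.
- by move=> w; exact: horizontal_orth.
- by move=> w; exact: horizontal_orth.
Qed.

Lemma phi_vertical i p v : dmap pi p v = 0 -> dmap pi p (phi i p v) = 0.
Proof.
move=> /vertical_decomp ->; rewrite !linear_sum big1 // => l _.
rewrite !linearZ /=; apply/eqP; rewrite scaler_eq0; apply/orP; right.
have [j [k ev]] := even3_ex i; have [E1 E2] := phi_xi p ev.
have [->|->|->] := even3_cases l ev.
- by rewrite (acm_phi_xi (acm i)) linear0.
- by rewrite E1 dpi_xi.
- by rewrite E2 linearN /= dpi_xi oppr0.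
Qed.

(** The endomorphism of the tangent space at [pi p] induced by [phi_i] at [p]. The
    choice of preimages under the differential is immaterial because [phi_i]
    preserves the vertical space. *)
Definition proj_phi i p : 'End('rV[R]_(4 * n)) :=
  (dmap pi p \o phi i p \o (dmap pi p)^-1)%VF.

Lemma dpi_inv p (x : 'rV[R]_(4 * n)) : dmap pi p ((dmap pi p)^-1%VF x) = x.
Proof.
by apply: limg_lfunVK; rewrite (subm_full (csub_submersion pi_can)) memvf.
Qed.

Lemma proj_phiE i p v : proj_phi i p (dmap pi p v) = dmap pi p (phi i p v).
Proof.
rewrite /proj_phi !comp_lfunE; apply/eqP; rewrite -subr_eq0 -!linearB; apply/eqP.
by apply: phi_vertical; rewrite linearB /= dpi_inv subrr.
Qed.

Lemma dpi_surj p (x : 'rV[R]_(4 * n)) : exists v, dmap pi p v = x.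
Proof. by exists ((dmap pi p)^-1%VF x); exact: dpi_inv. Qed.

Lemma proj_phi_sq i p x : proj_phi i p (proj_phi i p x) = - x.
Proof.
have [v <-] := dpi_surj p x; rewrite !proj_phiE (acm_phi2 (acm i)).
by rewrite linearD linearN linearZ /= dpi_xi scaler0 addr0.
Qed.

Lemma proj_phi_mul i j k p x : even3 i j k ->
  proj_phi i p (proj_phi j p x) = proj_phi k p x /\
  proj_phi j p (proj_phi i p x) = - proj_phi k p x.
Proof.
move=> ev; have [v <-] := dpi_surj p x; rewrite !proj_phiE.
have [E1 E2] := a3cm_phi M3 ev p v; split.
  by rewrite E1 linearB linearZ /= dpi_xi scaler0 subr0.
by rewrite E2 linearD linearN linearZ /= dpi_xi scaler0 addr0 opprK.
Qed.

Lemma proj_phi_orth i p x y :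
  gN (pi p) (proj_phi i p x) (proj_phi i p y) = gN (pi p) x y.
Proof.
have [u <-] := dpi_surj p x; have [v <-] := dpi_surj p y.
rewrite !proj_phiE !gN_dpi (acm_compat (acm i)).
have [j [k ev]] := even3_ex i; rewrite !(sum_even3 _ ev) !(acm_eta_phi (acm i)).
have [-> ->] := eta_phi p u ev; have [-> ->] := eta_phi p v ev; ring.
Qed.

Lemma proj_phi_skew i p x y :
  gN (pi p) (proj_phi i p x) y = - gN (pi p) x (proj_phi i p y).
Proof.
by rewrite -(proj_phi_orth i) proj_phi_sq (metricNl gN_metric).
Qed.

(** [phi_i] preserves the horizontal space, where [pi] is isometric, and acts on the
    vertical space by the rotation [xi_j |-> xi_k |-> - xi_j]. *)
Lemma fund_form_split i j k p u v : even3 i j k ->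
  fund_form g (phi i) p u v =
  gN (pi p) (dmap pi p u) (proj_phi i p (dmap pi p v))
  - wedge (eta j p) (eta k p) u v.
Proof.
move=> ev; rewrite /fund_form proj_phiE gN_dpi (sum_even3 _ ev) /wedge.
rewrite (acm_eta_phi (acm i)); have [-> ->] := eta_phi p v ev; ring.
Qed.

End Pointwise.

(** * Structure equations pulled back by a map *)

Fact sub_common (V : zmodType) (a b x y z : V) :
  a = z + x -> b = z + y -> a - b = x - y.
Proof. by move=> -> ->; rewrite opprD addrACA subrr add0r. Qed.

(** Pulling back along a map [s] into one chart covers two situations: sections of
    the submersion, and charts of [M] that straighten it. *)
Section PulledBack.
Context {R : realType} {n : nat} {M : manifold R (4 * n + 3)%N}.
Variables (alpha delta : R).
Variables (phi : 'I_3 -> M -> 'End('rV[R]_(4 * n + 3))).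
Variables (xi : 'I_3 -> M -> 'rV[R]_(4 * n + 3)).
Variables (eta : 'I_3 -> M -> {scalar 'rV[R]_(4 * n + 3)}).
Variables (g : M -> 'rV[R]_(4 * n + 3) -> 'rV[R]_(4 * n + 3) -> R).
Hypothesis Ms : sasaki3 alpha delta phi xi eta g.
Context {N : manifold R (4 * n)%N}.
Variables (gN : N -> 'rV[R]_(4 * n) -> 'rV[R]_(4 * n) -> R).
Hypothesis gN_metric : riemannian_metric gN.
Variable pi : M -> N.
Hypothesis pi_can : canonical_submersion xi g gN pi.

Let M3 : almost_3_contact_metric phi xi eta g. Proof. by case: Ms. Qed.

Variables (q : nat) (A : set 'rV[R]_q) (s : 'rV[R]_q -> 'rV[R]_(4 * n + 3)) (c : M).
Hypotheses (oA : open A) (ss : smooth_on A s).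
Hypothesis As : forall y, A y -> ccod c (s y).

(** [s] takes values in the coordinates of [c]; [pt] is the point of [M] and [push] the
    pushed-forward vector that it represents. [theta i] is then the pullback of
    [eta i], and [omega i] that of the Kaehler form of the induced
    endomorphism on the base. *)
Definition pt y : M := cfrom c (s y).
Definition push u y : 'rV[R]_(4 * n + 3) := coord_field c ('D_u s y) (pt y).
Definition theta i y u : R := eta i (pt y) (push u y).
Definition omega i y u v : R :=
  gN (pi (pt y)) (dmap pi (pt y) (push u y))
     (proj_phi phi pi i (pt y) (dmap pi (pt y) (push v y))).

Fact chart_form_linear i x : scalar (fun w => eta i (cfrom c x) (coord_field c w (cfrom c x))).
Proof. by move=> a u v; rewrite coord_field_linear linearP. Qed.

(** The form [eta i] in the coordinates of [c]. *)
Definition chart_form i x : {scalar 'rV[R]_(4 * n + 3)} :=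
  HB.pack (fun w => eta i (cfrom c x) (coord_field c w (cfrom c x)))
    (GRing.isLinear.Build _ _ _ _ _ (chart_form_linear i x)).

Lemma smooth_eta_coord_field i u : smooth_fun (cdom c) (fun p => eta i p (coord_field c u p)).
Proof.
have acm : almost_contact_metric (phi i) (xi i) (eta i) g by case: M3.
by apply: (acm_eta_smooth acm); [exact: cdom_open|exact: smooth_coord_field].
Qed.

Lemma smooth_chart_form i u : smooth_on (ccod c) (fun x => chart_form i x u).
Proof.
have sf : smooth_on (coords c (cdom c)) (fun x => chart_form i x u).
  exact: (@smooth_eta_coord_field i u c).
by apply: smooth_sub sf => x cx; split=> //; exact: cfrom_dom.
Qed.

(** The defining equation of the structure, tested on coordinate fields, whose
    brackets vanish. *)
Lemma chart_form_structure i j k x u v : even3 i j k -> ccod c x ->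
  'D_u (fun x => chart_form i x v) x - 'D_v (fun x => chart_form i x u) x =
  2 * alpha * fund_form g (phi i) (cfrom c x)
    (coord_field c u (cfrom c x)) (coord_field c v (cfrom c x))
  + 2 * (alpha - delta) *
    wedge (eta j (cfrom c x)) (eta k (cfrom c x))
      (coord_field c u (cfrom c x)) (coord_field c v (cfrom c x)).
Proof.
move=> ev cx; have cp := cfrom_dom cx.
have E := s3_deta Ms ev (cdom_open c) cp
  (@smooth_coord_field _ _ _ c u) (@smooth_coord_field _ _ _ c v).
rewrite -E /ext_d (lie_bracket_coord_field u v cp) linear0 subr0.
rewrite (dfun_coord_field u (cdom_open c) cp (@smooth_eta_coord_field i v) cp).
rewrite (dfun_coord_field v (cdom_open c) cp (@smooth_eta_coord_field i u) cp).
by rewrite (cfromK cx).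
Qed.

Lemma smooth_theta i u : smooth_on A (theta i ^~ u).
Proof.
apply: (@smooth_pullback _ _ _ A (ccod c) s ('D_u s) (chart_form i)) => //.
- exact: smooth_derive.
- exact: smooth_chart_form.
Qed.

(** Exterior differentiation commutes with pullback, since the second derivative of
    [s] is symmetric. *)
Lemma theta_structure i j k y u v : even3 i j k -> A y ->
  'D_u (theta i ^~ v) y - 'D_v (theta i ^~ u) y =
  2 * alpha * fund_form g (phi i) (pt y) (push u y) (push v y)
  + 2 * (alpha - delta) *
    wedge (eta j (pt y)) (eta k (pt y)) (push u y) (push v y).
Proof.
move=> ev Ay; rewrite -(chart_form_structure _ _ ev (As Ay)).
have E w w' : 'D_w (theta i ^~ w') y =
    chart_form i (s y) ('D_w ('D_w' s) y)
    + 'D_('D_w s y) (fun x => chart_form i x ('D_w' s y)) (s y).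
  apply: (@derive_pullback _ _ _ A (ccod c) s ('D_w' s) (chart_form i)) => //.
  - exact: smooth_derive.
  - exact: smooth_chart_form.
have S : 'D_u ('D_v s) y = 'D_v ('D_u s) y by exact: schwarz oA Ay ss.
have Ev : 'D_v (theta i ^~ u) y = chart_form i (s y) ('D_u ('D_v s) y)
    + 'D_('D_v s y) (fun x => chart_form i x ('D_u s y)) (s y).
  exact: etrans (E v u) (congr1 (fun t => chart_form i (s y) t + _) (esym S)).
exact: sub_common (E u v) Ev.
Qed.

(** Splitting the fundamental form turns the coefficient [2 (alpha - delta)] of
    [theta_j /\ theta_k] into [- 2 delta]. *)
Lemma omega_structure i j k : even3 i j k -> forall y u v, A y ->
  omega i y u v = (2 * alpha)^-1 * ('D_u (theta i ^~ v) y - 'D_v (theta i ^~ u) y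
    + 2 * delta * (theta j y u * theta k y v - theta j y v * theta k y u)).
Proof.
move=> ev y u v Ay; rewrite (theta_structure _ _ ev Ay).
rewrite (fund_form_split M3 pi_can _ _ _ ev).
have -> : wedge (eta j (pt y)) (eta k (pt y)) (push u y) (push v y) =
  theta j y u * theta k y v - theta j y v * theta k y u by [].
have a0 : alpha != 0 by case: Ms.
have -> : gN (pi (pt y)) (dmap pi (pt y) (push u y))
  (proj_phi phi pi i (pt y) (dmap pi (pt y) (push v y))) = omega i y u v by [].
move: (omega i y u v) (theta j y u) (theta k y u) (theta j y v) (theta k y v).
by move=> x1 x2 x3 x4 x5; field.
Qed.

Lemma cyclic_derive_omega i j k y u v w : even3 i j k -> A y ->
  'D_u (fun y => omega i y v w) y + 'D_v (fun y => omega i y w u) y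
    + 'D_w (fun y => omega i y u v) y =
  2 * delta * ((theta k y u * omega j y v w - theta j y u * omega k y v w)
    + (theta k y v * omega j y w u - theta j y v * omega k y w u)
    + (theta k y w * omega j y u v - theta j y w * omega k y u v)).
Proof. exact: cyclic_derive_Omega oA smooth_theta omega_structure _ _ _ _ _ _ _. Qed.

Lemma smooth_omega i u v : smooth_on A (fun y => omega i y u v).
Proof.
have [j [k ev]] := even3_ex i.
apply: (smooth_eq oA (fun y Ay => esym (omega_structure ev u v Ay))).
have st l w := @smooth_theta l w.
apply: smoothM => //; first exact: smooth_cst.
apply: smoothD => //.
  apply: (@smooth_eq _ _ _ _ (fun y => 'D_u (theta i ^~ v) y
     + (-1) * 'D_v (theta i ^~ u) y)) => //.
    by move=> y _; rewrite mulN1r.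
  apply: smoothD => //; first exact: smooth_derive.
  by apply: smoothM => //; [exact: smooth_cst|exact: smooth_derive].
apply: smoothM => //; first exact: smooth_cst.
apply: (@smooth_eq _ _ _ _ (fun y => theta j y u * theta k y v
     + (-1) * (theta j y v * theta k y u))) => //.
  by move=> y _; rewrite mulN1r.
apply: smoothD => //; first exact: smoothM.
by apply: smoothM => //; [exact: smooth_cst|exact: smoothM].
Qed.

End PulledBack.

(** * Tensoriality of covariant derivatives *)

Section SmoothFields.
Context {R : realType} {m : nat} {X : manifold R m}.
Implicit Types (W : set X) (f : X -> R) (Y Z : X -> 'rV[R]_m).

Lemma smooth_fun_cst W (a : R) : smooth_fun W (fun=> a).
Proof. by move=> q; apply: smooth_cst. Qed.

Lemma smooth_vf_add W Y Z : open W -> smooth_vf W Y -> smooth_vf W Z ->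
  smooth_vf W (fun q => Y q + Z q).
Proof.
move=> oW sY sZ q; have oA := @open_coords _ _ _ q _ oW.
apply: (smooth_eq oA _ (smoothDv oA (sY q) (sZ q))) => x _.
by rewrite /vf_in_chart linearD.
Qed.

Lemma smooth_vf_scale W f Y : open W -> smooth_fun W f -> smooth_vf W Y ->
  smooth_vf W (fun q => f q *: Y q).
Proof.
move=> oW sf sY q; have oA := @open_coords _ _ _ q _ oW.
apply: (smooth_eq oA _ (smoothZv oA (sf q) (sY q))) => x _.
by rewrite /vf_in_chart linearZ.
Qed.

Lemma smooth_vf_ext W Y Z : open W -> (forall q, W q -> Y q = Z q) ->
  smooth_vf W Y -> smooth_vf W Z.
Proof.
move=> oW E sY q; have oA := @open_coords _ _ _ q _ oW.
apply: (smooth_eq oA _ (sY q)) => x [_ Wx].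
by rewrite /vf_in_chart E.
Qed.

Lemma smooth_vf0 W : open W -> smooth_vf W (fun=> 0 : 'rV[R]_m).
Proof.
move=> oW q; have oA := @open_coords _ _ _ q _ oW.
apply: (smooth_eq oA _ (@smooth_cst _ _ _ _ (0 : 'rV[R]_m))) => x _.
by rewrite /vf_in_chart linear0.
Qed.

Lemma smooth_vf_sum W (I : Type) (r : seq I) (Y : I -> X -> 'rV[R]_m) :
  open W -> (forall a, smooth_vf W (Y a)) ->
  smooth_vf W (fun q => \sum_(a <- r) Y a q).
Proof.
move=> oW sY; elim: r => [|a r IH].
  apply: (smooth_vf_ext oW _ (smooth_vf0 oW)) => q _; by rewrite big_nil.
apply: (smooth_vf_ext oW _ (smooth_vf_add oW (sY a) IH)) => q _.
by rewrite big_cons.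
Qed.

Lemma dfun_cst (p : X) (a : R) (v : 'rV[R]_m) : dfun (fun=> a : R) p v = 0 :> R.
Proof. exact: derive_cst. Qed.

Definition component c Y (a : 'I_m) q : R := vf_in_chart c Y (cto c q) 0 a.

Lemma smooth_component c W Y a : open W -> smooth_vf W Y ->
  smooth_fun (W `&` cdom c) (component c Y a).
Proof.
move=> oW sY; have oA := @open_coords _ _ _ c _ oW.
have sa : smooth_on (coords c W) (fun x => vf_in_chart c Y x 0 a).
  by move: a; apply/(smooth_rowP _ oA); exact: sY.
apply: smooth_fun_sub (@smooth_fun_coords _ _ _ c _ _ oA sa) => q [Wq cq].
by split => //; exact: cto_coords.
Qed.

Lemma component_sum c Y q : cdom c q ->
  Y q = \sum_a component c Y a q *: coord_field c (delta_mx 0 a) q.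
Proof.
move=> cq; rewrite {1}(vf_decomp Y cq) {1}[vf_in_chart _ _ _]row_sum_delta.
rewrite -[LHS]/(dtrans c q q _) linear_sum; apply: eq_bigr => a _.
by rewrite linearZ.
Qed.

End SmoothFields.

Section Connection.
Context {R : realType} {m : nat} {X : manifold R m}.
Variable nabla : (X -> 'rV[R]_m) -> X -> 'End('rV[R]_m).
Hypothesis nc : affine_connection nabla.
Implicit Types (W U : set X) (f : X -> R) (Y Z : X -> 'rV[R]_m) (p : X)
  (v : 'rV[R]_m).

Lemma conn0 p : nabla (fun=> 0) p = 0.
Proof.
have sT : @smooth_vf R m X setT (fun=> 0) := @smooth_vf0 _ _ X setT openT.
have := conn_add nc openT I sT sT (p := p).
rewrite (_ : (fun _ => _) = (fun=> 0)); last by apply/funext => q; rewrite addr0.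
by move=> E; apply: (addrI (nabla (fun=> 0) p)); rewrite addr0 -E.
Qed.

Lemma conn_sum W p (I : Type) (r : seq I) (Y : I -> X -> 'rV[R]_m) :
  open W -> W p -> (forall a, smooth_vf W (Y a)) ->
  nabla (fun q => \sum_(a <- r) Y a q) p = \sum_(a <- r) nabla (Y a) p.
Proof.
move=> oW Wp sY; elim: r => [|a r IH].
  rewrite big_nil -[RHS](conn0 p); congr (nabla _ p).
  by apply/funext => q; rewrite big_nil.
rewrite big_cons -IH -(conn_add nc oW Wp (sY a) (smooth_vf_sum r oW sY)).
by congr (nabla _ p); apply/funext => q; rewrite big_cons.
Qed.

(** The Leibniz rule for a field expanded in a local frame. *)
Lemma conn_expand W p v (I : finType) (f : I -> X -> R)
    (Z : I -> X -> 'rV[R]_m) Y :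
  open W -> W p -> smooth_vf W Y -> (forall a, smooth_fun W (f a)) ->
  (forall a, smooth_vf W (Z a)) ->
  (forall q, W q -> Y q = \sum_a f a q *: Z a q) ->
  nabla Y p v = \sum_a (dfun (f a) p v *: Z a p + f a p *: nabla (Z a) p v).
Proof.
move=> oW Wp sY sf sZ YE.
have sfZ a : smooth_vf W (fun q => f a q *: Z a q) by exact: smooth_vf_scale.
rewrite (conn_local nc oW Wp sY (smooth_vf_sum _ oW sfZ) YE).
rewrite (conn_sum _ oW Wp sfZ) sum_lfunE; apply: eq_bigr => a _.
exact: (conn_leibniz nc v oW Wp (sf a) (sZ a)).
Qed.

(** The covariant derivative of [J] along [v], tested on a coordinate field. *)
Definition endo_derive (J : X -> 'End('rV[R]_m)) p v w :=
  nabla (fun q => J q (coord_field p w q)) p v - J p (nabla (coord_field p w) p v).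

(** Expanding [Y] in coordinate fields, the derivatives of its components cancel
    between [nabla (J Y)] and [J (nabla Y)]. *)
Lemma endo_derive_tensorial U (J : X -> 'End('rV[R]_m)) W Y p v :
  open U -> U p -> smooth_endo U J -> open W -> W p -> smooth_vf W Y ->
  nabla (fun q => J q (Y q)) p v - J p (nabla Y p v) =
  \sum_a Y p 0 a *: endo_derive J p v (delta_mx 0 a).
Proof.
move=> oU Up sJ oW Wp sY.
pose W0 := (W `&` cdom p) `&` U.
have oW0 : open W0 by apply: openI => //; apply: openI => //; exact: cdom_open.
have W0p : W0 p by do !split => //; exact: cdom_self.
pose f a := component p Y a; pose Z a := coord_field p (delta_mx 0 a : 'rV[R]_m).
have sf a : smooth_fun W0 (f a).
  by apply: smooth_fun_sub (@smooth_component _ _ _ p W Y a oW sY) => q [].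
have sZ a : smooth_vf W0 (Z a).
  by apply: smooth_vf_sub (@smooth_coord_field _ _ _ p _) => q [[]].
have sY0 : smooth_vf W0 Y by apply: smooth_vf_sub sY => q [[]].
have W0U : W0 `<=` U by move=> q [].
have sJY : smooth_vf W0 (fun q => J q (Y q)) by exact: sJ.
have sJZ a : smooth_vf W0 (fun q => J q (Z a q)) by exact: sJ.
have YE q : W0 q -> Y q = \sum_a f a q *: Z a q.
  by move=> [[_ cq] _]; exact: component_sum.
have JYE q : W0 q -> J q (Y q) = \sum_a f a q *: J q (Z a q).
  move=> /YE ->; rewrite linear_sum; apply: eq_bigr => a _; exact: linearZ.
rewrite (conn_expand v oW0 W0p sJY sf sJZ JYE) (conn_expand v oW0 W0p sY0 sf sZ YE).
rewrite linear_sum -sumrB; apply: eq_bigr => a _.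
rewrite linearD !linearZ /= opprD addrACA subrr add0r -scalerBr.
congr (_ *: _); rewrite /f /component /vf_in_chart -/(cfrom p) ctoK; last exact: cdom_self.
by rewrite tchangeE dtrans_id //; exact: cdom_self.
Qed.

Lemma smooth_J_coord_field U (J : X -> 'End('rV[R]_m)) p w :
  open U -> smooth_endo U J ->
  smooth_vf (U `&` cdom p) (fun q => J q (coord_field p w q)).
Proof.
move=> oU sJ; apply: sJ; first by apply: openI => //; exact: cdom_open.
  by move=> q [].
by apply: smooth_vf_sub (@smooth_coord_field _ _ _ p w) => q [].
Qed.

Lemma endo_derive_linear2 U (J : X -> 'End('rV[R]_m)) p v :
  open U -> U p -> smooth_endo U J -> linear (endo_derive J p v).
Proof.
move=> oU Up sJ.
have E w : endo_derive J p v w =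
    \sum_a w 0 a *: endo_derive J p v (delta_mx 0 a).
  have := endo_derive_tensorial v oU Up sJ (cdom_open p) (cdom_self p)
    (@smooth_coord_field _ _ _ p w).
  by rewrite coord_field_self.
move=> a u w; rewrite E (E u) (E w) scaler_sumr -big_split /=.
by apply: eq_bigr => b _; rewrite !mxE scalerDl scalerA.
Qed.

Lemma endo_derive_linear1 (J : X -> 'End('rV[R]_m)) p w :
  linear (endo_derive J p ^~ w).
Proof.
move=> a u v; rewrite /endo_derive !linearP /=.
by rewrite [in RHS]scalerDr addrACA.
Qed.

Lemma endo_derive_field U (J : X -> 'End('rV[R]_m)) W Y p v :
  open U -> U p -> smooth_endo U J -> open W -> W p -> smooth_vf W Y ->
  nabla (fun q => J q (Y q)) p v - J p (nabla Y p v) = endo_derive J p v (Y p).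
Proof.
move=> oU Up sJ oW Wp sY; rewrite (endo_derive_tensorial v oU Up sJ oW Wp sY).
pose lM := GRing.isLinear.Build _ _ _ _ _ (endo_derive_linear2 v oU Up sJ).
pose l : {linear _ -> _} := HB.pack (endo_derive J p v) lM.
rewrite {2}[Y p]row_sum_delta -[RHS]/(l _) linear_sum; apply: eq_bigr => a _.
by rewrite linearZ.
Qed.

Lemma is_cov_deriveP U (J : X -> 'End('rV[R]_m)) p v (A : 'End('rV[R]_m)) :
  open U -> U p -> smooth_endo U J ->
  (forall w, A w = endo_derive J p v w) -> is_cov_derive nabla J p v A.
Proof.
move=> oU Up sJ E W Y oW Wp sY.
by rewrite (endo_derive_field v oU Up sJ oW Wp sY) E.
Qed.

End Connection.

(** * Covariant derivative of a quaternionic frame *)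

(** [domega] is the twisted closedness of the three Kaehler forms; it determines the
    covariant derivative of the frame. *)
Section QuaternionicDerivative.
Context {R : realType} {m : nat} {X : manifold R m}.
Variable h : X -> 'rV[R]_m -> 'rV[R]_m -> R.
Hypothesis hm : riemannian_metric h.
Variable nabla : (X -> 'rV[R]_m) -> X -> 'End('rV[R]_m).
Hypothesis lc : levi_civita h nabla.
Variables (U : set X) (J : 'I_3 -> X -> 'End('rV[R]_m)) (p : X).
Hypotheses (oU : open U) (Up : U p).
Hypothesis sJ : forall i, smooth_endo U (J i).
Hypothesis J_sq : forall i q v, U q -> J i q (J i q v) = - v.
Hypothesis J_mul : forall i j k, even3 i j k -> forall q v, U q ->
  J i q (J j q v) = J k q v /\ J j q (J i q v) = - J k q v.
Hypothesis J_skew : forall i q u v, U q -> h q (J i q u) v = - h q u (J i q v).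
Variables (delta : R) (theta : 'I_3 -> {scalar 'rV[R]_m}).
Hypothesis domega : forall i j k, even3 i j k -> forall u v w,
  let om l q v w := h q (coord_field p v q) (J l q (coord_field p w q)) in
  dfun (fun q => om i q v w) p u + dfun (fun q => om i q w u) p v
   + dfun (fun q => om i q u v) p w =
  2 * delta * ((theta k u * om j p v w - theta j u * om k p v w)
    + (theta k v * om j p w u - theta j v * om k p w u)
    + (theta k w * om j p u v - theta j w * om k p u v)).

Let nc := lc_connection lc.
Let G u w := nabla (coord_field p w) p u.
Let D i u w := endo_derive nabla (J i) p u w.
Let W := U `&` cdom p.
Let oW : open W. Proof. by apply: openI => //; exact: cdom_open. Qed.
Let Wp : W p. Proof. by split => //; exact: cdom_self. Qed.
Let sE w : smooth_vf W (coord_field p w).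
Proof. by apply: smooth_vf_sub (@smooth_coord_field _ _ _ p w) => q []. Qed.
Let sJE i w : smooth_vf W (fun q => J i q (coord_field p w q)).
Proof. exact: smooth_J_coord_field. Qed.

Lemma christoffel_sym u v : G u v = G v u.
Proof.
have := lc_torsion_free lc oW Wp (sE u) (sE v).
by rewrite (lie_bracket_coord_field u v (cdom_self p)) !coord_field_self => /eqP;
  rewrite subr_eq0 => /eqP.
Qed.

Let nablaJ i u w : nabla (fun q => J i q (coord_field p w q)) p u = D i u w + J i p (G u w).
Proof. by rewrite /D /endo_derive subrK. Qed.

(** In the cyclic sum of these derivatives the Christoffel terms cancel, since [G] is
    symmetric and [J i] skew. *)
Lemma derive_om i u v w :
  dfun (fun q => h q (coord_field p v q) (J i q (coord_field p w q))) p u =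
  h p (G u v) (J i p w) + (h p v (D i u w) + h p v (J i p (G u w))).
Proof.
rewrite (lc_metric lc u oW Wp (sE v) (sJE i w)) nablaJ !coord_field_self.
by rewrite (metricDr hm).
Qed.

Lemma derive_om_left i u v w :
  dfun (fun q => h q (J i q (coord_field p v q)) (coord_field p w q)) p u =
  h p (D i u v) w + h p (J i p (G u v)) w + h p (J i p v) (G u w).
Proof.
rewrite (lc_metric lc u oW Wp (sJE i v) (sE w)) nablaJ !coord_field_self.
by rewrite (metricDl hm).
Qed.

Let dfun_near (f f' : X -> R) u : smooth_fun W f -> smooth_fun W f' ->
  (forall q, W q -> f q = f' q) -> dfun f p u = dfun f' p u.
Proof.
move=> sf sf' E; rewrite /dfun; apply: near_eq_derive.
apply: (near_eq_open (@open_coords _ _ _ p _ oW)).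
  by move=> x [_ Wx]; exact: E.
exact: cto_coords (cdom_self p) Wp.
Qed.

Lemma D_skew i u v w : h p (D i u v) w = - h p v (D i u w).
Proof.
have s1 : smooth_fun W (fun q => h q (coord_field p v q) (J i q (coord_field p w q))).
  by apply: (metric_smooth hm).
have s2 : smooth_fun W (fun q => h q (J i q (coord_field p v q)) (coord_field p w q)).
  by apply: (metric_smooth hm).
have s2' : smooth_fun W (fun q => -1 * h q (J i q (coord_field p v q)) (coord_field p w q)).
  move=> q; apply: smoothM; [exact: open_coords|exact: smooth_cst|exact: s2].
have E : forall q, W q -> h q (coord_field p v q) (J i q (coord_field p w q)) =
    -1 * h q (J i q (coord_field p v q)) (coord_field p w q).
  by move=> q [Uq _]; rewrite J_skew // mulN1r opprK.
have := dfun_near u s1 s2' E.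
have -> : dfun (fun q => -1 * h q (J i q (coord_field p v q)) (coord_field p w q)) p u =
    - dfun (fun q => h q (J i q (coord_field p v q)) (coord_field p w q)) p u.
  have der : derivable ((fun q => h q (J i q (coord_field p v q)) (coord_field p w q))
      \o from (chart_at p)) (to (chart_at p) p) u.
    apply: diff_derivable; apply: (smooth_diff (s2 p)).
    exact: cto_coords (cdom_self p) Wp.
  exact: etrans (deriveZ (-1) der) (mulN1r _).
rewrite derive_om derive_om_left !J_skew //.
move: (h p (G u v) _) (h p v (J i p _)) (h p (D i u v) w) (h p v (D i u w)).
by move=> x1 x2 x3 x4 E'; lra.
Qed.

(** The infinitesimal rotation of the frame defined by theta; i + 1 and i + 2 are
   the indices that complete i to an even permutation. *)
Let C i u : 'End('rV[R]_m) := (2 * delta) *: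
  (theta (i + 2) u *: J (i + 1) p - theta (i + 1) u *: J (i + 2) p).

Let CE i j k u w : even3 i j k -> C i u w = (2 * delta) *:
  (theta k u *: J j p w - theta j u *: J k p w).
Proof.
by move=> /even3_succ[-> ->]; rewrite /C !(scale_lfunE, add_lfunE, opp_lfunE).
Qed.

Let B i u w := D i u w - C i u w.

Let BE i j k u w : even3 i j k -> B i u w = D i u w - (2 * delta) *:
  (theta k u *: J j p w - theta j u *: J k p w).
Proof. by move=> ev; rewrite /B (CE _ _ ev). Qed.

Let products i j k v : even3 i j k ->
  ((J i p (J j p v) = J k p v) * (J j p (J i p v) = - J k p v) *
  (J j p (J k p v) = J i p v) * (J k p (J j p v) = - J i p v) *
  (J k p (J i p v) = J j p v) * (J i p (J k p v) = - J j p v))%type.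
Proof.
move=> ev; have ev1 := even3_rot ev; have ev2 := even3_rot ev1.
have [? ?] := J_mul ev v Up; have [? ?] := J_mul ev1 v Up.
by have [? ?] := J_mul ev2 v Up.
Qed.

Let D_anti i u v : D i u (J i p v) = - J i p (D i u v).
Proof.
have E : nabla (fun q => J i q (J i q (coord_field p v q))) p u = - G u v.
  have sN : smooth_vf W (fun q => -1 *: coord_field p v q).
    by apply: smooth_vf_scale => //; exact: smooth_fun_cst.
  have sJJ : smooth_vf W (fun q => J i q (J i q (coord_field p v q))).
    by apply: (smooth_vf_ext oW _ sN) => q [Uq _]; rewrite J_sq // scaleN1r.
  rewrite (conn_local nc oW Wp sJJ sN); last first.
    by move=> q [Uq _]; rewrite J_sq // scaleN1r.
  rewrite (conn_leibniz nc u oW Wp (@smooth_fun_cst _ _ _ W (-1)) (sE v)).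
  by rewrite dfun_cst scale0r add0r scaleN1r.
have /= := endo_derive_field nc u oU Up (sJ i) oW Wp (sJE i v).
rewrite coord_field_self /D => <-; rewrite E -/(G u v) nablaJ linearD /= J_sq // opprD opprK.
by rewrite addrCA addNr addr0.
Qed.

(** The Leibniz rule for a composite of endomorphisms. *)
Let D_comp i j u v : endo_derive nabla (fun q => (J i q \o J j q)%VF) p u v =
  D i u (J j p v) + J i p (D j u v).
Proof.
have /= := endo_derive_field nc u oU Up (sJ i) oW Wp (sJE j v).
rewrite coord_field_self /D => <-; rewrite nablaJ /endo_derive linearD /= comp_lfunE.
rewrite opprD addrA addrAC subrK; congr (_ - _).
by congr (nabla _ p u); apply/funext => q; rewrite comp_lfunE.
Qed.

Let D_eq (A A' : X -> 'End('rV[R]_m)) u v :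
  smooth_vf W (fun q => A q (coord_field p v q)) ->
  smooth_vf W (fun q => A' q (coord_field p v q)) ->
  (forall q w, W q -> A q w = A' q w) ->
  endo_derive nabla A p u v = endo_derive nabla A' p u v.
Proof.
move=> sA sA' E; rewrite /endo_derive E //.
by rewrite (conn_local nc oW Wp sA sA') // => q Wq; exact: E.
Qed.

Let D_der i j k u v : even3 i j k ->
  D k u v = D i u (J j p v) + J i p (D j u v) /\
  D k u v = - (D j u (J i p v) + J j p (D i u v)).
Proof.
move=> ev; have sk := sJE k v; split; rewrite -D_comp.
  apply: D_eq => //.
    apply: (smooth_vf_ext oW _ sk) => q [Uq _].
    by rewrite comp_lfunE; have [-> _] := J_mul ev (coord_field p v q) Uq.
  by move=> q w [Uq _]; rewrite comp_lfunE; have [-> _] := J_mul ev w Uq.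
have E q : W q -> (J j q \o J i q)%VF (coord_field p v q) = -1 *: J k q (coord_field p v q).
  move=> [Uq _]; rewrite comp_lfunE; have [_ ->] := J_mul ev (coord_field p v q) Uq.
  by rewrite scaleN1r.
have sN : smooth_vf W (fun q => -1 *: J k q (coord_field p v q)).
  by apply: smooth_vf_scale => //; exact: smooth_fun_cst.
have sJJ : smooth_vf W (fun q => (J j q \o J i q)%VF (coord_field p v q)).
  by apply: (smooth_vf_ext oW _ sN) => q Wq; rewrite E.
rewrite /D /endo_derive (conn_local nc oW Wp sJJ sN E).
rewrite (conn_leibniz nc u oW Wp (@smooth_fun_cst _ _ _ W (-1)) sk).
rewrite dfun_cst scale0r add0r scaleN1r comp_lfunE.
by have [_ ->] := J_mul ev (nabla (coord_field p v) p u) Up; rewrite opprK opprD opprK.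
Qed.

Let J_expand l d a b v w :
  J l p (d - (2 * delta) *: (a *: v - b *: w)) =
  J l p d - (2 * delta) *: (a *: J l p v - b *: J l p w).
Proof. by rewrite linearB linearZ linearB !linearZ. Qed.

(** [hitchin] applies to the difference [B] of [D] and [C]: both [D] and the rotation
    [C] are derivations compatible with the quaternion relations, and they have
    the same cyclic sums by [domega]. *)
Lemma quaternionic_endo_derive i j k u w : even3 i j k ->
  endo_derive nabla (J i) p u w = (2 * delta) *:
    (theta k u *: J j p w - theta j u *: J k p w).
Proof.
move=> ev; apply/eqP; rewrite -subr_eq0; apply/eqP; rewrite -(CE _ _ ev).
rewrite -/(D i u w) -/(B i u w) {ev j k}.
apply: (@hitchin R 'rV[R]_m (h p) (fun i => fun_of_lfun (J i p))).
- by move=> v a x y; rewrite (metricDl hm) (metricZl hm).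
- exact: metric_linear.
- exact: metric_nondeg.
- by move=> l v; exact: J_sq.
- by move=> l j k ev v; exact: J_mul.
- by move=> l x y; exact: J_skew.
- move=> l v a x y.
  have E : D l (a *: x + y) v = a *: D l x v + D l y v.
    exact: endo_derive_linear1.
  rewrite /B E.
  have ev := even3_self l; rewrite !(CE _ _ ev) !linearP.
  apply/rowP => r; rewrite !mxE; ring.
- move=> l v a x y; 
  have E : D l v (a *: x + y) = a *: D l v x + D l v y.
    exact: (endo_derive_linear2 nc v oU Up (sJ l)).
  rewrite /B E.
  rewrite linearP; apply/rowP => r; rewrite !mxE; ring.
- move=> l x y z; have ev := even3_self l; have := domega ev x y z.
  rewrite /= !derive_om !coord_field_self.
  have B_E a b c : h p (B l a b) c =
    - h p b (D l a c) + 2 * delta * (theta (l + 2) a * h p b (J (l + 1) p c)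
       - theta (l + 1) a * h p b (J (l + 2) p c)).
    have -> : h p (B l a b) c = h p (D l a b) c + h p (- C l a b) c.
      exact: (metricDl hm).
    rewrite D_skew (CE _ _ ev); move: (h p b (D l a c)) => d.
    rewrite !(metricDl hm, metricNl hm, metricZl hm) !J_skew //; ring.
  rewrite !B_E (christoffel_sym y x) (christoffel_sym z x) (christoffel_sym z y).
  rewrite (Defs.metric_sym hm p (G x y) (J l p z)) (Defs.metric_sym hm p (G x z) (J l p y)).
  rewrite (Defs.metric_sym hm p (G y z) (J l p x)) !J_skew //.
  move: (h p z (J l p (G x y))) (h p y (J l p (G x z))) (h p x (J l p (G y z))).
  move=> g1 g2 g3.
  move: (h p y (D l x z)) (h p z (D l y x)) (h p x (D l z y)) => d1 d2 d3.
  set e1 := theta _ x * _ - _; set e2 := theta _ y * _ - _; set e3 := theta _ z * _ - _.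
  move: e1 e2 e3 => e1 e2 e3 H.
  have H' : d1 + d2 + d3 = 2 * delta * (e1 + e2 + e3) by rewrite -H; ring.
  transitivity (2 * delta * (e1 + e2 + e3) - (d1 + d2 + d3)); first by ring.
  by rewrite H' subrr.
- move=> l x y; have ev := even3_self l; rewrite /B D_anti !(CE _ _ ev).
  move: (D l x y) => d; rewrite /= J_expand !(products _ ev).
  apply/rowP => r; rewrite !mxE; ring.
- move=> a b c ev x y; have ev1 := even3_rot ev; have ev2 := even3_rot ev1.
  have H1 := BE x y ev2; have H2 := BE x (J b p y) ev; have H3 := BE x y ev1.
  have H4 := BE x (J a p y) ev1; have H5 := BE x y ev.
  have [E1 E2] := D_der x y ev; clearbody B.
  split.
    rewrite H1 H2 H3 E1; move: (D a x (J b p y)) (D b x y) => d1 d2.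
    rewrite /= J_expand !(products _ ev) !J_sq //.
    apply/rowP => r; rewrite !mxE; ring.
  rewrite H1 H4 H5 E2; move: (D b x (J a p y)) (D a x y) => d1 d2.
  rewrite /= J_expand !(products _ ev) !J_sq //.
  apply/rowP => r; rewrite !mxE; ring.
Qed.

End QuaternionicDerivative.

(** * The frame defined by a section *)

Lemma smooth_map_sub {R : realType} {m n : nat} {M : manifold R m}
    {N : manifold R n} (W W' : set M) (f : M -> N) :
  W' `<=` W -> smooth_map W f -> smooth_map W' f.
Proof.
move=> WW [cf sf]; split.
  by move=> p; rewrite inE => /WW Wp; apply: cf; rewrite inE.
by move=> p q; apply: smooth_sub (sf p q) => x [px [/WW Wx fx]]; split.
Qed.

Section SectionCase.
Context {R : realType} {n : nat} {M : manifold R (4 * n + 3)%N}.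
Variables (alpha delta : R).
Variables (phi : 'I_3 -> M -> 'End('rV[R]_(4 * n + 3))).
Variables (xi : 'I_3 -> M -> 'rV[R]_(4 * n + 3)).
Variables (eta : 'I_3 -> M -> {scalar 'rV[R]_(4 * n + 3)}).
Variables (g : M -> 'rV[R]_(4 * n + 3) -> 'rV[R]_(4 * n + 3) -> R).
Hypothesis Ms : sasaki3 alpha delta phi xi eta g.
Context {N : manifold R (4 * n)%N}.
Variables (gN : N -> 'rV[R]_(4 * n) -> 'rV[R]_(4 * n) -> R).
Hypothesis gN_metric : riemannian_metric gN.
Variable nabla : (N -> 'rV[R]_(4 * n)) -> N -> 'End('rV[R]_(4 * n)).
Hypothesis nabla_lc : levi_civita gN nabla.
Variable pi : M -> N.
Hypothesis pi_can : canonical_submersion xi g gN pi.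

Let M3 : almost_3_contact_metric phi xi eta g. Proof. by case: Ms. Qed.
Let sm_pi : smooth_map setT pi. Proof. by case: pi_can => -[]. Qed.

Variables (U : set N) (s : N -> M).
Hypotheses (oU : open U) (s_sec : smooth_section pi U s).

Let sm_s : smooth_map U s. Proof. by case: s_sec. Qed.
Let piK y : U y -> pi (s y) = y. Proof. by case: s_sec => _; exact. Qed.

Local Notation J := (phi_check pi phi s).

(** s and pi in the charts of q and c, over the coordinate domain A q c *)
Let sg q c := in_coords s q c.
Let pg q c := in_coords pi c q.
Let A q c := map_dom U s q c.

Let oA q c : open (A q c). Proof. exact: map_dom_open. Qed.

Let AE q c x : A q c x ->
  [/\ ccod q x, cdom q (cfrom q x), U (cfrom q x) & cdom c (s (cfrom q x))].
Proof. by move=> [qx [Ux cx]]; split => //; exact: cfrom_dom. Qed.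

Let sgE q c x : A q c x -> cfrom c (sg q c x) = s (cfrom q x).
Proof. by move=> /AE[_ _ _ cx]; rewrite /sg /in_coords /= ctoK. Qed.

Let A_cod q c x : A q c x -> ccod c (sg q c x).
Proof. by move=> /AE[_ _ _ cx]; exact: to_cod. Qed.

Let ds_coord_field q c x u : A q c x ->
  dmap s (cfrom q x) (coord_field q u (cfrom q x)) =
  coord_field c ('D_u (sg q c) x) (s (cfrom q x)).
Proof.
move=> Ax; have [qx qy Uy cy] := AE Ax.
by rewrite (dmap_coord_field oU sm_s u Uy qy cy) cfromK.
Qed.

Let dpi_coord_field q c x w : A q c x ->
  dmap pi (s (cfrom q x)) (coord_field c w (s (cfrom q x))) =
  coord_field q ('D_w (pg q c) (sg q c x)) (cfrom q x).
Proof.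
move=> Ax; have [qx qy Uy cy] := AE Ax.
have qy' : cdom q (pi (s (cfrom q x))) by rewrite piK.
rewrite (dmap_coord_field openT sm_pi w I cy qy') piK //.
Qed.

Lemma dpi_ds y v : U y -> dmap pi (s y) (dmap s y v) = v.
Proof.
move=> Uy; have yy := cdom_self y; have sy := cdom_self (s y).
have Ay : A y (s y) (cto y y) by exact: cto_coords.
have := ds_coord_field v Ay; rewrite ctoK // coord_field_self => ->.
have := dpi_coord_field ('D_v (sg y (s y)) (cto y y)) Ay; rewrite ctoK // => ->.
rewrite coord_field_self.
transitivity ('D_v (id : 'rV[R]_(4 * n) -> _) (cto y y)); last first.
  by rewrite derive_id.
have piy : cdom y (pi (s y)) by rewrite piK.
apply/esym; apply: (@derive_comp_near _ _ _ _ (A y (s y))) => //.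
- move=> x Ax; have [qx qy Ux cx] := AE Ax.
  by rewrite /pg /in_coords /= sgE // piK // cfromK.
- exact: (in_coords_diff sm_s Uy yy sy).
- have := in_coords_diff sm_pi I sy piy.
  by rewrite /sg in_coords_point.
Qed.

Lemma phi_checkE i y : U y -> J i y = proj_phi phi pi i (s y).
Proof.
move=> Uy; apply/lfunP => v; rewrite -{2}(dpi_ds v Uy).
by rewrite (proj_phiE M3 pi_can) /phi_check !comp_lfunE.
Qed.

Lemma phi_check_sq i y v : U y -> J i y (J i y v) = - v.
Proof. by move=> Uy; rewrite phi_checkE // (proj_phi_sq M3 pi_can). Qed.

Lemma phi_check_mul i j k : even3 i j k -> forall y v, U y ->
  J i y (J j y v) = J k y v /\ J j y (J i y v) = - J k y v.
Proof.
move=> ev y v Uy; rewrite !phi_checkE //.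
exact: (proj_phi_mul M3 pi_can _ _ ev).
Qed.

Lemma phi_check_skew i y u v : U y -> gN y (J i y u) v = - gN y u (J i y v).
Proof.
move=> Uy; rewrite phi_checkE // -{1 3}(piK Uy).
exact: (proj_phi_skew M3 gN_metric pi_can).
Qed.

Lemma phi_check_orth i y u v : U y -> gN y (J i y u) (J i y v) = gN y u v.
Proof.
move=> Uy; rewrite phi_check_skew // phi_check_sq // (metricNr gN_metric).
exact: opprK.
Qed.

(** In charts the endomorphism is the composite of the derivatives of [s] and [pi]
    with [phi_i], each of which depends smoothly on the point. *)
Lemma smooth_phi_check i : smooth_endo U (J i).
Proof.
move=> W Y oW WU sY q; apply: smooth_local => x0 [qx0 Wx0].
set c := s (cfrom q x0).
have sW : smooth_map W s by exact: smooth_map_sub WU sm_s.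
pose A0 := map_dom W s q c.
have oA0 : open A0 by exact: map_dom_open.
have A0A : A0 `<=` A q c by move=> x [qx [/WU Wx cx]]; split.
exists A0; first by split => //; split => //; exact: cdom_self.
have acm : almost_contact_metric (phi i) (xi i) (eta i) g by case: M3.
have sphi w : smooth_vf (cdom c) (fun p => phi i p (coord_field c w p)).
  apply: (acm_phi_smooth acm); [exact: cdom_open|exact: subsetT|exact: smooth_coord_field].
pose F z w : 'rV[R]_(4 * n + 3) := tchange (cfrom c z) c
  (phi i (cfrom c z) (coord_field c w (cfrom c z))).
have F_lin z : linear (F z).
  by move=> a u v; rewrite /F coord_field_linear !linearP.
have sF w : smooth_on (ccod c) (F ^~ w).
  have sf : smooth_on (coords c (cdom c)) (F ^~ w) := @sphi w c.
  by apply: smooth_sub sf => x cx; split=> //; exact: cfrom_dom.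
pose Yq x := vf_in_chart q Y x.
pose Y1 x := 'D_(Yq x) (sg q c) x.
pose Y2 x := F (sg q c x) (Y1 x).
pose Y3 x := 'D_(Y2 x) (pg q c) (sg q c x).
have A0x x : A0 x -> [/\ A q c x, ccod q x, cdom q (cfrom q x), U (cfrom q x) &
    W (cfrom q x) /\ cdom c (s (cfrom q x))].
  move=> A0x; have Ax := A0A _ A0x; have [? ? ? ?] := AE Ax.
  by split => //; case: A0x => _ [? ?]; split.
have ssg : smooth_on A0 (sg q c) by exact: smooth_in_coords sW q c.
pose B := map_dom setT pi c q.
have oB : open B by exact: map_dom_open openT sm_pi _ _.
have spg : smooth_on B (pg q c) by exact: smooth_in_coords sm_pi c q.
have AB x : A0 x -> B (sg q c x).
  move=> /A0x[Ax qx qy Uy [Wy cy]]; split; first exact: A_cod.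
  by split => //=; rewrite sgE // piK.
have E x : A0 x -> Y3 x = vf_in_chart q (fun y => J i y (Y y)) x.
  move=> /A0x[Ax qx qy Uy [Wy cy]].
  rewrite /vf_in_chart -/(cfrom q) tchangeE.
  have Yy : Y (cfrom q x) = coord_field q (Yq x) (cfrom q x).
    by rewrite {1}(vf_decomp Y qy) cfromK.
  rewrite {1}Yy /phi_check !comp_lfunE (ds_coord_field _ Ax) -/(Y1 x).
  have -> : phi i (s (cfrom q x)) (coord_field c (Y1 x) (s (cfrom q x))) =
      coord_field c (Y2 x) (s (cfrom q x)).
    by rewrite /Y2 /F sgE // tchangeE coord_field_dtransK.
  by rewrite (dpi_coord_field _ Ax) dtrans_coord_fieldK.
have dsg x : A0 x -> differentiable (sg q c) x by exact: smooth_diff.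
have dpg x : A0 x -> differentiable (pg q c) (sg q c x).
  by move=> /AB; exact: smooth_diff.
have sYq : smooth_on A0 Yq.
  by apply: smooth_sub (sY q) => x [qx [Wx _]]; split.
have sY1 : smooth_on A0 Y1.
  apply: (@smooth_apply _ _ _ _ _ (fun x v => 'D_v (sg q c) x)) => //.
    by move=> x /dsg dx a u v; exact: derive_linear.
  by move=> a; exact: smooth_derive.
have sY2 : smooth_on A0 Y2.
  apply: (@smooth_apply _ _ _ _ _ (fun x v => F (sg q c x) v)) => //.
  move=> a; apply: (@smooth_comp _ _ _ _ _ (ccod c) (F ^~ (delta_mx 0 a))) => //.
    exact: cod_open.
  by move=> x /A0x[Ax _ _ _ _]; exact: A_cod.
apply: (smooth_eq oA0 E).
apply: (@smooth_apply _ _ _ _ _ (fun x v => 'D_v (pg q c) (sg q c x))) => //.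
  by move=> x /dpg dx a u v; exact: derive_linear.
move=> a; apply: (@smooth_comp _ _ _ _ _ B ('D_(delta_mx 0 a) (pg q c))) => //.
exact: smooth_derive.
Qed.

(** Since [pi o s] is the identity, the pulled-back forms [omega] along [s] are the
    Kaehler forms of the frame, so [cyclic_derive_omega] is the hypothesis
    [domega] of [quaternionic_endo_derive]. *)
Lemma phi_check_cov_derive i j k : even3 i j k -> forall y X, U y ->
  is_cov_derive nabla (J i) y X
    ((2 * delta) *: (eta_check eta s k y X *: J j y
                     - eta_check eta s j y X *: J k y)).
Proof.
move=> ev y X Uy; have yy := cdom_self y; have sy := cdom_self (s y).
pose c := s y; pose x0 := cto y y.
have Ax0 : A y c x0 by exact: cto_coords.
have fx0 : cfrom y x0 = y by exact: ctoK.
have ssg : smooth_on (A y c) (sg y c) by exact: smooth_in_coords sm_s y c.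
have cod_sg x : A y c x -> ccod c (sg y c x) by exact: A_cod.
pose th l : {scalar 'rV[R]_(4 * n)} := (eta l c \o dmap s y).
have thE l u : theta eta (sg y c) c l x0 u = th l u.
  rewrite /theta /pt /push /pt sgE // fx0 /=.
  by have := ds_coord_field u Ax0; rewrite fx0 coord_field_self => ->.
have omE l x u v : A y c x -> omega phi gN pi (sg y c) c l x u v =
    gN (cfrom y x) (coord_field y u (cfrom y x))
      (J l (cfrom y x) (coord_field y v (cfrom y x))).
  move=> Ax; have [qx qy Ux cx] := AE Ax.
  have d u' : dmap pi (s (cfrom y x)) (coord_field c ('D_u' (sg y c) x) (s (cfrom y x))) =
      coord_field y u' (cfrom y x).
    by rewrite -(ds_coord_field u' Ax) dpi_ds.
  rewrite (phi_checkE l Ux) -(d u) -(d v) -{1}(piK Ux).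
  by rewrite /omega /push /pt (sgE Ax).
have om0 l u v : omega phi gN pi (sg y c) c l x0 u v = gN y u (J l y v).
  by rewrite omE // fx0 !coord_field_self.
apply: (is_cov_deriveP (lc_connection nabla_lc) oU Uy (@smooth_phi_check i)).
move=> w; rewrite (@quaternionic_endo_derive _ _ _ _ gN_metric _ nabla_lc U J y oU Uy
  (fun i => @smooth_phi_check i) phi_check_sq phi_check_mul phi_check_skew delta th
  _ i j k X w ev).
  by rewrite !(scale_lfunE, add_lfunE, opp_lfunE).
move=> a b d evb u v z; cbv zeta.
have E l v' z' u' :
    dfun (fun q => gN q (coord_field y v' q) (J l q (coord_field y z' q))) y u' =
    'D_u' (fun x => omega phi gN pi (sg y c) c l x v' z') x0.
  apply: near_eq_derive; apply: (near_eq_open (@oA y c)) => // x Ax.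
  by rewrite omE.
rewrite !E.
rewrite (cyclic_derive_omega Ms pi_can (@oA y c) ssg cod_sg _ _ _ evb Ax0).
by rewrite !thE !om0 !coord_field_self.
Qed.

End SectionCase.

(** * Straightening the submersion *)

Section Straighten.
Context {R : realType} {n : nat} {M : manifold R (4 * n + 3)%N}.
Variables (alpha delta : R).
Variables (phi : 'I_3 -> M -> 'End('rV[R]_(4 * n + 3))).
Variables (xi : 'I_3 -> M -> 'rV[R]_(4 * n + 3)).
Variables (eta : 'I_3 -> M -> {scalar 'rV[R]_(4 * n + 3)}).
Variables (g : M -> 'rV[R]_(4 * n + 3) -> 'rV[R]_(4 * n + 3) -> R).
Hypothesis Ms : sasaki3 alpha delta phi xi eta g.
Context {N : manifold R (4 * n)%N}.
Variables (gN : N -> 'rV[R]_(4 * n) -> 'rV[R]_(4 * n) -> R).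
Hypothesis gN_metric : riemannian_metric gN.
Variable pi : M -> N.
Hypothesis pi_can : canonical_submersion xi g gN pi.

Let M3 : almost_3_contact_metric phi xi eta g. Proof. by case: Ms. Qed.
Let sm_pi : smooth_map setT pi. Proof. by case: pi_can => -[]. Qed.

Variable c : M.
Let a := pi c.
Let x0 := cto c c.
Let cc := cdom_self c.
Let aa : cdom a (pi c) := cdom_self a.

Definition eta_mx : 'M[R]_(4 * n + 3, 3) :=
  \matrix_(b, l) eta l c (delta_mx 0 b).

Lemma mul_eta_mx v l : (v *m eta_mx) 0 l = eta l c v.
Proof.
rewrite {2}[v]row_sum_delta linear_sum mxE; apply: eq_bigr => b _.
by rewrite linearZ mxE.
Qed.

(** The forms [eta_l] at [c], extended as constant linear forms, complete the
    coordinates of [pi] to a local coordinate system: they are independent on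
    the kernel of the differential of [pi]. *)
Definition straight z : 'rV[R]_(4 * n + 3) :=
  row_mx (in_coords pi c a z) (z *m eta_mx).

Let B0 := map_dom setT pi c a.
Let oB0 : open B0. Proof. exact: map_dom_open openT sm_pi _ _. Qed.
Let Bx0 : B0 x0. Proof. by apply: cto_coords. Qed.
Let spi : smooth_on B0 (in_coords pi c a).
Proof. exact: smooth_in_coords sm_pi c a. Qed.

Let smooth_lin : smooth_on B0 (fun z : 'rV[R]_(4 * n + 3) => z *m eta_mx).
Proof.
apply/(smooth_rowP _ oB0) => l.
apply: (@smooth_eq _ _ _ _ 
  (fun z : 'rV[R]_(4 * n + 3) => \sum_b z 0 b * eta_mx b l : R)) => //.
  by move=> z _; rewrite mxE.
apply: smooth_sum => // b; apply: smoothM => //; last exact: smooth_cst.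
by move: b; apply/(smooth_rowP _ oB0); exact: smooth_id.
Qed.

Lemma smooth_straight : smooth_on B0 straight.
Proof.
apply/(smooth_rowP _ oB0) => j; case: (split_ordP j) => [i ->|l ->].
  apply: (@smooth_eq _ _ _ _ (fun z => in_coords pi c a z 0 i)) => //.
    by move=> z _; rewrite row_mxEl.
  by move: i; apply/(smooth_rowP _ oB0).
apply: (@smooth_eq _ _ _ _ 
  (fun z : 'rV[R]_(4 * n + 3) => (z *m eta_mx) 0 l)) => //.
  by move=> z _; rewrite row_mxEr.
by move: l; apply/(smooth_rowP _ oB0).
Qed.

Lemma derive_straight_inj v : 'D_v straight x0 = 0 -> v = 0.
Proof.
move=> Dv; have dst := smooth_diff smooth_straight Bx0.
have dpi := smooth_diff spi Bx0; have dlin := smooth_diff smooth_lin Bx0.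
have E1 : 'D_v (in_coords pi c a) x0 = 0.
  apply/rowP => i; rewrite (derive_coord v i dpi) mxE.
  have := congr1 (fun w : 'rV[R]_(4 * n + 3) => w 0 (lshift 3 i)) Dv.
  rewrite /= (derive_coord v _ dst) mxE => <-.
  by congr ('D_v _ x0); apply/funext => z; rewrite row_mxEl.
have E2 l : eta l c v = 0.
  have [_ D2] := @derive_mulmxr _ _ _ _ id eta_mx x0 v
     (smooth_diff (@smooth_id R _ B0) Bx0).
  rewrite derive_id in D2; rewrite -mul_eta_mx -D2 (derive_coord v l dlin).
  have := congr1 (fun w : 'rV[R]_(4 * n + 3) => w 0 (rshift (4 * n) l)) Dv.
  rewrite /= (derive_coord v _ dst) mxE => <-.
  by congr ('D_v _ x0); apply/funext => z; rewrite row_mxEr.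
have : dmap pi c v = 0.
  have := dmap_coord_field openT sm_pi v I cc aa.
  by rewrite coord_field_self E1 => ->; rewrite /coord_field linear0.
move=> /(vertical_decomp M3 pi_can) ->; rewrite big1 // => l _.
by rewrite E2 scale0r.
Qed.

Lemma straighten : exists (O B : set 'rV[R]_(4 * n + 3)) H,
  [/\ open O, O x0, O `<=` B0 & open B] /\
  [/\ forall x, O x -> B (straight x) /\ H (straight x) = x,
      forall y, B y -> O (H y) /\ straight (H y) = y & smooth_on B H].
Proof. exact: inverse_function oB0 Bx0 smooth_straight derive_straight_inj. Qed.

End Straighten.

(** * Local sections and constancy along the fibres *)

Lemma smooth_row_mx {R : realType} m p (t : 'rV[R]_p) :
  smooth_on setT (fun z : 'rV[R]_m => row_mx z t).
Proof.
have oT : open (setT : set 'rV[R]_m) by exact: openT.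
apply/(smooth_rowP _ oT) => j; case: (split_ordP j) => [i ->|l ->].
  apply: (@smooth_eq _ _ _ _ (fun z : 'rV[R]_m => z 0 i)) => //.
    by move=> z _; rewrite row_mxEl.
  by move: i; apply/(smooth_rowP _ oT); exact: smooth_id.
apply: (@smooth_eq _ _ _ _ (fun z : 'rV[R]_m => t 0 l)) => //.
  by move=> z _; rewrite row_mxEr.
exact: smooth_cst.
Qed.

Lemma derive_lsubmx {R : realType} m p (b u : 'rV[R]_(m + p)) :
  'D_u (lsubmx : 'rV[R]_(m + p) -> 'rV[R]_m) b = lsubmx u.
Proof.
have dl : differentiable (lsubmx : 'rV[R]_(m + p) -> 'rV[R]_m) b.
  exact: differentiable_lsubmx.
have did : differentiable (id : 'rV[R]_(m + p) -> _) b.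
  exact: (smooth_diff (@smooth_id R _ setT)).
apply/rowP => i; rewrite (derive_coord u i dl) mxE.
transitivity ('D_u (fun z : 'rV[R]_(m + p) => z 0 (lshift p i)) b).
  by congr ('D_u _ b); apply/funext => z; rewrite mxE.
by rewrite -(derive_coord u (lshift p i) did) derive_id.
Qed.

Section Fibres.
Context {R : realType} {n : nat} {M : manifold R (4 * n + 3)%N}.
Variables (alpha delta : R).
Variables (phi : 'I_3 -> M -> 'End('rV[R]_(4 * n + 3))).
Variables (xi : 'I_3 -> M -> 'rV[R]_(4 * n + 3)).
Variables (eta : 'I_3 -> M -> {scalar 'rV[R]_(4 * n + 3)}).
Variables (g : M -> 'rV[R]_(4 * n + 3) -> 'rV[R]_(4 * n + 3) -> R).
Hypothesis Ms : sasaki3 alpha delta phi xi eta g.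
Context {N : manifold R (4 * n)%N}.
Variables (gN : N -> 'rV[R]_(4 * n) -> 'rV[R]_(4 * n) -> R).
Hypothesis gN_metric : riemannian_metric gN.
Variable pi : M -> N.
Hypothesis pi_can : canonical_submersion xi g gN pi.

Let M3 : almost_3_contact_metric phi xi eta g. Proof. by case: Ms. Qed.
Let sm_pi : smooth_map setT pi. Proof. by case: pi_can => -[]. Qed.

(** In straightened coordinates, keep the last three coordinates constant. *)
Lemma local_section c : exists U s, [/\ open U, U (pi c) & smooth_section pi U s].
Proof.
set a := pi c; pose x0 := cto c c.
have [V0 [B [H [[oO Ox0 OB0 oB] HH]]]] := straighten Ms pi_can c.
have [HO HB sH] := HH.
pose t0 := x0 *m eta_mx eta c.
pose r0 (z : 'rV[R]_(4 * n)) : 'rV[R]_(4 * n + 3) := row_mx z t0.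
have sr0 A : smooth_on A r0 by apply: smooth_sub (@smooth_row_mx R _ _ t0).
have cr0 : continuous r0.
  by move=> z; apply: differentiable_continuous; exact: (smooth_diff (@sr0 setT)).
pose A1 : set 'rV[R]_(4 * n) := r0 @^-1` B.
have oA1 : open A1 by apply: open_comp => // z _; exact: cr0.
pose K z := H (r0 z).
have sK : smooth_on A1 K by exact: (@smooth_comp _ _ _ _ A1 B H r0).
have KO z : A1 z -> V0 (K z) by move=> /HB[].
have KB0 z : A1 z -> map_dom setT pi c a (K z) by move=> /KO/OB0.
pose s y := cfrom c (K (cto a y)).
pose U := cdom a `&` cto a @^-1` A1.
have oU : open U.
  by apply: open_preimage_in => //; [exact: cdom_open|exact: to_continuous].
have cs : {in U, continuous s}.
  move=> y; rewrite inE => -[ay A1y].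
  have c1 : {for y, continuous (cto a)} by apply: to_continuous; rewrite inE.
  have c2 : {for cto a y, continuous K}.
    by apply: differentiable_continuous; exact: (smooth_diff sK).
  have c3 : {for K (cto a y), continuous (cfrom c)}.
    by apply: from_continuous; rewrite inE; have [] := KB0 _ A1y.
  exact: (continuous_comp (continuous_comp c1 c2) c3).
have pis y : U y -> pi (s y) = y.
  move=> [ay A1y]; have [Kc [_ Ka]] := KB0 _ A1y.
  have [_ E] := HB _ A1y.
  have : lsubmx (straight eta pi c (K (cto a y))) = cto a y.
    by rewrite E row_mxKl.
  rewrite row_mxKl => E'.
  exact: etrans (esym (ctoK Ka)) (etrans (congr1 (cfrom a) E') (ctoK ay)).
exists U, s; split => //.
  split; first exact: cdom_self.
  by have [] := HO _ Ox0; rewrite /A1 /straight /= in_coords_point //; exact: cdom_self.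
split => //; split => // p q.
pose D := coords p (U `&` s @^-1` cdom q).
have oD : open D.
  by apply: open_coords; apply: open_preimage_in => //; exact: cdom_open.
have D1 x : D x -> [/\ coords p (cdom a) x, A1 (cto a (cfrom p x)) &
    coords c (cdom q) (K (cto a (cfrom p x)))].
  move=> [px [[ax A1x] qx]]; split => //; split => //.
  by have [] := KB0 _ A1x.
have st : smooth_on D (cto a \o cfrom p).
  by apply: smooth_sub (smooth_transition p a) => x /D1[].
have sKt : smooth_on D (fun x => K (cto a (cfrom p x))).
  by apply: (@smooth_comp _ _ _ _ D A1 K (cto a \o cfrom p)) => // x /D1[].
apply: (@smooth_comp _ _ _ _ D (coords c (cdom q)) (cto q \o cfrom c)) => //.
- exact/open_coords/cdom_open.
- exact: smooth_transition.
- by move=> x /D1[].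
Qed.

(** The tensor [sum_i A_i (x) A_i], in terms of the metric; the [A_i] being
    orthogonal, it determines their span. The name refers to the closely related
    Kraines four-form [sum_i Omega_i /\ Omega_i]. *)
Definition kraines p x y x' y' :=
  \sum_i gN (pi p) x (proj_phi phi pi i p y) * gN (pi p) x' (proj_phi phi pi i p y').

(** In straightened coordinates the forms [omega] vanish on vertical vectors, so
    [cyclic_derive_omega] with a vertical [tau] reads
    [D_tau omega_i = 2 delta (theta_k (tau) omega_j - theta_j (tau) omega_k)]:
    along a fibre the [A_i] rotate, and the tensor is constant on segments. *)
Lemma kraines_locally_constant c : exists V : set M,
  [/\ open V, V c & forall p, V p -> pi p = pi c ->
    forall x y x' y', kraines p x y x' y' = kraines c x y x' y'].
Proof.
set a := pi c; pose x0 := cto c c.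
have cc := cdom_self c.
have [V0 [B [H [[oO Ox0 OB0 oB] HH]]]] := straighten Ms pi_can c.
have [HO HB sH] := HH.
pose S := straight eta pi c.
have sS : smooth_on (map_dom setT pi c a) S by apply: smooth_straight; exact: pi_can.
pose b0 := S x0; have [Bb0 Hb0] := HO _ Ox0.
have [r /= r0 rB] : exists2 r, 0 < r & ball b0 r `<=` B.
  by apply/nbhs_ballP; apply: open_nbhs_nbhs.
pose W1 := V0 `&` S @^-1` ball b0 r.
have oW1 : open W1.
  apply: open_preimage_in => //; last exact: ball_open.
  move=> x; rewrite inE => Ox; apply: differentiable_continuous.
  exact: (smooth_diff sS (OB0 _ Ox)).
exists (cdom c `&` cto c @^-1` W1); split.
- by apply: open_preimage_in => //; [exact: cdom_open|exact: to_continuous].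
- by split => //; split => //; exact: ballxx.
move=> p [cp [Op Sp]] pia x y x' y'.
pose P := pt H c.
have Bcod b : B b -> ccod c (H b) by move=> /HB[/OB0[]].
have ls b : B b -> lsubmx b = in_coords pi c a (H b).
  by move=> /HB[_ {1}<-]; rewrite row_mxKl.
have dpush b u : B b ->
    dmap pi (P b) (push H c u b) = coord_field a (lsubmx u) (pi (P b)).
  move=> Bb; have [Ob _] := HB _ Bb; have [cb [_ ab]] := OB0 _ Ob.
  rewrite /push /P /pt (dmap_coord_field openT sm_pi _ I (cfrom_dom cb) ab) (cfromK cb).
  congr (coord_field a _ _); rewrite -(derive_lsubmx b u).
  apply/esym; apply: (@derive_comp_near _ _ _ _ B) => //.
    exact: (smooth_diff sH).
  apply: (smooth_diff (smooth_in_coords sm_pi c a)); exact: OB0.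
pose om := omega phi gN pi H c.
pose th := theta eta H c.
have om0 l b u v : B b -> lsubmx v = 0 -> om l b u v = 0.
  move=> Bb v0; rewrite /om /omega -/(P b) (dpush _ v Bb) v0 /coord_field linear0.
  by rewrite linear0 (metric0r gN_metric).
have om0' l b u v : B b -> lsubmx u = 0 -> om l b u v = 0.
  move=> Bb v0; rewrite /om /omega -/(P b) (dpush _ u Bb) v0 /coord_field linear0.
  by rewrite (metric0l gN_metric).
have omE l b u v : B b -> lsubmx b = cto a a ->
    om l b u v = gN a (lsubmx u) (proj_phi phi pi l (P b) (lsubmx v)).
  move=> Bb lb; rewrite /om /omega -/(P b) (dpush _ u Bb) (dpush _ v Bb).
  have [Ob _] := HB _ Bb; have [cb [_ ab]] := OB0 _ Ob.
  have -> : pi (P b) = a.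
    rewrite -(ctoK ab) -[RHS](ctoK (cdom_self a)) -lb ls //.
  by rewrite !coord_field_self.
have dF l b u1 u2 : B b -> differentiable (fun b => om l b u1 u2) b.
  have sO : smooth_on B (fun b => om l b u1 u2).
    exact: (smooth_omega Ms pi_can oB sH Bcod).
  exact: smooth_diff.
have cyc i j k b u v w : even3 i j k -> B b ->
    'D_u (fun y => om i y v w) b + 'D_v (fun y => om i y w u) b
      + 'D_w (fun y => om i y u v) b =
    2 * delta * ((th k b u * om j b v w - th j b u * om k b v w)
      + (th k b v * om j b w u - th j b v * om k b w u)
      + (th k b w * om j b u v - th j b w * om k b u v)).
  by move=> ev Bb; exact: (cyclic_derive_omega Ms pi_can oB sH Bcod).
clearbody om th.
(* The segment from b0 to the coordinates of p stays in the fibre: only its last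
   three coordinates vary. *)
pose tau := S (cto c p) - b0.
have [BSp HSp] := HO _ Op.
have lb0 : lsubmx b0 = cto a a by rewrite ls // Hb0 in_coords_point.
have lb1 : lsubmx (S (cto c p)) = cto a a by rewrite ls // HSp in_coords_point // pia.
have ltau : lsubmx tau = 0 by rewrite /tau linearB /= lb0 lb1 subrr.
have line t : 0 <= t <= 1 -> B (b0 + t *: tau) /\ lsubmx (b0 + t *: tau) = cto a a.
  move=> t01; split.
    apply: rB; apply: (ball_line _ _ t01); first exact: ballxx.
    have -> : b0 + tau = S (cto c p) by rewrite /tau addrC subrK.
    exact: Sp.
  by rewrite linearD linearZ /= ltau scaler0 addr0.
have Dom i j k b v w : even3 i j k -> B b ->
    'D_tau (fun b => om i b v w) b =
    2 * delta * (th k b tau * om j b v w - th j b tau * om k b v w).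
  move=> ev Bb; have := cyc _ _ _ b tau v w ev Bb.
  have Z (f : 'rV[R]_(4 * n + 3) -> R) u : (forall b, B b -> f b = 0) -> 'D_u f b = 0.
    move=> f0; rewrite (@near_eq_derive _ _ _ _ (fun=> 0)) ?derive_cst //.
    exact: near_eq_open oB f0 Bb.
  rewrite (Z (fun b => om i b w tau)); last by move=> b' Bb'; exact: om0.
  rewrite (Z (fun b => om i b tau v)); last by move=> b' Bb'; exact: om0'.
  have e1 l u : om l b u tau = 0 by exact: om0.
  have e2 l u : om l b tau u = 0 by exact: om0'.
  by rewrite !e1 !e2 !mulr0 !subr0 !addr0.
pose v := row_mx x 0 : 'rV[R]_(4 * n + 3); pose w := row_mx y 0 : 'rV[R]_(4 * n + 3).
pose v' := row_mx x' 0 : 'rV[R]_(4 * n + 3); pose w' := row_mx y' 0 : 'rV[R]_(4 * n + 3).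
pose F l : 'rV[R]_(4 * n + 3) -> R := (fun b => om l b v w).
pose F' l : 'rV[R]_(4 * n + 3) -> R := (fun b => om l b v' w').
pose K : 'rV[R]_(4 * n + 3) -> R := F 0 * F' 0 + F 1 * F' 1 + F 2 * F' 2.
have dK b : B b -> differentiable K b.
  move=> Bb; do 2?apply: differentiableD; apply: differentiableM; exact: dF.
have KE b : B b -> lsubmx b = cto a a ->
    K b = \sum_l gN a x (proj_phi phi pi l (P b) y)
                 * gN a x' (proj_phi phi pi l (P b) y').
  move=> Bb lb; have e012 : even3 0 1 2 by [].
  by rewrite (sum_even3 _ e012) /K /F /F' !fctE !omE // !row_mxKl.
have DK b : B b -> 'D_tau K b = 0.
  move=> Bb; have der l u1 u2 := diff_derivable (v := tau) (@dF l b u1 u2 Bb).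
  have dm l : derivable (F l * F' l) b tau by apply: derivableM; exact: der.
  rewrite deriveD; [|exact: derivableD|exact: dm].
  rewrite deriveD; [|exact: dm|exact: dm].
  rewrite !deriveM; [|exact: der..].
  rewrite (@Dom 0 1 2) // (@Dom 1 2 0) // (@Dom 2 0 1) //.
  rewrite (@Dom 0 1 2) // (@Dom 1 2 0) // (@Dom 2 0 1) //.
  rewrite /F /F' /GRing.scale /=; ring.
have [t t01|t t01 E] := @mvt_dir _ _ K b0 tau 1 ltr01.
  by apply: dK; have [] := line t t01.
move: E; rewrite DK ?mulr0; last first.
  by have [] // := line t; case/andP: t01 => ? ?; rewrite !ltW.
rewrite scale1r => /eqP; rewrite subr_eq0 => /eqP.
have -> : b0 + tau = S (cto c p) by rewrite /tau addrC subrK.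
have P1 : P (S (cto c p)) = p by rewrite /P /pt HSp ctoK.
have P0 : P b0 = c by rewrite /P /pt Hb0 ctoK.
rewrite (KE _ BSp lb1) (KE _ Bb0 lb0) P1 P0 => E.
by rewrite /kraines pia; exact: E.
Qed.

End Fibres.

(** * The quaternionic Kaehler structure of the base *)

Lemma sum_delta (R : nzRingType) (I : finType) (j : I) (d : R) (w u : I -> R) :
  (forall i, u i = (i == j)%:R * d) -> \sum_i u i * w i = d * w j.
Proof.
move=> E; rewrite (bigD1 j) //= big1 => [|i /negbTE ne].
  by rewrite E eqxx mul1r addr0.
by rewrite E ne !mul0r.
Qed.

Section QuaternionicFrameAlgebra.
Context {R : realType} {m : nat} {X : manifold R m}.
Variable h : X -> 'rV[R]_m -> 'rV[R]_m -> R.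
Hypothesis hm : riemannian_metric h.
Variables (x : X) (J : 'I_3 -> 'End('rV[R]_m)).
Hypothesis J_sq : forall i v, J i (J i v) = - v.
Hypothesis J_mul : forall i j k, even3 i j k -> forall v,
  J i (J j v) = J k v /\ J j (J i v) = - J k v.
Hypothesis J_skew : forall i u v, h x (J i u) v = - h x u (J i v).

Lemma skew_orth i e : h x e (J i e) = 0.
Proof.
have := J_skew i e e; rewrite (Defs.metric_sym hm x (J i e)) => E.
by apply: self_opp.
Qed.

(** For distinct [i] and [j], up to sign [h (J j e) (J i e)] is [h e (J k e)], which
    vanishes as [J k] is skew. *)
Lemma frame_orth i j e : h x (J j e) (J i e) = (i == j)%:R * h x e e.
Proof.
have [->|ne] := eqVneq.
  by rewrite J_skew J_sq (metricNr hm) opprK mul1r.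
rewrite mul0r; have [k1 [k2 ev]] := even3_ex j.
have [E|->|->] := even3_cases i ev.
- by rewrite E eqxx in ne.
- by rewrite J_skew; have [-> _] := J_mul ev e; rewrite skew_orth oppr0.
- have ev2 := even3_rot (even3_rot ev).
  rewrite J_skew; have [_ ->] := J_mul ev2 e.
  by rewrite (metricNr hm) skew_orth !oppr0.
Qed.

Lemma frame_coef (c : 'I_3 -> R) j e :
  h x (J j e) (\sum_i c i *: J i e) = c j * h x e e.
Proof.
rewrite (metric_sumr hm) (bigD1 j) //= big1 ?addr0.
  by rewrite (metricZr hm) frame_orth eqxx mul1r.
by move=> i ne; rewrite (metricZr hm) frame_orth (negbTE ne) mul0r mulr0.
Qed.

Lemma frame_dim (e : 'rV[R]_m) : e != 0 ->
  (\dim <<[:: J 0%R; J 1%R; J 2%R]>>%VS = 3)%N.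
Proof.
move=> e0; have he : h x e e != 0 by rewrite gt_eqF // (metric_pos hm).
pose X3 : 3.-tuple 'End('rV[R]_m) := [tuple J 0; J 1; J 2].
suff : free X3 by move=> /eqP.
apply/freeP => c E i.
have S : \sum_l c l *: J l = 0.
  apply: etrans E; apply: eq_bigr => l _; congr (_ *: _).
  by have [->|->|->] := @even3_cases 0 1 2 l isT.
have := frame_coef c i e.
have -> : \sum_l c l *: J l e = 0.
  transitivity ((\sum_l c l *: J l) e); last by rewrite S zero_lfunE.
  by rewrite sum_lfunE; apply: eq_bigr => l _; rewrite scale_lfunE.
rewrite (metric0r hm) => /esym/eqP; rewrite mulf_eq0 (negbTE he) orbF.
by move/eqP.
Qed.

End QuaternionicFrameAlgebra.

Section BaseStructure.
Context {R : realType} {n : nat} {M : manifold R (4 * n + 3)%N}.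
Variables (alpha delta : R).
Variables (phi : 'I_3 -> M -> 'End('rV[R]_(4 * n + 3))).
Variables (xi : 'I_3 -> M -> 'rV[R]_(4 * n + 3)).
Variables (eta : 'I_3 -> M -> {scalar 'rV[R]_(4 * n + 3)}).
Variables (g : M -> 'rV[R]_(4 * n + 3) -> 'rV[R]_(4 * n + 3) -> R).
Hypothesis Ms : sasaki3 alpha delta phi xi eta g.
Context {N : manifold R (4 * n)%N}.
Variables (gN : N -> 'rV[R]_(4 * n) -> 'rV[R]_(4 * n) -> R).
Hypothesis gN_metric : riemannian_metric gN.
Variable nabla : (N -> 'rV[R]_(4 * n)) -> N -> 'End('rV[R]_(4 * n)).
Hypothesis nabla_lc : levi_civita gN nabla.
Variable pi : M -> N.
Hypothesis pi_can : canonical_submersion xi g gN pi.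
Variable e : 'rV[R]_(4 * n).
Hypothesis e_neq0 : e != 0.

Let M3 : almost_3_contact_metric phi xi eta g. Proof. by case: Ms. Qed.
Let nc := lc_connection nabla_lc.

Definition fibre_span p : {vspace 'End('rV[R]_(4 * n))} :=
  <<[:: proj_phi phi pi 0%R p; proj_phi phi pi 1%R p; proj_phi phi pi 2%R p]>>%VS.

Let psq p i v := proj_phi_sq M3 pi_can i p v.
Let pmul p i j k (ev : even3 i j k) v := proj_phi_mul M3 pi_can p v ev.
Let pskew p i u v := proj_phi_skew M3 gN_metric pi_can i p u v.

(** Contracting the tensor with (A_j e, e) isolates A_j on the side of p, and gives a
   combination of the A_i on the side of p'. *)
Let fibre_span_sub p p' : pi p = pi p' ->
  (forall x y x' y', kraines phi gN pi p x y x' y' = kraines phi gN pi p' x y x' y') ->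
  (fibre_span p <= fibre_span p')%VS.
Proof.
move=> pp K; apply: (span3_sub (f := fun l => proj_phi phi pi l p)) => j.
pose A l := proj_phi phi pi l p; pose A' l := proj_phi phi pi l p'.
pose c l := gN (pi p) (A j e) (A' l e).
have ee : gN (pi p) e e != 0 by rewrite gt_eqF // (metric_pos gN_metric).
suff E : A j = (gN (pi p) e e)^-1 *: \sum_l c l *: A' l.
  rewrite -/(A j) E; apply: memvZ; apply: memv_suml => l _; apply: memvZ.
  exact: (span3_mem A').
apply/lfunP => y'; apply: (scalerI ee).
rewrite scale_lfunE scalerA mulfV // scale1r.
apply/eqP; rewrite -subr_eq0; apply/eqP/(metric_nondeg gN_metric (x := pi p)) => x'.
rewrite (metricDl gN_metric) (metricNl gN_metric).
rewrite !(Defs.metric_sym gN_metric _ _ x') (metricZr gN_metric).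
apply/eqP; rewrite subr_eq0; apply/eqP.
have K1 : \sum_i gN (pi p) (A j e) (A i e) * gN (pi p) x' (A i y') =
    \sum_i c i * gN (pi p) x' (A' i y').
  by have := K (A j e) e x' y'; rewrite /kraines -pp.
have orth i : gN (pi p) (A j e) (A i e) = (i == j)%:R * gN (pi p) e e.
  exact: (frame_orth gN_metric (psq p) (pmul p) (pskew p)).
have K2 : \sum_i gN (pi p) (A j e) (A i e) * gN (pi p) x' (A i y') =
    gN (pi p) e e * gN (pi p) x' (A j y').
  exact: (sum_delta (fun i => gN (pi p) x' (A i y')) orth).
rewrite -K2 K1 sum_lfunE (metric_sumr gN_metric); apply: eq_bigr => l _.
by move: (A' l) (c l) => B b; rewrite scale_lfunE (metricZr gN_metric).
Qed.

Let fibre_span_near c : exists V : set M,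
  [/\ open V, V c & forall p, V p -> pi p = pi c -> fibre_span p = fibre_span c].
Proof.
have [V [oV Vc K]] := kraines_locally_constant Ms gN_metric pi_can c.
exists V; split; [exact: oV|exact: Vc|move=> p Vp pc].
apply/eqP; rewrite eqEsubv; apply/andP; split.
  by apply: fibre_span_sub => [//|x y x' y']; exact: K.
by apply: fibre_span_sub => [//|x y x' y']; exact/esym/K.
Qed.

(** The points of a fibre with a given span form an open set, and so do the others;
    the fibre is connected. *)
Lemma fibre_span_constant p p' : pi p = pi p' -> fibre_span p = fibre_span p'.
Proof.
move=> pp; pose F := pi @^-1` [set pi p'].
pose S := [set r | F r /\ fibre_span r = fibre_span p'].
have [V HV] := choice fibre_span_near.
have SF : S = F.
  apply: (csub_connected pi_can).
  - by exists p'.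
  - exists (\bigcup_(r in S) V r).
      by apply: bigcup_open => r _; have [] := HV r.
    apply/seteqP; split => [r Sr|r [Fr [r' [Fr' Sr'] Vr]]].
      by split; [case: Sr|exists r => //; have [] := HV r].
    split; [exact: Fr|have [_ _ H] := HV r'].
    by apply: etrans Sr'; apply: (H _ Vr); rewrite Fr Fr'.
  - exists (~` \bigcup_(r in F `\` S) V r).
      by apply: open_closedC; apply: bigcup_open => r _; have [] := HV r.
    apply/seteqP; split => [r [Fr Sr]|r [Fr nV]].
      split; [exact: Fr|case=> r' [Fr' nS] Vr; apply: nS].
      split; [exact: Fr'|have [_ _ H] := HV r'].
      by apply: etrans Sr; apply/esym/(H _ Vr); rewrite Fr Fr'.
    apply: contrapT => nS; apply: nV; exists r; first by split.
    by have [] := HV r.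
have : S p by rewrite SF.
by case.
Qed.

Let lift_point y : M := sval (cid (subm_onto (csub_submersion pi_can) y)).
Let lift_pointK y : pi (lift_point y) = y.
Proof. exact: svalP (cid (subm_onto (csub_submersion pi_can) y)). Qed.

(** Any point of the fibre would do, by [fibre_span_constant]. *)
Definition base_Q y := fibre_span (lift_point y).

Section WithSection.
Variables (U : set N) (s : N -> M).
Hypotheses (oU : open U) (s_sec : smooth_section pi U s).
Local Notation J := (phi_check pi phi s).

Let piK y : U y -> pi (s y) = y. Proof. by case: s_sec => _ H; exact: H. Qed.

Lemma base_QE y : U y -> base_Q y = <<[:: J 0%R y; J 1%R y; J 2%R y]>>%VS.
Proof.
move=> Uy; rewrite !(phi_checkE Ms pi_can oU s_sec _ Uy).
by apply: fibre_span_constant; rewrite lift_pointK piK.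
Qed.

Lemma phi_check_frame : quaternionic_frame gN base_Q U J.
Proof.
split.
- by move=> i; apply: (smooth_phi_check Ms pi_can oU s_sec).
- by move=> i y v Uy; apply: (phi_check_sq Ms pi_can oU s_sec).
- by move=> i y u v Uy; apply: (phi_check_orth Ms gN_metric pi_can oU s_sec).
- move=> i j k ev y v Uy.
  have [-> ->] := phi_check_mul Ms pi_can oU s_sec ev v Uy.
  by rewrite opprK.
- exact: base_QE.
Qed.

Let sJ i := @smooth_phi_check _ _ _ _ _ _ _ _ _ Ms _ _ _ pi_can _ _ oU s_sec i.

(** Write a section of the bundle as [sum_i f i *: J i]. The coefficients are smooth,
    being inner products of [T E] and [J i E] for a nowhere zero field [E], and
    the covariant derivatives of the [J i] lie in the bundle. *)
Lemma section_parallel (W : set N) (T : N -> 'End('rV[R]_(4 * n))) y v :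
  open W -> smooth_endo W T -> (forall q, W q -> T q \in base_Q q) ->
  W y -> U y -> exists2 A, A \in base_Q y & is_cov_derive nabla T y v A.
Proof.
move=> oW sT TQ Wy Uy.
pose W0 := (W `&` U) `&` cdom y.
have oW0 : open W0 by apply: openI; [exact: openI|exact: cdom_open].
have W0y : W0 y by split => //; exact: cdom_self.
have W0W : W0 `<=` W by move=> q [[]].
have W0U : W0 `<=` U by move=> q [[]].
pose E := coord_field y e.
have sE : smooth_vf W0 E by apply: smooth_vf_sub (@smooth_coord_field _ _ _ y e) => q [].
have En0 q : W0 q -> E q != 0.
  move=> [_ yq]; apply: contra_neq e_neq0 => Eq0.
  by rewrite -(dtrans_coord_fieldK e yq) -/(E q) Eq0 linear0.
have EE q : W0 q -> gN q (E q) (E q) != 0.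
  by move=> /En0 H; rewrite gt_eqF // (metric_pos gN_metric).
pose f i q := gN q (J i q (E q)) (T q (E q)) * (gN q (E q) (E q))^-1.
have sf i : smooth_fun W0 (f i).
  have s1 : smooth_fun W0 (fun q => gN q (J i q (E q)) (T q (E q))).
    by apply: (metric_smooth gN_metric) => //; [exact: sJ|exact: sT].
  have s2 : smooth_fun W0 (fun q => gN q (E q) (E q)).
    exact: (metric_smooth gN_metric).
  move=> q; apply: smoothM; [exact: open_coords|exact: s1|].
  apply: smoothV; [exact: open_coords| |exact: s2].
  by move=> x [_ Wx]; exact: EE.
have TE q u : W0 q -> T q u = \sum_i f i q *: J i q u.
  move=> W0q; have Uq := W0U _ W0q.
  have := TQ q (W0W _ W0q); rewrite (base_QE Uq).
  move=> /(span3P (f := fun l => J l q)) [c Tc].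
  have Tcu w : T q w = \sum_i c i *: J i q w.
    by rewrite Tc sum_lfunE; apply: eq_bigr => l _; rewrite scale_lfunE.
  rewrite Tcu; apply: eq_bigr => i _; congr (_ *: _).
  rewrite /f Tcu (frame_coef gN_metric).
  - by rewrite mulfK // EE.
  - by move=> l w; exact: (phi_check_sq Ms pi_can oU s_sec).
  - by move=> a b d ev w; exact: (phi_check_mul Ms pi_can oU s_sec).
  - by move=> l u1 u2; exact: (phi_check_skew Ms gN_metric pi_can oU s_sec).
pose D i : 'End('rV[R]_(4 * n)) := (2 * delta) *:
  (eta_check eta s (i + 2) y v *: J (i + 1) y
   - eta_check eta s (i + 1) y v *: J (i + 2) y).
have cov i : is_cov_derive nabla (J i) y v (D i).
  exact: (phi_check_cov_derive Ms gN_metric nabla_lc pi_can oU s_sec (even3_self i)).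
exists (\sum_i (dfun (f i) y v *: J i y + f i y *: D i)).
  have memJ l : J l y \in base_Q y.
    by rewrite (base_QE Uy); exact: (span3_mem (fun l => J l y)).
  apply: memv_suml => i _; apply: memvD; first exact: memvZ.
  by apply: memvZ; apply: memvZ; apply: memvB; exact: memvZ.
move=> W1 Y oW1 W1y sY.
pose W2 := W0 `&` W1.
have oW2 : open W2 by exact: openI.
have W2y : W2 y by [].
have sY2 : smooth_vf W2 Y by apply: smooth_vf_sub sY => q [].
have sf2 i : smooth_fun W2 (f i) by apply: smooth_fun_sub (@sf i) => q [].
have sJY i : smooth_vf W2 (fun q => J i q (Y q)).
  by apply: sJ => // q [/W0U].
have sTY : smooth_vf W2 (fun q => T q (Y q)).
  by apply: sT => // q [/W0W].
have TYE q : W2 q -> T q (Y q) = \sum_i f i q *: J i q (Y q).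
  by move=> [W0q _]; exact: TE.
rewrite (conn_expand nc v oW2 W2y sTY sf2 sJY TYE) (TE y _ W0y) -sumrB sum_lfunE.
apply: eq_bigr => i _.
have cY := cov i W2 Y oW2 W2y sY2; move: (D i) cY => B cY.
rewrite add_lfunE !scale_lfunE cY.
by rewrite scalerBr addrA.
Qed.

End WithSection.

Lemma base_quaternionic_kaehler : quaternionic_kaehler gN nabla base_Q.
Proof.
have sect y : exists U s, [/\ open U, U y & smooth_section pi U s].
  by have := local_section Ms pi_can (lift_point y); rewrite lift_pointK.
split.
- move=> y; exact: (frame_dim gN_metric (psq _) (pmul _) (pskew _) e_neq0).
- move=> y; have [U [s [oU Uy ss]]] := sect y.
  exists U, (phi_check pi phi s); split => //; exact: phi_check_frame.
- move=> W T oW sT TQ y v Wy; have [U [s [oU Uy ss]]] := sect y.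
  apply: (@section_parallel U s oU ss W T y v oW sT TQ Wy Uy).
Qed.

End BaseStructure.

Theorem theorem2p2p1 (R : realType) (n : nat) (n_gt0 : (0 < n)%N)
    (M : manifold R (4 * n + 3)%N) (alpha delta : R)
    (phi : 'I_3 -> M -> 'End('rV[R]_(4 * n + 3)))
    (xi : 'I_3 -> M -> 'rV[R]_(4 * n + 3))
    (eta : 'I_3 -> M -> {scalar 'rV[R]_(4 * n + 3)})
    (g : M -> 'rV[R]_(4 * n + 3) -> 'rV[R]_(4 * n + 3) -> R)
    (M_sasaki : sasaki3 alpha delta phi xi eta g)
    (N : manifold R (4 * n)%N)
    (gN : N -> 'rV[R]_(4 * n) -> 'rV[R]_(4 * n) -> R)
    (gN_metric : riemannian_metric gN)
    (nabla : (N -> 'rV[R]_(4 * n)) -> N -> 'End('rV[R]_(4 * n)))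
    (nabla_lc : levi_civita gN nabla)
    (pi : M -> N) (pi_canonical : canonical_submersion xi g gN pi) :
  exists2 Q : N -> {vspace 'End('rV[R]_(4 * n))},
    quaternionic_kaehler gN nabla Q &
    forall (U : set N) (s : N -> M), open U -> smooth_section pi U s ->
      quaternionic_frame gN Q U (phi_check pi phi s) /\
      (forall i j k : 'I_3, even3 i j k ->
       forall (y : N) (X : 'rV[R]_(4 * n)), U y ->
         is_cov_derive nabla (phi_check pi phi s i) y X
           ((2 * delta) *:
              (eta_check eta s k y X *: phi_check pi phi s j y
               - eta_check eta s j y X *: phi_check pi phi s k y))).
Proof.
have [e e0] : exists e : 'rV[R]_(4 * n), e != 0.
  have n4 : (0 < 4 * n)%N by rewrite muln_gt0.
  exists (const_mx 1); apply/eqP => /rowP /(_ (Ordinal n4)).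
  by rewrite !mxE => /eqP; rewrite oner_eq0.
exists (base_Q phi pi_canonical).
  exact: (base_quaternionic_kaehler M_sasaki gN_metric nabla_lc pi_canonical e0).
move=> U s oU ss; split.
  exact: (phi_check_frame M_sasaki gN_metric pi_canonical e0 oU ss).
move=> i j k ev y X Uy.
exact: (phi_check_cov_derive M_sasaki gN_metric nabla_lc pi_canonical oU ss ev X Uy).
Qed.
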